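(* Let $X=(X_i)_{i\in\mathbb N}$ be a sequence of independent Rademacher random variables with $\mathbb P(X_i=1)=p_i\in(0,1)$ and $\mathbb P(X_i=-1)=q_i=1-p_i$. For every $k\in\mathbb N$ and $M>0$ there is a constant $C>0$, depending only on $k$ and $M$, such that the following holds. Let $F\in\mathbb D^{1,2}$ with $\mathbb E[F]=0$, $\operatorname{Var}(F)=1$ and $\mathbb E[F^{2k}]<M$. Assume further that $$F f_z(F)+\mathbf 1_{\{F>z\}}\in\mathbb D^{1,2}\quad\text{for all }z\in\mathbb R,\qquad \frac{1}{\sqrt{pq}}\,DF\,|DL^{-1}F|\in\mathrm{Dom}(\delta).$$ Then, for every $z\in\mathbb R$, $$|\mathbb P(F\le z)-\Phi(z)|\le\frac{C}{(1+|z|)^k}\Bigl(\tfrac{\sqrt{15}}2\sqrt{B_1}+\tfrac{\sqrt3}2\sqrt{B_2}+2\sqrt{B_3}+2\sqrt6\sqrt{B_4}+2\sqrt3\sqrt{B_5}\Bigr),$$ where $$B_1=\sum_{j,m,l\in\mathbb N}\sqrt{\mathbb E[(D_jF)^2(D_mF)^2]}\sqrt{\mathbb E[(D_lD_jF)^2(D_lD_mF)^2]},\qquad B_2=\sum_{j,m,l\in\mathbb N}\frac1{p_lq_l}\mathbb E[(D_lD_jF)^2(D_lD_mF)^2],$$ $$B_3=\sum_{m\in\mathbb N}\frac1{p_mq_m}\mathbb E[(D_mF)^4],\qquad B_4=\sum_{m,l\in\mathbb N}\frac1{p_mq_m}\sqrt{\mathbb E[(D_mF)^4]}\sqrt{\mathbb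 E[(D_lD_mF)^4]},$$ $$B_5=\sum_{m,l\in\mathbb N}\frac1{p_mq_mp_lq_l}\mathbb E[(D_lD_mF)^4].$$
   Context: $\Phi$ is the distribution function and $p_{\mathcal N}(w)=e^{-w^2/2}/\sqrt{2\pi}$ the density of $\mathcal N(0,1)$. For $z\in\mathbb R$, $f_z$ is the Stein solution: $f_z(w)=\Phi(w)(1-\Phi(z))/p_{\mathcal N}(w)$ for $w\le z$ and $f_z(w)=\Phi(z)(1-\Phi(w))/p_{\mathcal N}(w)$ for $w>z$. $Y_i=(X_i-p_i+q_i)/(2\sqrt{p_iq_i})$ are the standardized variables. $\mathcal H=\ell^2(\mathbb N)$ with inner product $\langle\cdot,\cdot\rangle$. $\Delta_n=\{(i_1,\dots,i_n)\in\mathbb N^n: i_j\ne i_l\text{ for }j\ne l\}$, and $\mathcal H_0^{\odot n}$ is the set of symmetric square-summable $f$ on $\mathbb N^n$ vanishing outside $\Delta_n$. Each $F\in L^2(\Omega,\sigma(X),\mathbb P)$ has a unique expansion $F=\mathbb E(F)+\sum_{n\ge1}J_n(f_n)$ in $L^2$, $f_n\in\mathcal H_0^{\odot n}$, with $J_n(f_n)=\sum_{(i_1,\dots,i_n)\in\Delta_n}f_n(i_1,\dots,i_n)Y_{i_1}\cdots Y_{i_n}$. For $\mathbb E(F)=0$, $L^{-1}F=-\sum_{n\ge1}\frac1nJ_n(f_n)$. Writing $F=f(X_1,X_2,\dots)$, the discrete gradient is $D_iF=\sqrt{p_iq_i}\,(F_i^+-F_i^-)$, where $F_i^\pm=f(X_1,\dots,X_{i-1},\pm1,X_{i+1},\dots)$,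 and $DF=(D_1F,D_2F,\dots)$; $D_lD_mF=D_l(D_mF)$. $\mathbb D^{1,2}=\{F\in L^2(\Omega,\sigma(X),\mathbb P):\mathbb E[\sum_i(D_iF)^2]<\infty\}$. $\mathrm{Dom}(\delta)$ (the domain of the adjoint $\delta$ of $D$) consists of $u\in L^2(\Omega,\mathcal H)$ for which there is $C_u>0$ with $|\mathbb E\langle DF,u\rangle|\le C_u\sqrt{\mathbb E(F^2)}$ for all $F\in\mathbb D^{1,2}$. $\frac1{\sqrt{pq}}DF\,|DL^{-1}F|$ denotes the sequence $\bigl(\frac1{\sqrt{p_iq_i}}D_iF\,|D_iL^{-1}F|\bigr)_{i\in\mathbb N}$. *)

(* Defs.v *)
From HB Require Import structures.
From mathcomp Require Import all_boot all_order all_algebra.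
From mathcomp Require Import all_classical all_reals all_analysis.

Set Implicit Arguments.
Unset Strict Implicit.
Unset Printing Implicit Defensive.

Import Order.TTheory GRing.Theory Num.Theory.
Import numFieldNormedType.Exports.

Local Open Scope classical_set_scope.
Local Open Scope ring_scope.

Definition Phi (R : realType) (z : R) : R :=
  fine (normal_prob 0 1 `]-oo, z]%classic).

Definition stein_sol (R : realType) (z w : R) : R :=
  if w <= z then Phi w * (1 - Phi z) / normal_pdf 0 1 w
  else Phi z * (1 - Phi w) / normal_pdf 0 1 w.

(* Here and below q_i = 1 - p_i. *)
Definition pq (R : realType) (p : nat -> R) (i : nat) : R := p i * (1 - p i).

Definition mutually_independent (R : realType) (d : measure_display)
    (T : measurableType d) (P : probability T R) (X : nat -> T -> R) : Prop :=
  forall (s : seq nat) (A : nat -> set R), uniq s ->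
    (forall i, measurable (A i)) ->
    P (\bigcap_(i in [set` s]) X i @^-1` A i) =
      (\prod_(i <- s) P (X i @^-1` A i))%E.

Definition rademacher_sequence (R : realType) (d : measure_display)
    (T : measurableType d) (P : probability T R)
    (X : nat -> {RV P >-> R}) (p : nat -> R) : Prop :=
  [/\ mutually_independent P (fun i => X i : T -> R),
      forall i, 0 < p i < 1,
      forall i, P [set w | X i w = 1] = (p i)%:E &
      forall i, P [set w | X i w = -1] = (1 - p i)%:E].

Definition sigma_of (R : realType) (T : Type) (X : nat -> T -> R) :
    set (set T) :=
  <<s \bigcup_i preimage_set_system setT (X i) measurable >>.

Definition sigma_measurable (R : realType) (T : Type) (X : nat -> T -> R)
    (F : T -> R) : Prop :=
  forall B : set R, measurable B -> sigma_of X (F @^-1` B).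

Definition L2X (R : realType) (d : measure_display) (T : measurableType d)
    (P : probability T R) (X : nat -> T -> R) (F : T -> R) : Prop :=
  sigma_measurable X F /\ ('E_P[fun w => (F w ^+ 2)%R] < +oo)%E.

Definition cvg_L2 (R : realType) (d : measure_display) (T : measurableType d)
    (P : probability T R) (S : nat -> T -> R) (G : T -> R) : Prop :=
  (fun N => 'E_P[fun w => ((S N w - G w) ^+ 2)%R]%E) @ \oo --> 0%E.

(* A functional f with F = f(X_0, X_1, ...), f being measurable for the product
   sigma-algebra of R^nat, i.e. the one generated by the coordinates.  If F is
   sigma(X)-measurable such an f exists, and D below does not depend on the
   choice of f up to almost sure equality. *)
Definition functional_of (R : realType) (T : Type) (X : nat -> T -> R)
    (F : T -> R) : (nat -> R) -> R :=
  get [set f | sigma_measurable (fun (i : nat) (x : nat -> R) => x i) f /\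
               forall w, F w = f (fun i => X i w)].

Definition set_coord (R : realType) (x : nat -> R) (i : nat) (a : R) :
    nat -> R :=
  fun j => if j == i then a else x j.

Definition D (R : realType) (T : Type) (X : nat -> T -> R) (p : nat -> R)
    (i : nat) (F : T -> R) : T -> R :=
  fun w => let f := functional_of X F in let x := fun j => X j w in
    Num.sqrt (pq p i) * (f (set_coord x i 1) - f (set_coord x i (-1))).

Definition D12 (R : realType) (d : measure_display) (T : measurableType d)
    (P : probability T R) (X : nat -> T -> R) (p : nat -> R) (F : T -> R) :
    Prop :=
  L2X P X F /\
  (\int[P]_w (\sum_(0 <= i <oo) ((D X p i F w) ^+ 2)%:E) < +oo)%E.

Definition ell2_inner (R : realType) (a b : nat -> R) : R :=
  limn (series (fun i => a i * b i)).

Definition L2H (R : realType) (d : measure_display) (T : measurableType d)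
    (P : probability T R) (u : nat -> T -> R) : Prop :=
  (forall i, measurable_fun setT (u i)) /\
  (\int[P]_w (\sum_(0 <= i <oo) ((u i w) ^+ 2)%:E) < +oo)%E.

Definition Dom_delta (R : realType) (d : measure_display)
    (T : measurableType d) (P : probability T R) (X : nat -> T -> R)
    (p : nat -> R) (u : nat -> T -> R) : Prop :=
  L2H P u /\
  exists2 C : R, 0 < C & forall F : T -> R, D12 P X p F ->
    (`|'E_P[fun w => ell2_inner (fun i => D X p i F w) (fun i => u i w)]|
       <= C%:E * sqrte 'E_P[fun w => (F w ^+ 2)%R])%E.

Definition Y (R : realType) (T : Type) (X : nat -> T -> R) (p : nat -> R)
    (i : nat) (w : T) : R :=
  (X i w - p i + (1 - p i)) / (2 * Num.sqrt (pq p i)).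

(* N^n is n.-tuple nat, and Delta_n is the set of duplicate-free tuples. *)
Definition H0sym (R : realType) (n : nat) (f : n.-tuple nat -> R) : Prop :=
  [/\ forall i j : n.-tuple nat, perm_eq i j -> f i = f j,
      forall i : n.-tuple nat, ~~ uniq i -> f i = 0 &
      (\esum_(i in [set: n.-tuple nat]) ((f i) ^+ 2)%:E < +oo)%E].

Definition J_partial (R : realType) (T : Type) (X : nat -> T -> R)
    (p : nat -> R) (n : nat) (f : n.-tuple nat -> R) (N : nat) (w : T) : R :=
  \sum_(i : n.-tuple 'I_N | uniq i)
     f (map_tuple (@nat_of_ord N) i) * \prod_(j <- i) Y X p j w.

(* The series J_n(f) converges unconditionally in L^2(P), so its sum is the
   L^2 limit of the partial sums over the cubes {0, ..., N-1}^n. *)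
Definition J (R : realType) (d : measure_display) (T : measurableType d)
    (P : probability T R) (X : nat -> T -> R) (p : nat -> R)
    (n : nat) (f : n.-tuple nat -> R) : T -> R :=
  get [set G | L2X P X G /\ cvg_L2 P (J_partial X p f) G].

Definition chaos_expansion (R : realType) (d : measure_display)
    (T : measurableType d) (P : probability T R) (X : nat -> T -> R)
    (p : nat -> R) (F : T -> R) (f : forall n, n.-tuple nat -> R) : Prop :=
  (forall n, (0 < n)%N -> H0sym (f n)) /\
  cvg_L2 P
    (fun N w => fine 'E_P[F] + \sum_(1 <= n < N.+1) J P X p (f n) w) F.

(* As an element of L^2, L^-1 F is determined only up to almost sure equality;
   this picks a sigma(X)-measurable version. *)
Definition Linv (R : realType) (d : measure_display) (T : measurableType d)
    (P : probability T R) (X : nat -> T -> R) (p : nat -> R) (F : T -> R) :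
    T -> R :=
  get [set G | L2X P X G /\
    exists2 f : forall n, n.-tuple nat -> R, chaos_expansion P X p F f &
      cvg_L2 P
        (fun N w => - \sum_(1 <= n < N.+1) n%:R^-1 * J P X p (f n) w) G].

(* The B_i take values in [0, +oo], with the convention 0 * +oo = 0. *)
Local Open Scope ereal_scope.

Definition B1 (R : realType) (d : measure_display) (T : measurableType d)
    (P : probability T R) (X : nat -> T -> R) (p : nat -> R) (F : T -> R) :
    \bar R :=
  let D := D X p in
  \sum_(0 <= j <oo) \sum_(0 <= m <oo) \sum_(0 <= l <oo)
    (sqrte 'E_P[fun w => ((D j F w) ^+ 2 * (D m F w) ^+ 2)%R] *
     sqrte 'E_P[fun w => ((D l (D j F) w) ^+ 2 * (D l (D m F) w) ^+ 2)%R]).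

Definition B2 (R : realType) (d : measure_display) (T : measurableType d)
    (P : probability T R) (X : nat -> T -> R) (p : nat -> R) (F : T -> R) :
    \bar R :=
  let D := D X p in
  \sum_(0 <= j <oo) \sum_(0 <= m <oo) \sum_(0 <= l <oo)
    ((pq p l)^-1%:E *
     'E_P[fun w => ((D l (D j F) w) ^+ 2 * (D l (D m F) w) ^+ 2)%R]).

Definition B3 (R : realType) (d : measure_display) (T : measurableType d)
    (P : probability T R) (X : nat -> T -> R) (p : nat -> R) (F : T -> R) :
    \bar R :=
  let D := D X p in
  \sum_(0 <= m <oo) ((pq p m)^-1%:E * 'E_P[fun w => ((D m F w) ^+ 4)%R]).

Definition B4 (R : realType) (d : measure_display) (T : measurableType d)
    (P : probability T R) (X : nat -> T -> R) (p : nat -> R) (F : T -> R) :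
    \bar R :=
  let D := D X p in
  \sum_(0 <= m <oo) \sum_(0 <= l <oo)
    ((pq p m)^-1%:E * sqrte 'E_P[fun w => ((D m F w) ^+ 4)%R] *
     sqrte 'E_P[fun w => ((D l (D m F) w) ^+ 4)%R]).

Definition B5 (R : realType) (d : measure_display) (T : measurableType d)
    (P : probability T R) (X : nat -> T -> R) (p : nat -> R) (F : T -> R) :
    \bar R :=
  let D := D X p in
  \sum_(0 <= m <oo) \sum_(0 <= l <oo)
    ((pq p m * pq p l)^-1%:E * 'E_P[fun w => ((D l (D m F) w) ^+ 4)%R]).

(* Main.v *)
From HB Require Import structures.
From mathcomp Require Import all_boot all_order all_algebra.
From mathcomp Require Import all_classical all_reals all_analysis.
From mathcomp Require Import measurable_realfun ring lra.
Require Import Defs.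

(** The theorem is Stein's method with a discrete integration by parts. Put
    [f = stein_sol z], [h = stein_deriv z] and [g = stein_mono z]. Stein's equation
    says that [h w = w * f w + (w <= z) - Phi z], so that
    [P(F <= z) - Phi z = E[h(F)] - E[F f(F)]].

    The variable [F] depends on the path of signs only, so the whole computation is
    done on the space [cube] of sign sequences, under the law of the signs. The one
    property of this law that is used is its disintegration along a coordinate
    ([sign_law_flip]); [D_i] becomes the explicit operator [dif i].

    The operator [- D L^-1] is replaced by a family of finite-dimensional ones. For
    [P_s] keeping each of the first [N] coordinates with probability [s] and
    averaging it out otherwise, let [K_N] be the integral of [P_s] over [s] in [0, 1]
    ([resample N 0 0]). It has an explicit recursive definition, which needs no
    chaos decomposition, and it satisfies
    [F - avg N F = \sum_(j < N) Y_j K_N D_j F] ([resample_by_parts]), where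
    [avg N F] tends to the expectation of [F] in mean square ([mixing_L2]). As
    [K_N D_j F] does not depend on the [j]-th coordinate, [Y_j] is removed by
    integration by parts, and up to a vanishing error
    [E[F f(F)] = \sum_(j < N) E[K_N D_j F * D_j f(F)]] ([Ex_covariance]).

    Next [D_j f(F) = h(F) D_j F + R_j]. The function [h] jumps at [z], but its
    oscillation between two points is at most the increment of the nondecreasing
    function [g], whence [|R_j| <= D_j F * D_j g(F) / sqrt (p_j q_j)]
    ([stein_taylor], [stein_rest_le]). Two errors remain.

    The first one is [E[h(F) (1 - \sum_j D_j F * K_N D_j F)]]. It is at most the
    norm of [h(F)] times the standard deviation of [carre N], up to the vanishing
    difference between [1] and the mean of [carre N]; the Poincare inequality and
    the discrete Leibniz rule estimate the variance ([Ex_carre_variance_le]).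

    The second one is [\sum_j E[u_j D_j g(F)]] with
    [u_j = D_j F |K_N D_j F| / sqrt (p_j q_j)]. By duality it is the expectation of
    [g(F) \sum_j Y_j u_j], at most the norm of [g(F)] times the norm of the
    Skorokhod integral of [u] ([Ex_skorokhod_sqr_bound]). Joint moments such as
    those of [D_l D_j F] and [D_l D_m F] come out, and not only moments of single
    gradients, because Jensen's inequality for [K_N] is applied to whole sums
    ([Ex_sum_mul_K_sqr_le]).

    Finally the norms of [h(F)] and [g(F)] are of order [(1 + |z|) ^ (- k)]
    ([stein_decay]). For [z] nonnegative, both functions are exponentially small on
    the left of [z / 2], while [F] exceeds [z / 2] with a probability controlled by
    its moment of order [2 k]; negative [z] are treated by reflection. *)

Set Implicit Arguments.
Unset Strict Implicit.
Unset Printing Implicit Defensive.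

Import Order.TTheory GRing.Theory Num.Theory.
Import numFieldNormedType.Exports.

Local Open Scope classical_set_scope.
Local Open Scope ring_scope.

(** * Gaussian tails *)

(** The identity seen as a random variable, so that [Phi] is its distribution
    function and inherits the limits at infinity. *)
Definition idR (R : realType) : measurableTypeR R -> R := idfun.

HB.instance Definition _ (R : realType) :=
  isMeasurableFun.Build _ _ _ _ (@idR R) (@measurable_id _ _ setT).

Section gaussian.
Context {R : realType}.
Implicit Types (x z w b : R) (f df : R -> R).

Local Notation pdf := (normal_pdf (0 : R) 1).

Lemma pdfE x : pdf x = normal_peak 1 * expR (- (x ^+ 2 / 2)).
Proof.
by rewrite normal_pdfE ?oner_neq0// /normal_fun subr0 expr1n mulNr.
Qed.

Lemma pdf_gt0 x : 0 < pdf x.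
Proof. by rewrite pdfE mulr_gt0 ?expR_gt0// normal_peak_gt0 ?oner_neq0. Qed.

Lemma pdf_neq0 x : pdf x != 0. Proof. by rewrite gt_eqF ?pdf_gt0. Qed.

Lemma pdfN x : pdf (- x) = pdf x. Proof. by rewrite !pdfE sqrrN. Qed.

Lemma is_derive_pdf x : is_derive x 1 pdf (- x * pdf x).
Proof.
have -> : pdf = (fun y => normal_peak 1 * expR (- (y ^+ 2 / 2))).
  by apply/funext => y; exact: pdfE.
have h : is_derive x 1 (fun y : R => - (y ^+ 2 / 2)) (- x).
  apply: is_derive_eq.
  by rewrite /GRing.scale /= mulr0 mulr0 !mulr1; lra.
have h2 : is_derive x 1 (expR \o (fun y : R => - (y ^+ 2 / 2))) (expR (- (x ^+ 2 / 2)) * - x).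
  exact: (@is_derive1_comp _ expR _ _ _ _ (is_derive_expR _) h).
have h3 : is_derive x 1 (normal_peak 1 \*: (expR \o (fun y : R => - (y ^+ 2 / 2)))) (normal_peak 1 *: (expR (- (x ^+ 2 / 2)) * - x)).
  exact: is_deriveZ.
apply: (is_derive_eq h3).
rewrite /GRing.scale /=. ring.
Qed.

Lemma is_derive_Phi x : is_derive x 1 (@Phi R) (pdf x).
Proof.
have xx1 : x < x + 1 by rewrite ltrDl.
have [|||dP Pe] := @continuous_FTC1 R pdf -oo%O x (x + 1) xx1.
- apply: (integrableS _ _ (subsetT _)) => //; exact: integrable_normal_pdf.
- by rewrite ltNyr.
- by apply: continuous_normal_pdf; exact: oner_neq0.
rewrite -Pe derive1E; exact: derivableP.
Qed.

Lemma cdf_PhiE x : cdf (@idR R : {RV normal_prob (0 : R) 1 >-> R}) x = (Phi x)%:E.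
Proof.
rewrite /cdf /distribution /pushforward /= /Phi fineK// fin_num_measure//.
Qed.

Lemma Phi_ge0 x : 0 <= Phi x.
Proof. by rewrite -lee_fin -cdf_PhiE; exact: cdf_ge0. Qed.

Lemma Phi_le1 x : Phi x <= 1.
Proof. by rewrite -lee_fin -cdf_PhiE; exact: cdf_le1. Qed.

Lemma Phi_nd x y : x <= y -> Phi x <= Phi y.
Proof. by move=> xy; rewrite -lee_fin -!cdf_PhiE; exact: cdf_nondecreasing. Qed.

Lemma Phi_cvgNy0 : @Phi R x @[x --> -oo] --> 0.
Proof.
have := fine_cvg (cvg_cdfNy0 (@idR R : {RV normal_prob (0 : R) 1 >-> R})).
rewrite (_ : fine \o _ = @Phi R); first exact.
by apply/funext => x; exact: (congr1 fine (cdf_PhiE x)).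
Qed.

Lemma Phi_cvgy1 : @Phi R x @[x --> +oo] --> (1 : R).
Proof.
have := fine_cvg (cvg_cdfy1 (@idR R : {RV normal_prob (0 : R) 1 >-> R})).
rewrite (_ : fine \o _ = @Phi R); first exact.
by apply/funext => x; exact: (congr1 fine (cdf_PhiE x)).
Qed.

Lemma is_derive_cont f x (l : R) : is_derive x 1 f l -> {for x, continuous f}.
Proof. by move=> [h _]; apply: differentiable_continuous; apply/derivable1_diffP. Qed.

Lemma is_derive_MVT f (df : R -> R) (a b : R) : a <= b ->
  (forall x, a < x < b -> is_derive x 1 f (df x)) ->
  (forall x, a <= x <= b -> {for x, continuous f}) ->
  exists2 c, a <= c <= b & f b - f a = df c * (b - a).
Proof.
move=> ab h hc.
have h1 x : x \in `]a, b[ -> is_derive x 1 f (df x).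
  by rewrite in_itv/=; apply: h.
have h2 : {within `[a, b], continuous f}.
  by apply: continuous_in_subspaceT => x; rewrite inE/= in_itv/=; exact: hc.
have [c + E] := MVT_segment ab h1 h2.
by rewrite in_itv/=; exists c.
Qed.

Lemma is_derive_nd f (df : R -> R) (a b : R) : a <= b ->
  (forall x, a <= x <= b -> is_derive x 1 f (df x)) ->
  (forall x, a <= x <= b -> 0 <= df x) -> f a <= f b.
Proof.
move=> ab h df0.
have h1 x : a < x < b -> is_derive x 1 f (df x).
  by move=> /andP[ax xb]; apply: h; rewrite !ltW.
have h2 x : a <= x <= b -> {for x, continuous f}.
  by move=> /h; exact: is_derive_cont.
have [c cab E] := is_derive_MVT ab h1 h2.
by rewrite -subr_ge0 E mulr_ge0 ?subr_ge0// df0.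
Qed.

(** The sum [Phi y + Phi (- y)] has derivative zero, and its value is found at
    infinity. *)
Lemma PhiN x : Phi (- x) = 1 - Phi x.
Proof.
pose g y := Phi y + Phi (- y) : R.
have dg (y : R) : is_derive y 1 g 0.
  have h1 : is_derive y 1 (@Phi R \o -%R) (pdf (- y) * - 1).
    exact: (@is_derive1_comp _ _ _ _ _ _ (is_derive_Phi (- y)) (is_deriveNid y 1)).
  have h2 := is_derive_Phi y.
  apply: (is_derive_eq (is_deriveD h2 h1)).
  by rewrite pdfN mulrN1 subrr.
have gc y : g y = g 0 by exact: is_derive_0_is_cst.
have g1 : g y @[y --> +oo] --> (1 + 0 : R).
  apply: cvgD; first exact: Phi_cvgy1.
  have := Phi_cvgNy0. by rewrite cvgNy_compNP.
have : g y @[y --> +oo] --> g 0.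
  by under eq_fun do rewrite gc; exact: cvg_cst.
move/(cvg_unique _ g1) => /(_ (@Rhausdorff R)); rewrite addr0 => g01.
by have := gc x; rewrite -g01 /g => <-; rewrite addrC addKr.
Qed.

Lemma Phi_small b (e : R) : 0 < e -> exists2 x, x <= b & Phi x <= e.
Proof.
move=> e0; have := Phi_cvgNy0 => /cvgrPdist_le /(_ e e0) h.
have [x [h1 xb]] := filter_ex (filterI h (nbhs_ninfty_le (num_real b))).
by exists x => //; move: h1; rewrite sub0r normrN ger0_norm// Phi_ge0.
Qed.

(** For negative [w] the function [- p / w - Phi] is nondecreasing and vanishes at
    minus infinity; comparing with a point where [Phi] is below [e] avoids taking
    the limit. *)
Lemma mills_lower w : 0 <= pdf w + w * Phi w.
Proof.
have [w0|w0] := leP 0 w; first by rewrite addr_ge0 ?mulr_ge0 ?Phi_ge0// ltW// pdf_gt0.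
suff : Phi w <= - (w^-1 * pdf w).
  by rewrite -(ler_nM2l w0) mulrN mulVKf ?lt_eqF// -subr_ge0 opprK addrC.
apply/ler_addgt0Pr => e e0; have [x xw Pe] := Phi_small w e0.
pose H y := - (y^-1 * pdf y) - Phi y.
have dH y : x <= y <= w -> is_derive y 1 H (pdf y / y ^+ 2).
  move=> /andP[_ yw]; have y0 : y != 0 by rewrite lt_eqF// (le_lt_trans yw).
  have h1 : is_derive y 1 (fun y : R => y^-1) (- y ^- 2 *: 1).
    exact: (@is_deriveV _ id).
  have h2 := is_derive_Phi y.
  have h3 := is_derive_pdf y.
  apply: (is_derive_eq (is_deriveB (is_deriveN (is_deriveM h1 h3)) h2)).
  by rewrite /GRing.scale /=; field.
have : H x <= H w.
  apply: (is_derive_nd xw dH) => y _.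
  by rewrite divr_ge0 ?sqr_ge0// ltW// pdf_gt0.
have : 0 <= - (x^-1 * pdf x).
  rewrite oppr_ge0 mulr_le0_ge0 ?ltW ?pdf_gt0// invr_lt0; exact: (le_lt_trans xw).
by rewrite /H; lra.
Qed.

(** Same comparison from minus infinity, for [Phi + w p / (1 + w ^ 2)], whose
    derivative is [2 p / (1 + w ^ 2) ^ 2]. *)
Lemma mills_upper w : 0 <= (1 + w ^+ 2) * Phi w + w * pdf w.
Proof.
have c0 (y : R) : 0 < 1 + y ^+ 2 by have := sqr_ge0 y; lra.
have [w0|w0] := leP 0 w.
  by rewrite addr_ge0 ?mulr_ge0 ?Phi_ge0// ltW// ?pdf_gt0.
suff : 0 <= Phi w + w * (1 + w ^+ 2)^-1 * pdf w.
  move=> h; have -> : (1 + w ^+ 2) * Phi w + w * pdf w =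
      (1 + w ^+ 2) * (Phi w + w * (1 + w ^+ 2)^-1 * pdf w).
    by have := c0 w => cw; field; exact: lt0r_neq0.
  by rewrite mulr_ge0// ltW.
rewrite -[leRHS]opprK oppr_ge0; apply/ler_addgt0Pr => e e0; rewrite add0r.
have pk0 : 0 < normal_peak (1 : R) by rewrite normal_peak_gt0 ?oner_neq0.
pose b := Num.min w (- (normal_peak 1 / e)).
pose x := b; have xw : x <= w by rewrite /x /b ge_min lexx.
have x0 : x < 0 by exact: le_lt_trans w0.
pose H y := Phi y + y * (1 + y ^+ 2)^-1 * pdf y.
have dH y : x <= y <= w -> is_derive y 1 H (2 * pdf y / (1 + y ^+ 2) ^+ 2).
  move=> _; have cy := c0 y.
  have h0 : is_derive y 1 (fun y : R => 1 + y ^+ 2) (2 * y).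
    by apply: is_derive_eq; rewrite /GRing.scale /=; ring.
  have h1 : is_derive y 1 (fun y : R => (1 + y ^+ 2)^-1) (- (1 + y ^+ 2) ^- 2 *: (2 * y)).
    by apply: is_deriveV => //; rewrite gt_eqF.
  have h2 := is_derive_Phi y.
  have h3 := is_derive_pdf y.
  have h4 := is_derive_id y (1 : R).
  apply: (is_derive_eq (is_deriveD h2 (is_deriveM (is_deriveM h4 h1) h3))).
  rewrite /GRing.scale /= fctE /=; field; exact: lt0r_neq0.
have hH : H x <= H w.
  apply: (is_derive_nd xw dH) => y _.
  by rewrite divr_ge0 ?sqr_ge0// mulr_ge0// ltW// pdf_gt0.
have : - e <= H x; last by rewrite /H in hH *; lra.
rewrite /H; apply: (@le_trans _ _ (x * (1 + x ^+ 2)^-1 * pdf x)); last first.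
  by rewrite lerDr Phi_ge0.
have xb : x <= - (normal_peak 1 / e) by rewrite /x /b ge_min lexx orbT.
have px : pdf x <= normal_peak 1 by rewrite normal_pdf_ub// oner_neq0.
have : normal_peak 1 <= - x * e by rewrite -ler_pdivrMr//; lra.
have cx := c0 x; have px0 := pdf_gt0 x.
rewrite mulrAC -mulrN1 ler_pdivlMr// => h; nra.
Qed.

End gaussian.

(** * The Stein solution *)

Section stein.
Context {R : realType}.
Implicit Types (x z w b a c : R).

Local Notation pdf := (normal_pdf (0 : R) 1).
Local Notation peak := (normal_peak (1 : R)).

(** The Mills ratio of the left tail; on both sides of [z] the Stein
    solution is a multiple of it or of its reflection. *)
Definition mills_ratio w : R := Phi w / pdf w.

Lemma mills_ratio_ge0 w : 0 <= mills_ratio w.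
Proof. by rewrite divr_ge0 ?Phi_ge0// ltW// pdf_gt0. Qed.

Lemma mills_ratio_lb w : 0 <= 1 + w * mills_ratio w.
Proof.
have p0 := pdf_gt0 w; rewrite -(pmulr_rge0 _ p0) /mills_ratio.
by rewrite mulrDr mulr1 mulrCA [pdf w * _]mulrC divfK ?gt_eqF// mills_lower.
Qed.

Lemma is_derive_mills_ratio w :
  is_derive w 1 mills_ratio (1 + w * mills_ratio w).
Proof.
have h1 : is_derive w 1 (fun y : R => (pdf y)^-1) (- pdf w ^- 2 *: (- w * pdf w)).
  by apply: is_deriveV; [exact: pdf_neq0|exact: is_derive_pdf].
have h2 := is_derive_Phi w.
apply: (is_derive_eq (is_deriveM h2 h1)).
by rewrite /GRing.scale /= /mills_ratio; field; exact: pdf_neq0.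
Qed.

(** The derivative of [w * mills_ratio w] is the left-hand side of [mills_upper]
    divided by the density. *)
Lemma nd_mul_mills_ratio a b : a <= b -> a * mills_ratio a <= b * mills_ratio b.
Proof.
move=> ab; apply: (@is_derive_nd _ (fun x => x * mills_ratio x)
  (fun x => ((1 + x ^+ 2) * Phi x + x * pdf x) / pdf x)) => // w _; last first.
  by rewrite divr_ge0 ?mills_upper// ltW// pdf_gt0.
have h1 := is_derive_mills_ratio w.
apply: (is_derive_eq (is_deriveM (is_derive_id w (1 : R)) h1)).
by rewrite /GRing.scale /= /mills_ratio; field; exact: pdf_neq0.
Qed.

Lemma stein_solE z w : stein_sol z w =
  if w <= z then mills_ratio w * Phi (- z) else Phi z * mills_ratio (- w).
Proof.
rewrite /stein_sol /mills_ratio PhiN PhiN pdfN; case: ifP => _.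
  by rewrite mulrAC.
by rewrite mulrA.
Qed.

(** The two branches of the solution agree at [z]. *)
Lemma stein_sol_ge z w : z <= w -> stein_sol z w = Phi z * mills_ratio (- w).
Proof.
rewrite stein_solE le_eqVlt => /predU1P[->|zw].
  by rewrite lexx /mills_ratio pdfN mulrAC mulrA.
by rewrite leNgt zw.
Qed.

Lemma stein_solN z w : stein_sol z w = stein_sol (- z) (- w).
Proof.
have [wz|zw] := leP w z.
  by rewrite [RHS]stein_sol_ge ?lerN2// stein_solE wz opprK mulrC.
by rewrite [RHS]stein_solE lerN2 ltW// opprK mulrC stein_sol_ge// ltW.
Qed.

Lemma stein_sol_ge0 z w : 0 <= stein_sol z w.
Proof. by rewrite stein_solE; case: ifP => _; rewrite mulr_ge0 ?Phi_ge0 ?mills_ratio_ge0. Qed.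

Lemma mul_stein_sol_nd z a b : a <= b -> a * stein_sol z a <= b * stein_sol z b.
Proof.
have left x y : x <= y -> y <= z -> x * stein_sol z x <= y * stein_sol z y.
  move=> xy yz; rewrite !stein_solE yz (le_trans xy yz) (mulrA x) (mulrA y).
  by apply: ler_wpM2r; [exact: Phi_ge0|exact: nd_mul_mills_ratio].
have right x y : z <= x -> x <= y -> x * stein_sol z x <= y * stein_sol z y.
  move=> zx xy; rewrite !stein_sol_ge// ?(le_trans zx xy)// !(mulrCA _ (Phi z)).
  have := @nd_mul_mills_ratio (- y) (- x); rewrite lerN2 !mulNr lerN2.
  by move=> /(_ xy) h; rewrite ler_wpM2l ?Phi_ge0.
move=> ab; have [bz|zb] := leP b z; first exact: left.
have [za|az] := leP z a; first exact: right.
exact: (le_trans (left _ _ (ltW az) (lexx z)) (right _ _ (lexx z) (ltW zb))).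
Qed.

(** [stein_deriv z] is the derivative of the Stein solution read off from
    Stein's equation. *)
Definition stein_deriv z w : R := w * stein_sol z w + (w <= z)%R%:R - Phi z.

(** The nondecreasing function that controls the oscillation of [stein_deriv z].
    The constant makes it small far away from [z] on either side; a discrete
    gradient does not see it. *)
Definition stein_mono z w : R := w * stein_sol z w + (z < w)%R%:R - (z < 0)%R%:R.

Lemma stein_sol_MVT_left z a b : a < b -> b <= z -> exists2 c, a <= c <= b &
  stein_sol z b - stein_sol z a = stein_deriv z c * (b - a).
Proof.
move=> ab bz.
have h c : is_derive c 1 (fun x => mills_ratio x * Phi (- z))
    ((1 + c * mills_ratio c) * Phi (- z)).
  have h1 := is_derive_mills_ratio c.
  apply: (is_derive_eq (is_deriveM h1 (is_derive_cst (Phi (- z) : R) c 1))).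
  by rewrite /GRing.scale /=; ring.
have [c /andP[ac cb] E] := is_derive_MVT (ltW ab) (fun x _ => h x)
  (fun x _ => is_derive_cont (h x)).
exists c; first by rewrite ac.
rewrite !stein_solE bz (le_trans (ltW ab) bz) E /stein_deriv.
rewrite stein_solE (le_trans cb bz) PhiN /=; congr (_ * _). ring.
Qed.

Lemma stein_sol_MVT_right z a b : z <= a -> a < b -> exists2 c, a < c <= b &
  stein_sol z b - stein_sol z a = stein_deriv z c * (b - a).
Proof.
move=> za ab.
have h c : is_derive c 1 (fun x => Phi z * mills_ratio (- x))
    (- Phi z * (1 - c * mills_ratio (- c))).
  have h1 : is_derive c 1 (mills_ratio \o -%R) ((1 + (- c) * mills_ratio (- c)) * - 1).
    exact: (@is_derive1_comp _ _ _ _ _ _ (is_derive_mills_ratio (- c)) (is_deriveNid c 1)).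
  apply: (is_derive_eq (is_deriveM (is_derive_cst (Phi z : R) c 1) h1)).
  by rewrite /GRing.scale /=; ring.
have hc : {within `[a, b], continuous (fun x => Phi z * mills_ratio (- x))}.
  by apply: continuous_subspaceT => x; exact: is_derive_cont (h x).
have [c] := MVT ab (fun x _ => h x) hc.
rewrite in_itv/= => /andP[ac cb] E.
exists c; first by rewrite ac ltW.
have zc : z < c by exact: le_lt_trans ac.
rewrite !stein_sol_ge ?(le_trans za (ltW ab))// E /stein_deriv.
rewrite stein_sol_ge ?(ltW zc)// leNgt zc /=; congr (_ * _); ring.
Qed.

(** The oscillation of the derivative between two points is controlled by the
    increment of the nondecreasing function [stein_mono]: its two summands are
    both nondecreasing, while in [stein_deriv] they enter with opposite signs. *)
Lemma stein_deriv_osc z a b x y : a <= x <= b -> a <= y <= b ->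
  `|stein_deriv z x - stein_deriv z y| <= stein_mono z b - stein_mono z a.
Proof.
move=> /andP[ax xb] /andP[ay yb].
have m1 := mul_stein_sol_nd z ax; have m2 := mul_stein_sol_nd z xb.
have m3 := mul_stein_sol_nd z ay; have m4 := mul_stein_sol_nd z yb.
have ind u v : u <= v -> (z < u)%R%:R <= (z < v)%R%:R :> R.
  move=> uv; rewrite ler_nat; case: (ltP z u) => // zu.
  by rewrite (lt_le_trans zu uv).
have i1 := ind _ _ ax; have i2 := ind _ _ xb.
have i3 := ind _ _ ay; have i4 := ind _ _ yb.
have E u : (u <= z)%R%:R = 1 - (z < u)%R%:R :> R.
  by rewrite leNgt; case: (z < u); rewrite ?subrr ?subr0.
rewrite /stein_deriv /stein_mono !E ler_norml; apply/andP; split; lra.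
Qed.

(** A first-order Taylor estimate without second derivative: the mean value
    theorem is used on each side of the kink at [z], and the derivatives at the
    intermediate points are compared through [stein_deriv_osc]. *)
Lemma stein_taylor_lt z a b c : a < b -> a <= c <= b ->
  `|stein_sol z b - stein_sol z a - stein_deriv z c * (b - a)| <=
  (b - a) * (stein_mono z b - stein_mono z a).
Proof.
move=> ab cab.
have one m : a <= m <= b -> stein_sol z b - stein_sol z a = stein_deriv z m * (b - a) ->
  `|stein_sol z b - stein_sol z a - stein_deriv z c * (b - a)| <=
  (b - a) * (stein_mono z b - stein_mono z a).
  move=> mab ->; rewrite -mulrBl normrM mulrC.
  have -> : `|b - a| = b - a by rewrite ger0_norm// subr_ge0 ltW.
  by apply: ler_wpM2l; [rewrite subr_ge0 ltW|exact: stein_deriv_osc].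
have [bz|zb] := leP b z.
  by have [m mab E] := stein_sol_MVT_left ab bz; exact: one mab E.
have [za|az] := leP z a.
  have [m /andP[am mb] E] := stein_sol_MVT_right za ab.
  by apply: one E; rewrite ltW.
have [m /andP[am mz] E1] := stein_sol_MVT_left az (lexx z).
have [n /andP[zn nb] E2] := stein_sol_MVT_right (lexx z) zb.
have -> : stein_sol z b - stein_sol z a - stein_deriv z c * (b - a) =
  (stein_deriv z n - stein_deriv z c) * (b - z) +
  (stein_deriv z m - stein_deriv z c) * (z - a).
  rewrite (_ : stein_sol z b - stein_sol z a = (stein_sol z b - stein_sol z z) +
    (stein_sol z z - stein_sol z a)); last by ring.
  by rewrite E1 E2; ring.
apply: (le_trans (ler_normD _ _)); rewrite !normrM.
have -> : `|b - z| = b - z by rewrite ger0_norm// subr_ge0 ltW.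
have -> : `|z - a| = z - a by rewrite ger0_norm// subr_ge0 ltW.
rewrite [leRHS](_ : _ = (stein_mono z b - stein_mono z a) * (b - z) +
  (stein_mono z b - stein_mono z a) * (z - a)); last by ring.
apply: lerD; (apply: ler_wpM2r; first by rewrite subr_ge0 ltW);
  apply: stein_deriv_osc => //.
- by rewrite nb ltW// (lt_trans az zn).
- by rewrite am (le_trans mz (ltW zb)).
Qed.

Lemma stein_taylor z a b c : c = a \/ c = b ->
  `|stein_sol z a - stein_sol z b - stein_deriv z c * (a - b)| <=
  (a - b) * (stein_mono z a - stein_mono z b).
Proof.
move=> cab; have [ab|ba|ab] := ltgtP a b.
- have -> : stein_sol z a - stein_sol z b - stein_deriv z c * (a - b) =
    - (stein_sol z b - stein_sol z a - stein_deriv z c * (b - a)) by ring.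
  have -> : (a - b) * (stein_mono z a - stein_mono z b) =
    (b - a) * (stein_mono z b - stein_mono z a) by ring.
  by rewrite normrN; apply: stein_taylor_lt => //; case: cab => ->; rewrite lexx ltW.
- by apply: stein_taylor_lt => //; case: cab => ->; rewrite lexx ltW.
- by rewrite ab !subrr mulr0 mul0r subr0 normr0.
Qed.

Lemma normr_mul_stein_sol z w : `|w * stein_sol z w| <= 1.
Proof.
wlog wz : z w / w <= z.
  move=> H; have [|zw] := leP w z; first exact: H.
  by rewrite stein_solN -normrN -mulNr H// lerN2 ltW.
rewrite stein_solE wz; have lb := mills_ratio_lb w.
have P0 := Phi_ge0 (- z); have P1 := Phi_le1 (- z).
have [w0|w0] := leP w 0.
  have : w * mills_ratio w <= 0 by rewrite mulr_le0_ge0// mills_ratio_ge0.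
  by rewrite ler_norml mulrA => h; apply/andP; split; nra.
have r0 := mills_ratio_ge0 w.
rewrite ger0_norm; last by rewrite mulr_ge0 ?(ltW w0)// mulr_ge0.
have h1 : Phi (- z) <= Phi (- w) by rewrite Phi_nd// lerN2.
have h2 : w * (mills_ratio w * Phi (- z)) <= w * (mills_ratio w * Phi (- w)).
  by apply: ler_wpM2l; [exact: ltW|exact: ler_wpM2l].
apply: (le_trans h2).
have -> : w * (mills_ratio w * Phi (- w)) = Phi w * (w * mills_ratio (- w)).
  by rewrite /mills_ratio pdfN; ring.
have := mills_ratio_lb (- w).
have := Phi_le1 w; have := Phi_ge0 w; have := mills_ratio_ge0 (- w).
set r := mills_ratio (- w) => ? ? ? h; nra.
Qed.

Lemma pdf_le_norm x y : `|x| <= `|y| -> pdf y <= pdf x.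
Proof.
move=> xy; rewrite !pdfE ler_wpM2l ?normal_peak_ge0// ler_expR lerN2.
by rewrite ler_wpM2r// -[x ^+ 2]real_normK ?num_real// -[y ^+ 2]real_normK ?num_real// lerXn2r// nnegrE.
Qed.

Lemma stein_sol_bounded z w : stein_sol z w <= 1 + (pdf 1)^-1.
Proof.
have s0 := stein_sol_ge0 z w; have h := normr_mul_stein_sol z w.
have p1 : 0 < (pdf 1)^-1 by rewrite invr_gt0 pdf_gt0.
have [w1|w1] := leP 1 `|w|.
  move: h; rewrite normrM (ger0_norm s0) => h.
  apply: (@le_trans _ _ 1); last by rewrite lerDl ltW.
  by apply: le_trans h; rewrite ler_peMl.
suff : stein_sol z w <= (pdf 1)^-1 by lra.
have ph : (pdf w)^-1 <= (pdf 1)^-1.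
  by rewrite lef_pV2 ?posrE ?pdf_gt0// pdf_le_norm// normr1 ltW.
apply: le_trans ph; have pw : 0 < (pdf w)^-1 by rewrite invr_gt0 pdf_gt0.
have b1 (u v : R) : 0 <= u <= 1 -> 0 <= v <= 1 -> u * v <= 1.
  by move=> /andP[? ?] /andP[? ?]; nra.
rewrite stein_solE /mills_ratio pdfN; case: ifP => _.
  rewrite mulrAC -[leRHS]mul1r; apply: ler_wpM2r; first exact: ltW.
  by rewrite b1 ?Phi_ge0 ?Phi_le1.
rewrite mulrA -[leRHS]mul1r; apply: ler_wpM2r; first exact: ltW.
by rewrite b1 ?Phi_ge0 ?Phi_le1.
Qed.

Lemma PhiN_le z : 1 <= z -> Phi (- z) <= pdf z / z.
Proof.
move=> z1; have z0 : 0 < z by lra.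
by have := mills_lower (- z); rewrite pdfN ler_pdivlMr// mulNr subr_ge0 mulrC.
Qed.

Local Notation K0 := (1 + peak).

Lemma PhiN_exp z : 1 <= z -> Phi (- z) <= K0 * expR (- (3 / 8 * z)).
Proof.
move=> z1; apply: (le_trans (PhiN_le z1)).
have p0 := pdf_gt0 z; have k0 := @normal_peak_ge0 R 1.
apply: (@le_trans _ _ (pdf z)).
  by rewrite ler_pdivrMr ?(lt_le_trans ltr01)// ler_peMr// ltW.
rewrite pdfE; apply: (@le_trans _ _ (peak * expR (- (3 / 8 * z)))).
  by apply: ler_wpM2l => //; rewrite ler_expR; nra.
by apply: ler_wpM2r; [exact: expR_ge0|lra].
Qed.

(** For [0 <= w <= z / 2] the factor [w * mills_ratio w] is at most of order
    [z * expR (z ^+ 2 / 8)], and the tail [Phi (- z)] is at most of order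
    [expR (- z ^+ 2 / 2) / z]; the product of the exponentials is
    [expR (- 3 / 8 * z ^+ 2)]. *)
Lemma mul_stein_sol_exp z w : 1 <= z -> w <= z / 2 ->
  `|w * stein_sol z w| <= K0 * expR (- (3 / 8 * z)).
Proof.
move=> z1 wz2; have wz : w <= z by lra.
have k0 := @normal_peak_ge0 R 1; have e0 := expR_ge0 (- (3 / 8 * z)).
rewrite stein_solE wz mulrA normrM (ger0_norm (Phi_ge0 _)).
have [w0|w0] := leP w 0.
  rewrite -[leRHS]mul1r; apply: ler_pM; [exact: normr_ge0|exact: Phi_ge0| |exact: PhiN_exp].
  have := mills_ratio_lb w.
  have : w * mills_ratio w <= 0 by rewrite mulr_le0_ge0// mills_ratio_ge0.
  by rewrite ler_norml => ? ?; apply/andP; split; lra.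
rewrite ger0_norm; last by rewrite mulr_ge0 ?(ltW w0)// mills_ratio_ge0.
have z0 : 0 < z by lra.
have pz2 := pdf_gt0 (z / 2).
apply: (@le_trans _ _ ((z / 2 * (pdf (z / 2))^-1) * (pdf z / z))).
  have h1 : mills_ratio w <= (pdf (z / 2))^-1.
    rewrite /mills_ratio -[leRHS]mul1r; apply: ler_pM; rewrite ?Phi_ge0 ?Phi_le1 ?invr_ge0 ?normal_pdf_ge0//.
    rewrite lef_pV2 ?posrE ?pdf_gt0// pdf_le_norm// !gtr0_norm//.
    by rewrite divr_gt0.
  have h2 : w * mills_ratio w <= z / 2 * (pdf (z / 2))^-1.
    by apply: ler_pM => //; [exact: ltW|exact: mills_ratio_ge0].
  apply: ler_pM => //; [|exact: Phi_ge0|exact: PhiN_le].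
  by apply: mulr_ge0; [exact: ltW|exact: mills_ratio_ge0].
have -> : z / 2 * (pdf (z / 2))^-1 * (pdf z / z) = 2^-1 * (pdf z / pdf (z / 2)).
  by field; rewrite !gt_eqF ?pdf_gt0.
have -> : pdf z / pdf (z / 2) = expR (- (3 / 8 * z ^+ 2)).
  rewrite !pdfE -mulf_div divff ?mul1r; last first.
    by rewrite gt_eqF// normal_peak_gt0// oner_neq0.
  by rewrite -expRN -expRD; congr expR; field.
apply: ler_pM; rewrite ?expR_ge0 ?invr_ge0//; first by lra.
by rewrite ler_expR; nra.
Qed.

(** With [n = k.+1] and [y = 3 z / (8 n)], the exponential of [3 z / 8 = n y] is
    at least [(1 + y) ^ n], which is of order [(1 + z) ^ n]. *)
Lemma exp_decay (k : nat) : exists2 C : R, 0 < C &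
  forall z, 0 <= z -> expR (- (3 / 8 * z)) * (1 + z) ^+ k <= C.
Proof.
pose n : R := k.+1%:R; have n0 : 0 < n by rewrite ltr0n.
pose E : R := 1 + 8 / 3 * n; have E0 : 0 < E by rewrite /E; lra.
exists (E ^+ k.+1) => [|z z0]; first exact: exprn_gt0.
have [y y0 yE] : exists2 y, 0 <= y & 3 / 8 * z = y * n.
  exists (3 / 8 * z / n); last by rewrite divfK// gt_eqF.
  by apply: divr_ge0; [lra|exact: ltW].
have y1 : 0 <= 1 + y by lra.
rewrite expRN mulrC ler_pdivrMr ?expR_gt0//.
apply: (@le_trans _ _ ((1 + z) ^+ k.+1)).
  by rewrite ler_weXn2l ?leqnSn//; lra.
apply: (@le_trans _ _ ((E * (1 + y)) ^+ k.+1)).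
  have Ey : E * (1 + y) = E + z + y.
    have -> : z = 8 / 3 * (y * n) by lra.
    by rewrite /E; ring.
  by rewrite Ey; apply: lerXn2r; rewrite ?nnegrE; rewrite /E; lra.
rewrite exprMn; apply: ler_wpM2l; first by apply: exprn_ge0; exact: ltW.
rewrite yE mulrC expRM_natl; apply: lerXn2r; rewrite ?nnegrE ?expR_ge0//.
exact: expR_ge1Dx.
Qed.

(** The source of the non-uniformity, as a pointwise version of Markov's
    inequality: below [z / 2] the weight is exponentially small, and beyond [z / 2]
    it is bounded while [w ^+ (2 * k)] dominates [(1 + z) ^+ (2 * k)]. The summand
    [r] leaves room for the indicators and for [Phi z]. *)
Lemma stein_weight_decay (k : nat) : exists2 C : R, 0 < C &
  forall z w r, 0 <= z -> `|r| <= 1 ->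
    (1 <= z -> w <= z / 2 -> `|r| <= Phi (- z)) ->
    (w * stein_sol z w + r) ^+ 2 * (1 + z) ^+ (2 * k) <= C * (1 + w ^+ (2 * k)).
Proof.
have [E E0 hE] := exp_decay k.
have K00 : 0 < K0 by have := @normal_peak_ge0 R 1; lra.
pose C := (2 * K0 * E) ^+ 2 + 4 * 4 ^+ (2 * k).
have c40 : 0 < 4 ^+ (2 * k) :> R by rewrite exprn_gt0.
have C0 : 0 < C by rewrite /C; have := sqr_ge0 (2 * K0 * E); lra.
have even (u : R) : 0 <= u ^+ (2 * k) by rewrite exprM exprn_ge0// sqr_ge0.
exists C => // z w r z0 r1 rs.
have T2 : `|w * stein_sol z w + r| <= 2.
  by apply: (le_trans (ler_normD _ _)); have := normr_mul_stein_sol z w; lra.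
set T := w * _ + r in T2 *.
have T24 : T ^+ 2 <= 4.
  have -> : 4 = 2 ^+ 2 :> R by ring.
  by rewrite -[T ^+ 2]real_normK ?num_real// lerXn2r// nnegrE.
have q0 : 0 <= T ^+ 2 := sqr_ge0 T.
have main u : (1 + z) ^+ (2 * k) <= 4 ^+ (2 * k) * u -> 0 <= u -> u <= 1 + w ^+ (2 * k) ->
    T ^+ 2 * (1 + z) ^+ (2 * k) <= C * (1 + w ^+ (2 * k)).
  move=> h u0 h2; apply: (@le_trans _ _ (4 * (4 ^+ (2 * k) * u))).
    apply: ler_pM => //; apply: exprn_ge0; lra.
  rewrite mulrA; apply: ler_pM => //.
  by rewrite /C lerDr sqr_ge0.
have [z1|z1] := ltP z 1.
  apply: (main 1) => //; last by rewrite lerDl.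
  by rewrite mulr1; apply: lerXn2r; rewrite ?nnegrE; lra.
have [wz|wz] := leP w (z / 2); last first.
  apply: (main (w ^+ (2 * k))) => //; last by rewrite lerDr.
  by rewrite -exprMn; apply: lerXn2r; rewrite ?nnegrE; lra.
have Ts : `|T| <= 2 * K0 * expR (- (3 / 8 * z)).
  apply: (le_trans (ler_normD _ _)).
  have := mul_stein_sol_exp z1 wz; have := PhiN_exp z1; have := rs z1 wz.
  by lra.
have e0 := expR_ge0 (- (3 / 8 * z)).
have : T ^+ 2 * (1 + z) ^+ (2 * k) <= (2 * K0 * E) ^+ 2.
  rewrite mulnC exprM -exprMn -[_ ^+ 2]real_normK ?num_real//.
  apply: lerXn2r; rewrite ?nnegrE; [exact: normr_ge0| |].
    by apply: mulr_ge0; [lra|exact: ltW].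
  rewrite normrM [`|(1 + z) ^+ k|]ger0_norm; last by apply: exprn_ge0; lra.
  apply: (@le_trans _ _ (2 * K0 * expR (- (3 / 8 * z)) * (1 + z) ^+ k)).
    by apply: ler_wpM2r => //; apply: exprn_ge0; lra.
  by rewrite -mulrA; apply: ler_wpM2l; [lra|exact: hE].
move/le_trans; apply; have := even w; rewrite /C => w0.
have := sqr_ge0 (2 * K0 * E); move: (_ ^+ 2) => a a0.
nra.
Qed.

(** Both weights are of the form treated in [stein_weight_decay] when [z] is
    nonnegative; the reflection [stein_solN] reduces negative [z] to this case, up
    to the values of the indicators at [z] itself. *)
Lemma stein_decay (k : nat) : exists2 C : R, 0 < C & forall z w,
  stein_deriv z w ^+ 2 <= C * (1 + w ^+ (2 * k)) / (1 + `|z|) ^+ (2 * k) /\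
  stein_mono z w ^+ 2 <= C * (1 + w ^+ (2 * k)) / (1 + `|z|) ^+ (2 * k).
Proof.
have [C C0 hC] := stein_weight_decay k.
exists C => // z w.
have pz : 0 < (1 + `|z|) ^+ (2 * k).
  by rewrite exprn_gt0//; have := normr_ge0 z; lra.
rewrite !ler_pdivlMr//.
have ind (b : bool) (x : R) : 0 <= x <= 1 -> `|b%:R - x| <= 1.
  move=> /andP[x0 x1]; rewrite ler_norml.
  by apply/andP; split; case: b => /=; rewrite ?mulr1n ?mulr0n; lra.
have ind1 (b : bool) : `|b%:R : R| <= 1 by case: b; rewrite /= ?normr1 ?normr0.
have P01 x : 0 <= @Phi R x <= 1 by rewrite Phi_ge0 Phi_le1.
have nP x : `|1 - Phi x| = Phi (- x) :> R by rewrite PhiN ger0_norm// subr_ge0 Phi_le1.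
have [z0|z0] := leP 0 z.
  rewrite ger0_norm//; split.
    rewrite /stein_deriv -addrA; apply: hC => //; first exact: ind.
    by move=> z1 wz; rewrite (_ : w <= z) ?nP//; lra.
  rewrite /stein_mono (ltNge z 0) z0 /= subr0; apply: hC => //.
  move=> z1 wz; rewrite (_ : z < w = false) ?normr0 ?Phi_ge0//.
  by apply/negbTE; rewrite -leNgt; lra.
have Nz0 : 0 <= - z by lra.
rewrite ltr0_norm// -[w ^+ (2 * k)]mulr1 -[X in _ * (1 + _ * X)](sqrr_sign R (odd k)).
have -> : w ^+ (2 * k) = (- w) ^+ (2 * k) by rewrite !exprM sqrrN.
rewrite sqrr_sign mulr1; split.
  have -> : stein_deriv z w ^+ 2 =
      (- w * stein_sol (- z) (- w) + ((- w < - z)%R%:R - Phi (- z))) ^+ 2.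
    rewrite -stein_solN /stein_deriv PhiN ltrN2 ltNge.
    by case: (w <= z) => /=; rewrite ?mulr1n ?mulr0n; ring.
  apply: hC => //; first exact: ind.
  by move=> z1 wz; rewrite (_ : - w < - z) ?nP//; lra.
have -> : stein_mono z w ^+ 2 =
    (- w * stein_sol (- z) (- w) + (- z <= - w)%R%:R) ^+ 2.
  rewrite -stein_solN /stein_mono z0 lerN2 ltNge.
  by case: (w <= z) => /=; rewrite ?mulr1n ?mulr0n; ring.
apply: hC => //.
move=> z1 wz; rewrite (_ : (- z <= - w) = false) ?normr0 ?Phi_ge0//.
by apply/negbTE; rewrite -ltNge; lra.
Qed.

Lemma measurable_mills_ratio : measurable_fun setT mills_ratio.
Proof.
by apply: continuous_measurable_fun => x; apply: is_derive_cont (is_derive_mills_ratio x).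
Qed.

Lemma measurable_stein_sol z : measurable_fun setT (stein_sol z).
Proof.
rewrite (_ : stein_sol z = fun w => if w <= z then mills_ratio w * Phi (- z)
    else Phi z * mills_ratio (- w)); last by apply/funext => w; rewrite stein_solE.
apply: measurable_fun_ifT => //; first exact: measurable_fun_ler.
- by apply: measurable_funM => //; exact: measurable_mills_ratio.
- apply: measurable_funM => //; apply: measurableT_comp => //.
  exact: measurable_mills_ratio.
Qed.

Lemma measurable_stein_deriv z : measurable_fun setT (stein_deriv z).
Proof.
have -> : stein_deriv z = fun w => w * stein_sol z w + \1_`]-oo, z] w - Phi z.
  by apply/funext => w; rewrite /stein_deriv indicE mem_setE in_itv.
apply: measurable_funB => //; apply: measurable_funD => //.
apply: measurable_funM => //; exact: measurable_stein_sol.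
Qed.

Lemma measurable_stein_mono z : measurable_fun setT (stein_mono z).
Proof.
have -> : stein_mono z = fun w => w * stein_sol z w + \1_`]z, +oo[ w - (z < 0)%R%:R.
  by apply/funext => w; rewrite /stein_mono indicE mem_setE in_itv/= andbT.
apply: measurable_funB => //; apply: measurable_funD => //.
apply: measurable_funM => //; exact: measurable_stein_sol.
Qed.

End stein.

(** * Sequences of signs and resampling operators *)

Definition coord_sets : set (set (nat -> bool)) :=
  [set A : set (nat -> bool) | exists i, A = (fun x => x i)].

(** The space of sign sequences, [true] standing for the value [1]. *)
Definition cube := g_sigma_algebraType coord_sets.

Definition flip (i : nat) (c : bool) (x : cube) : cube :=
  fun j => if j == i then c else x j.

Section flip_theory.
Implicit Types (i j : nat) (c d : bool) (x : cube).

Lemma flip_same i c x : flip i c x i = c. Proof. by rewrite /flip eqxx. Qed.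

Lemma flip_other i j c x : j != i -> flip i c x j = x j.
Proof. by rewrite /flip => /negbTE->. Qed.

Lemma flip_id i x : flip i (x i) x = x.
Proof. by apply/funext => j; rewrite /flip; case: eqP => [->|]. Qed.

Lemma flip_flip i c d x : flip i c (flip i d x) = flip i c x.
Proof. by apply/funext => j; rewrite /flip; case: eqP. Qed.

Lemma flipC i j c d x : i != j -> flip i c (flip j d x) = flip j d (flip i c x).
Proof.
move=> ij; apply/funext => k; rewrite /flip; case: eqP => // ->.
by rewrite (negbTE ij).
Qed.

Lemma measurable_flip i c : measurable_fun setT (flip i c).
Proof.
apply: (@measurability _ _ cube cube setT (flip i c) coord_sets) => //.
move=> _ [_ [j ->] <-]; rewrite setTI.
have [ji|ji] := eqVneq j i.
  case: c.
    rewrite (_ : _ @^-1` _ = setT) //; apply/seteqP; split => // x _.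
    by rewrite /preimage/= ji flip_same.
  rewrite (_ : _ @^-1` _ = set0) //; apply/seteqP; split => // x.
  by rewrite /preimage/= ji flip_same.
apply: sub_sigma_algebra; exists j; apply/seteqP.
by split => x /=; rewrite flip_other.
Qed.

Lemma measurable_bit i : measurable_fun setT (fun x : cube => x i).
Proof.
apply: (measurable_fun_bool true).
rewrite setTI; apply: sub_sigma_algebra; exists i; apply/seteqP.
by split => x /=.
Qed.

End flip_theory.

Section operators.
Context {R : realType} (p : nat -> R).
Hypothesis hp : forall i, 0 < p i < 1.
Implicit Types (i j l n a b : nat) (f g u : cube -> R) (x y : cube).

Local Notation s i := (Num.sqrt (pq p i)).

Lemma pq_gt0 i : 0 < pq p i.
Proof. by have /andP[p0 p1] := hp i; rewrite /pq mulr_gt0 ?subr_gt0. Qed.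

Lemma spq_gt0 i : 0 < s i. Proof. by rewrite sqrtr_gt0 pq_gt0. Qed.

Lemma spq_neq0 i : s i != 0. Proof. by rewrite gt_eqF ?spq_gt0. Qed.

Lemma spq_sqr i : s i ^+ 2 = p i * (1 - p i).
Proof. by rewrite sqr_sqrtr// ltW// pq_gt0. Qed.

(** The conditional expectation given all coordinates but the [i]-th, the discrete
    gradient, and the standardized [i]-th coordinate. *)
Definition avgi i f x : R :=
  p i * f (flip i true x) + (1 - p i) * f (flip i false x).

Definition dif i f x : R := s i * (f (flip i true x) - f (flip i false x)).

Definition std i x : R := (if x i then 1 - p i else - p i) / s i.

Definition indep_of i f := forall c x, f (flip i c x) = f x.

Lemma avgiD i f g : avgi i (fun x => f x + g x) = fun x => avgi i f x + avgi i g x.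
Proof. by apply/funext => x; rewrite /avgi; ring. Qed.

Lemma avgiZ i (k : R) f : avgi i (fun x => k * f x) = fun x => k * avgi i f x.
Proof. by apply/funext => x; rewrite /avgi; ring. Qed.

Lemma avgi_le i f g : (forall x, f x <= g x) -> forall x, avgi i f x <= avgi i g x.
Proof.
move=> fg x; have /andP[p0 p1] := hp i.
by apply: lerD; apply: ler_wpM2l => //; rewrite ?subr_ge0 ltW.
Qed.

Lemma avgi_cst i (k : R) : avgi i (fun=> k) = fun=> k.
Proof. by apply/funext => x; rewrite /avgi; ring. Qed.

Lemma avgi_indep i f : indep_of i f -> avgi i f = f.
Proof. by move=> h; apply/funext => x; rewrite /avgi !h; ring. Qed.

Lemma indep_avgi i f : indep_of i (avgi i f).
Proof. by move=> c x; rewrite /avgi !flip_flip. Qed.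

Lemma indep_avgi_other i j f : indep_of i f -> indep_of i (avgi j f).
Proof.
have [->|ij] := eqVneq i j; first by move=> _; exact: indep_avgi.
by move=> h c x; rewrite /avgi -!(flipC c _ x ij) !h.
Qed.

Lemma indep_dif i f : indep_of i (dif i f).
Proof. by move=> c x; rewrite /dif !flip_flip. Qed.

Lemma avgiM_indep i u f : indep_of i u ->
  avgi i (fun x => u x * f x) = fun x => u x * avgi i f x.
Proof. by move=> h; apply/funext => x; rewrite /avgi !h; ring. Qed.

Lemma avgiC i j f : avgi i (avgi j f) = avgi j (avgi i f).
Proof.
have [->//|ij] := eqVneq i j.
by apply/funext => x; rewrite /avgi !(flipC _ _ x ij); ring.
Qed.

Lemma dif_avgi i j f : i != j -> dif i (avgi j f) = avgi j (dif i f).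
Proof.
by move=> ij; apply/funext => x; rewrite /avgi /dif !(flipC _ _ x ij); ring.
Qed.

Lemma dif_avgi_same i f : dif i (avgi i f) = fun=> 0.
Proof. by apply/funext => x; rewrite /dif !indep_avgi subrr mulr0. Qed.

(** As [f] is affine in its [i]-th coordinate, it is the sum of its average and of
    the gradient times the standardized coordinate. *)
Lemma std_dif i f x : std i x * dif i f x = f x - avgi i f x.
Proof.
rewrite /std /dif -[in f x](flip_id i x) /avgi; have s0 := spq_neq0 i.
by case: (x i); field.
Qed.

(** The gradient is the covariance with the standardized coordinate. *)
Lemma avgi_std_mul i f : avgi i (fun x => std i x * f x) = dif i f.
Proof.
apply/funext => x; rewrite /avgi /std !flip_same /dif.
have s0 := spq_neq0 i; have s2 := spq_sqr i.
transitivity (p i * (1 - p i) / s i * (f (flip i true x) - f (flip i false x))).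
  by field.
by rewrite -s2; field.
Qed.

(** The one-coordinate variance identity behind the Poincare inequality. *)
Lemma avgi_sqr i f x :
  avgi i (fun x => f x ^+ 2) x = avgi i f x ^+ 2 + dif i f x ^+ 2.
Proof. by rewrite /dif exprMn spq_sqr /avgi; ring. Qed.

Lemma difD i f g : dif i (fun x => f x + g x) = fun x => dif i f x + dif i g x.
Proof. by apply/funext => x; rewrite /dif; ring. Qed.

Lemma difZ i (k : R) f : dif i (fun x => k * f x) = fun x => k * dif i f x.
Proof. by apply/funext => x; rewrite /dif; ring. Qed.

Lemma dif_cst i (k : R) : dif i (fun=> k) = fun=> 0.
Proof. by apply/funext => x; rewrite /dif subrr mulr0. Qed.

Lemma dif_sum i (J : Type) (r : seq J) (F : J -> cube -> R) x :
  dif i (fun x => \sum_(j <- r) F j x) x = \sum_(j <- r) dif i (F j) x.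
Proof.
elim: r => [|j r IH]; first by rewrite big_nil /dif !big_nil subrr mulr0.
by rewrite big_cons -IH /dif !big_cons; ring.
Qed.

(** Discrete Leibniz rule; the correction has a sign depending on the [i]-th
    coordinate of [x]. *)
Lemma dif_mul i f g x : exists2 e : R, `|e| = (s i)^-1 &
  dif i (fun x => f x * g x) x =
  dif i f x * g x + f x * dif i g x + e * (dif i f x * dif i g x).
Proof.
have s0 := spq_neq0 i; have sg := spq_gt0 i.
exists (if x i then - (s i)^-1 else (s i)^-1).
  by case: (x i); rewrite ?normrN gtr0_norm// invr_gt0.
rewrite /dif -[in g x](flip_id i x) -[in f x](flip_id i x).
by case: (x i); field.
Qed.

Lemma dif_norm i f x : `|dif i (fun x => `|f x|) x| <= `|dif i f x|.
Proof. by rewrite /dif !normrM ler_wpM2l// ler_dist_dist. Qed.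

Lemma dif_mul_norm i f g x : `|dif i (fun x => f x * g x) x| <=
  `|dif i f x| * `|g x| + `|f x| * `|dif i g x| +
  (s i)^-1 * (`|dif i f x| * `|dif i g x|).
Proof.
have [e he ->] := dif_mul i f g x.
rewrite -he -!normrM; apply: (le_trans (ler_normD _ _)).
by rewrite lerD2r ler_normD.
Qed.

(** The integral of [s ^ a * (1 - s) ^ b] over [0, 1]. *)
Definition beta_weight a b : R := (a`! * b`!)%:R / ((a + b).+1)`!%:R.

Lemma beta_weight_ge0 a b : 0 <= beta_weight a b.
Proof. by rewrite divr_ge0. Qed.

Lemma beta_weight00 : beta_weight 0 0 = 1.
Proof. by rewrite /beta_weight /= divr1. Qed.

Lemma beta_weightD a b :
  beta_weight a.+1 b + beta_weight a b.+1 = beta_weight a b.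
Proof.
rewrite /beta_weight !addSn !addnS [((a + b).+2)`!]factS !factS !natrM.
rewrite -!(natr1 (a + b).+1) -!(natr1 (a + b)) natrD -!(natr1 a) -!(natr1 b).
have h : ((a + b)`!)%:R != 0 :> R by rewrite pnatr_eq0 -lt0n fact_gt0.
have a0 : 0 <= a%:R :> R by []; have b0 : 0 <= b%:R :> R by [].
field; rewrite h /=.
by rewrite !lt0r_neq0//; lra.
Qed.

(** [resample n a b] is the integral over [s] in [0, 1] of
    [s ^ a * (1 - s) ^ b * \prod_(i < n) (s + (1 - s) * avgi i)]; for [a = b = 0]
    it resamples every coordinate [i < n] independently with probability
    [1 - s], with the same uniform [s] for all of them. *)
Fixpoint resample n a b f : cube -> R :=
  if n is m.+1 then
    fun x => resample m a.+1 b f x + resample m a b.+1 (avgi m f) x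
  else fun x => beta_weight a b * f x.

Fixpoint avg n f : cube -> R := if n is m.+1 then avg m (avgi m f) else f.

Lemma resampleD n a b f g :
  resample n a b (fun x => f x + g x) =
  fun x => resample n a b f x + resample n a b g x.
Proof.
elim: n a b f g => [|n IH] a b f g; apply/funext => x /=; first by rewrite mulrDr.
by rewrite avgiD !IH; ring.
Qed.

Lemma resampleZ n a b (k : R) f :
  resample n a b (fun x => k * f x) = fun x => k * resample n a b f x.
Proof.
elim: n a b f => [|n IH] a b f; apply/funext => x /=; first by rewrite mulrCA.
by rewrite avgiZ !IH; ring.
Qed.

Lemma resample_le n a b f g : (forall x, f x <= g x) ->
  forall x, resample n a b f x <= resample n a b g x.
Proof.
elim: n a b f g => [|n IH] a b f g fg x /=.
  by rewrite ler_wpM2l// beta_weight_ge0.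
by apply: lerD; apply: IH => // y; exact: avgi_le.
Qed.

Lemma resample_cst n a b (k : R) :
  resample n a b (fun=> k) = fun=> beta_weight a b * k.
Proof.
elim: n a b => [|n IH] a b //=; apply/funext => x.
by rewrite avgi_cst !IH -mulrDl beta_weightD.
Qed.

Lemma resample_sum n a b (J : Type) (r : seq J) (F : J -> cube -> R) x :
  resample n a b (fun x => \sum_(j <- r) F j x) x =
  \sum_(j <- r) resample n a b (F j) x.
Proof.
elim: r => [|j r IH].
  rewrite big_nil (_ : (fun _ => _) = fun=> 0) ?resample_cst ?mulr0//.
  by apply/funext => y; rewrite big_nil.
rewrite big_cons -IH.
rewrite (_ : (fun x => \sum_(j <- j :: r) F j x) =
  fun x => F j x + \sum_(j <- r) F j x) ?resampleD//.
by apply/funext => y; rewrite big_cons.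
Qed.

Lemma resample_ge0 n a b f : (forall x, 0 <= f x) ->
  forall x, 0 <= resample n a b f x.
Proof.
move=> f0 x; apply: le_trans (resample_le n a b f0 x).
by rewrite resample_cst mulr0.
Qed.

Lemma resampleS n a b f x :
  resample n a.+1 b f x + resample n a b.+1 f x = resample n a b f x.
Proof.
elim: n a b f x => [|n IH] a b f x /=; first by rewrite -mulrDl beta_weightD.
by rewrite addrACA !IH.
Qed.

Lemma resample_mul n a b u f : (forall i, (i < n)%N -> indep_of i u) ->
  resample n a b (fun x => u x * f x) = fun x => u x * resample n a b f x.
Proof.
elim: n a b f => [|n IH] a b f hu; apply/funext => x /=; first by rewrite mulrCA.
have hn i : (i < n)%N -> indep_of i u by move=> ni; apply: hu; exact: leqW.
rewrite (avgiM_indep f (hu _ (ltnSn n))) (IH _ _ _ hn) (IH _ _ _ hn); ring.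
Qed.

Lemma indep_resample i n a b f : indep_of i f -> indep_of i (resample n a b f).
Proof.
elim: n a b f => [|n IH] a b f h c x /=; first by rewrite h.
by rewrite !IH//; exact: indep_avgi_other.
Qed.

(** The gradient commutes with every average except the one in its own
    coordinate, which it kills; only some of the terms of [resample] survive. *)
Lemma dif_resample_norm l n a b f x :
  `|dif l (resample n a b f) x| <= resample n a b (fun x => `|dif l f x|) x.
Proof.
elim: n a b f x => [|n IH] a b f x /=.
  by rewrite difZ normrM ger0_norm// beta_weight_ge0.
rewrite difD; apply: (le_trans (ler_normD _ _)); apply: lerD => //.
apply: (le_trans (IH _ _ _ _)); apply: resample_le => y.
have [->|ln] := eqVneq l n.
  rewrite dif_avgi_same normr0.
  have := @avgi_le n (fun=> 0) (fun x => `|dif n f x|) (fun x => normr_ge0 _) y.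
  by rewrite avgi_cst.
rewrite dif_avgi//; have /andP[p0 p1] := hp n.
rewrite /avgi; apply: (le_trans (ler_normD _ _)); rewrite !normrM.
have q0 : 0 <= 1 - p n by rewrite subr_ge0 ltW.
by rewrite (ger0_norm (ltW p0)) (ger0_norm q0).
Qed.

(** Differentiating the product in the integral that defines [resample] in [s]
    replaces one factor [s + (1 - s) * avgi j] by [1 - avgi j]; the fundamental
    theorem of calculus then gives the boundary terms. *)
Lemma resample_by_parts n a b f x :
  \sum_(j < n) std j x * resample n a b (dif j f) x =
  (b == 0)%N%:R * f x - (a == 0)%N%:R * avg n f x
  - a%:R * resample n a.-1 b f x + b%:R * resample n a b.-1 f x.
Proof.
elim: n a b f x => [|n IH] a b f x.
  have h (m : nat) : (m`!)%:R != 0 :> R by rewrite pnatr_eq0 -lt0n fact_gt0.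
  have pred c d : c.+1%:R * beta_weight c d = (c.+1`! * d`!)%:R / (c + d).+1`!%:R.
    by rewrite /beta_weight mulrA -natrM mulnA -factS.
  have pred' c d : d.+1%:R * beta_weight c d = (c`! * d.+1`!)%:R / (c + d).+1`!%:R.
    by rewrite /beta_weight mulrA -natrM mulnCA -factS.
  rewrite big_ord0 /= !(mulrA _ (beta_weight _ _)); case: a => [|a]; case: b => [|b] /=.
  - by ring.
  - by rewrite pred' add0n mul1n divff//; ring.
  - by rewrite pred addn0 muln1 divff//; ring.
  - by rewrite pred pred' addnS addSn; ring.
rewrite big_ord_recr /=.
have -> : \sum_(j < n) std j x * (resample n a.+1 b (dif j f) x
      + resample n a b.+1 (avgi n (dif j f)) x) =
    \sum_(j < n) std j x * resample n a.+1 b (dif j f) x +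
    \sum_(j < n) std j x * resample n a b.+1 (dif j (avgi n f)) x.
  rewrite -big_split /=; apply: eq_bigr => j _; rewrite mulrDr dif_avgi//.
  by rewrite ltn_eqF.
rewrite !IH (avgi_indep (indep_dif n f)) resampleS.
have -> : std n x * resample n a b (dif n f) x =
    resample n a b f x - resample n a b (avgi n f) x.
  have hu i : (i < n)%N -> indep_of i (std n).
    by move=> ni c y; rewrite /std flip_other// gtn_eqF.
  have := resample_mul a b (dif n f) hu.
  rewrite (_ : (fun x => std n x * dif n f x) = fun x => f x + -1 * avgi n f x).
    by rewrite resampleD resampleZ => /(congr1 (fun f => f x)) <-; ring.
  by apply/funext => y; rewrite std_dif; ring.
case: a => [|a]; case: b => [|b] /=; rewrite -?natr1; ring.
Qed.

End operators.

(** * Real-valued expectations *)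

Section expectations.
Context {d} {T : measurableType d} {R : realType} (P : probability T R).
Implicit Types (f g : T -> R).

Definition L1 f := P.-integrable setT (EFin \o f).
Definition L2 f := measurable_fun setT f /\ L1 (fun x => f x ^+ 2).
Definition L4 f := measurable_fun setT f /\ L1 (fun x => f x ^+ 4).
(** The expectation as a real number; it is meaningful for [L1] functions. *)
Definition Ex f : R := \int[P]_x f x.

Lemma L1_measurable f : L1 f -> measurable_fun setT f.
Proof. by move=> /integrableP[/measurable_EFinP]. Qed.

Lemma L1_le f g : measurable_fun setT f -> L1 g -> (forall x, `|f x| <= g x) -> L1 f.
Proof.
move=> mf ig fg; apply: (le_integrable _ _ _ ig) => //.
  exact/measurable_EFinP.
by move=> x _ /=; rewrite lee_fin (le_trans (fg x))// ler_norm.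
Qed.

Lemma L1_cst (k : R) : L1 (fun=> k).
Proof. exact: finite_measure_integrable_cst. Qed.

Lemma L1D f g : L1 f -> L1 g -> L1 (fun x => f x + g x).
Proof. by move=> h1 h2; have := integrableD measurableT h1 h2. Qed.

Lemma L1Z (k : R) f : L1 f -> L1 (fun x => k * f x).
Proof. by move=> h; have := integrableZl measurableT k h. Qed.

Lemma L1B f g : L1 f -> L1 g -> L1 (fun x => f x - g x).
Proof. by move=> h1 h2; have := integrableB measurableT h1 h2. Qed.

Lemma L1_sum (J : Type) (r : seq J) (F : J -> T -> R) :
  (forall j, L1 (F j)) -> L1 (fun x => \sum_(j <- r) F j x).
Proof.
move=> h; elim: r => [|j r IH].
  by rewrite (_ : (fun _ => _) = fun=> 0); [exact: L1_cst|apply/funext => x; rewrite big_nil].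
rewrite (_ : (fun _ => _) = fun x => F j x + \sum_(j <- r) F j x); first exact: L1D.
by apply/funext => x; rewrite big_cons.
Qed.

Lemma L1_norm f : L1 f -> L1 (fun x => `|f x|).
Proof.
move=> h; apply: (L1_le (g := fun x => `|f x|)) => //.
- by apply: measurableT_comp => //; exact: L1_measurable.
- by have := integrable_norm h.
- by move=> x; rewrite normr_id.
Qed.

Lemma L1_bounded f (k : R) : measurable_fun setT f -> (forall x, `|f x| <= k) -> L1 f.
Proof. by move=> mf h; apply: L1_le (L1_cst k) h. Qed.

Lemma Ex_cst (k : R) : Ex (fun=> k) = k.
Proof.
rewrite /Ex Rintegral_cst// -[RHS]mulr1; congr (_ * _).
exact: (congr1 fine (probability_setT P)).
Qed.

Lemma ExD f g : L1 f -> L1 g -> Ex (fun x => f x + g x) = Ex f + Ex g.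
Proof. by move=> h1 h2; rewrite /Ex RintegralD. Qed.

Lemma ExB f g : L1 f -> L1 g -> Ex (fun x => f x - g x) = Ex f - Ex g.
Proof. by move=> h1 h2; rewrite /Ex RintegralB. Qed.

Lemma ExZ (k : R) f : L1 f -> Ex (fun x => k * f x) = k * Ex f.
Proof. by move=> h; rewrite /Ex RintegralZl. Qed.

Lemma Ex_sum (J : Type) (r : seq J) (F : J -> T -> R) :
  (forall j, L1 (F j)) -> Ex (fun x => \sum_(j <- r) F j x) = \sum_(j <- r) Ex (F j).
Proof.
move=> h; elim: r => [|j r IH].
  by rewrite big_nil -[RHS](Ex_cst 0); congr Ex; apply/funext => x; rewrite big_nil.
rewrite big_cons -IH -ExD//; last exact: L1_sum.
by congr Ex; apply/funext => x; rewrite big_cons.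
Qed.

Lemma Ex_ge0 f : (forall x, 0 <= f x) -> 0 <= Ex f.
Proof. by move=> f0; apply: Rintegral_ge0. Qed.

Lemma Ex_le f g : L1 f -> L1 g -> (forall x, f x <= g x) -> Ex f <= Ex g.
Proof. by move=> h1 h2 fg; apply: le_Rintegral. Qed.

Lemma Ex_le_norm f g : measurable_fun setT f -> L1 g ->
  (forall x, `|f x| <= g x) -> `|Ex f| <= Ex g.
Proof.
move=> mf ig fg; have h1 := L1_le mf ig fg.
apply: (le_trans (le_normr_Rintegral measurableT h1)).
by apply: Ex_le => //; exact: L1_norm.
Qed.

Lemma L2_le f g : measurable_fun setT f -> L2 g -> (forall x, `|f x| <= `|g x|) -> L2 f.
Proof.
move=> mf [mg ig] fg; split=> //; apply: L1_le ig _.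
  exact: measurable_funX.
move=> x; rewrite normrX -[g x ^+ 2]real_normK ?num_real//.
by apply: lerXn2r; rewrite ?nnegrE.
Qed.

Lemma L2M f g : L2 f -> L2 g -> L1 (fun x => f x * g x).
Proof.
move=> [mf if2] [mg ig2]; apply: (L1_le _ (L1D if2 ig2)).
  exact: measurable_funM.
move=> x; rewrite normrM -[f x ^+ 2]real_normK ?num_real//.
rewrite -[g x ^+ 2]real_normK ?num_real//.
have := sqr_ge0 (`|f x| - `|g x|); have := sqr_ge0 (`|f x|); have := sqr_ge0 (`|g x|).
by rewrite sqrrB; lra.
Qed.

Lemma L2D f g : L2 f -> L2 g -> L2 (fun x => f x + g x).
Proof.
move=> h1 h2; have [mf if2] := h1; have [mg ig2] := h2.
split; first exact: measurable_funD.
rewrite (_ : (fun _ => _) = fun x => f x ^+ 2 + (2 * (f x * g x) + g x ^+ 2)).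
  by apply: L1D => //; apply: L1D => //; apply: L1Z; exact: L2M.
by apply/funext => x; ring.
Qed.

Lemma L2Z (k : R) f : L2 f -> L2 (fun x => k * f x).
Proof.
move=> [mf if2]; split; first exact: measurable_funM.
rewrite (_ : (fun _ => _) = fun x => k ^+ 2 * f x ^+ 2); first exact: L1Z.
by apply/funext => x; ring.
Qed.

Lemma L2B f g : L2 f -> L2 g -> L2 (fun x => f x - g x).
Proof.
move=> h1 h2; rewrite (_ : (fun _ => _) = fun x => f x + -1 * g x).
  by apply: L2D => //; exact: L2Z.
by apply/funext => x; ring.
Qed.

Lemma L2_cst (k : R) : L2 (fun=> k).
Proof. by split => //; exact: L1_cst. Qed.

Lemma L2_bounded f (k : R) : measurable_fun setT f -> (forall x, `|f x| <= k) -> L2 f.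
Proof.
move=> mf h; apply: (L2_le mf (L2_cst k)) => x.
by rewrite (le_trans (h x))// ler_norm.
Qed.

Lemma L2_L1 f : L2 f -> L1 f.
Proof.
move=> h; have := L2M h (L2_cst 1).
by under [X in L1 X]funext do rewrite mulr1.
Qed.

Lemma L2_sum (J : Type) (r : seq J) (F : J -> T -> R) :
  (forall j, L2 (F j)) -> L2 (fun x => \sum_(j <- r) F j x).
Proof.
move=> h; elim: r => [|j r IH].
  by rewrite (_ : (fun _ => _) = fun=> 0); [exact: L2_cst|apply/funext => x; rewrite big_nil].
rewrite (_ : (fun _ => _) = fun x => F j x + \sum_(j <- r) F j x); first exact: L2D.
by apply/funext => x; rewrite big_cons.
Qed.

Lemma L2_mul_bounded f g (k : R) : L2 f -> measurable_fun setT g ->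
  (forall x, `|g x| <= k) -> L2 (fun x => f x * g x).
Proof.
move=> h mg gk; apply: (@L2_le _ (fun x => k * f x)).
- by apply: measurable_funM => //; case: h.
- exact: L2Z.
- move=> x; rewrite !normrM mulrC; apply: ler_wpM2r => //.
  by rewrite (le_trans (gk x))// ler_norm.
Qed.

Lemma L4_sqr f : L4 f -> L2 (fun x => f x ^+ 2).
Proof.
move=> [mf if4]; split; first exact: measurable_funX.
by under [X in L1 X]funext do rewrite -exprM.
Qed.

Lemma sqr_L4 f : measurable_fun setT f -> L2 (fun x => f x ^+ 2) -> L4 f.
Proof.
by move=> mf [_ h]; split => //; move: h; under [X in L1 X]funext do rewrite -exprM.
Qed.

Lemma L4_le f g : measurable_fun setT f -> L4 g -> (forall x, `|f x| <= `|g x|) -> L4 f.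
Proof.
move=> mf hg fg; apply: sqr_L4 => //; apply: L2_le (L4_sqr hg) _.
  exact: measurable_funX.
by move=> x; rewrite !normrX; apply: lerXn2r; rewrite ?nnegrE.
Qed.

Lemma L4M f g : L4 f -> L4 g -> L2 (fun x => f x * g x).
Proof.
move=> hf hg; split; first by apply: measurable_funM; [case: hf|case: hg].
under [X in L1 X]funext do rewrite exprMn.
by apply: L2M; exact: L4_sqr.
Qed.

Lemma L4_L2 f : L4 f -> L2 f.
Proof.
by move=> h; split; [case: h|exact: L2_L1 (L4_sqr h)].
Qed.

Lemma L4Z (k : R) f : L4 f -> L4 (fun x => k * f x).
Proof.
move=> h; apply: sqr_L4; first by apply: measurable_funM => //; case: h.
under [X in L2 X]funext do rewrite exprMn.
by apply: L2Z; exact: L4_sqr.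
Qed.

Lemma L4D f g : L4 f -> L4 g -> L4 (fun x => f x + g x).
Proof.
move=> hf hg; apply: sqr_L4; first by apply: measurable_funD; [case: hf|case: hg].
rewrite (_ : (fun _ => _) = fun x => f x ^+ 2 + (2 * (f x * g x) + g x ^+ 2)).
  apply: L2D; first exact: L4_sqr.
  by apply: L2D; [apply: L2Z; exact: L4M|exact: L4_sqr].
by apply/funext => x; ring.
Qed.

Lemma L4_norm f : L4 f -> L4 (fun x => `|f x|).
Proof.
move=> h; apply: (L4_le _ h); last by move=> x; rewrite normr_id.
by apply: measurableT_comp => //; case: h.
Qed.

(** The discriminant argument for [t ^+ 2 * A - 2 * t * C + B], with [t = C / A]
    when [A] is positive, and [t] large when [A] vanishes. *)
Lemma Ex_cauchy_schwarz f g : L2 f -> L2 g ->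
  Ex (fun x => `|f x * g x|) <=
  Num.sqrt (Ex (fun x => f x ^+ 2)) * Num.sqrt (Ex (fun x => g x ^+ 2)).
Proof.
move=> hf hg; have if2 := hf.2; have ig2 := hg.2.
set A := Ex (fun x => f x ^+ 2); set B := Ex (fun x => g x ^+ 2).
set C := Ex _.
have A0 : 0 <= A by apply: Ex_ge0 => x; exact: sqr_ge0.
have B0 : 0 <= B by apply: Ex_ge0 => x; exact: sqr_ge0.
have C0 : 0 <= C by apply: Ex_ge0.
have iC : L1 (fun x => `|f x * g x|) by apply: L1_norm; exact: L2M.
have key t : 2 * t * C <= t ^+ 2 * A + B.
  rewrite -!ExZ// -ExD//; last exact: L1Z.
  apply: Ex_le; [exact: L1Z|by apply: L1D => //; exact: L1Z|] => x.
  rewrite normrM -[f x ^+ 2]real_normK ?num_real// -[g x ^+ 2]real_normK ?num_real//.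
  have := sqr_ge0 (t * `|f x| - `|g x|); lra.
rewrite -sqrtrM// -[leLHS]ger0_norm// -sqrtr_sqr ler_wsqrtr//.
have [A00|Ane] := eqVneq A 0.
  rewrite A00 mul0r.
  have [->|Cne] := eqVneq C 0; first by rewrite expr0n.
  have Cp : 0 < C by rewrite lt_neqAle eq_sym Cne.
  have := key ((B + 1) / (2 * C)); rewrite A00 mulr0 add0r.
  have -> : 2 * ((B + 1) / (2 * C)) * C = B + 1 by field.
  by lra.
have Ap : 0 < A by rewrite lt_neqAle eq_sym Ane.
have := key (C / A).
have -> : 2 * (C / A) * C = 2 * C ^+ 2 / A by field.
have -> : (C / A) ^+ 2 * A = C ^+ 2 / A by field.
rewrite -lerBlDl.
have -> : 2 * C ^+ 2 / A - C ^+ 2 / A = C ^+ 2 / A by ring.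
by rewrite ler_pdivrMr// [B * A]mulrC.
Qed.

Lemma dominated_small (G : nat -> T -> R) g :
  (forall n, measurable_fun setT (G n)) -> L1 g ->
  (forall n x, 0 <= G n x <= g x) -> (forall x, G n x @[n --> \oo] --> 0) ->
  forall e, 0 < e -> exists n, Ex (G n) <= e.
Proof.
move=> mG ig Gg G0 e e0.
have h1 n : measurable_fun setT (EFin \o G n) by exact/measurable_EFinP.
have h2 : {ae P, forall x, setT x -> (EFin \o G n) x @[n --> \oo] --> (0 : R)%:E}.
  apply: aeW => x _; apply: cvg_EFin; [exact: nearW|exact: G0].
have h3 : {ae P, forall x n, setT x -> (`|(EFin \o G n) x| <= (EFin \o g) x)%E}.
  apply: aeW => x n _; rewrite /= lee_fin; have /andP[g0 gg] := Gg n x.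
  by rewrite ger0_norm.
have [_ _] := dominated_convergence measurableT h1 (measurable_cst (0 : R)%:E) h2 ig h3.
rewrite integral0 => /fine_cvg /cvgrPdist_le /(_ e e0) [n _ /(_ n (leqnn n))].
by rewrite sub0r normrN => /(le_trans (ler_norm _)); exists n.
Qed.

End expectations.

(** * Duality and the Poincare inequality *)

HB.instance Definition _ i c :=
  isMeasurableFun.Build _ _ _ _ (flip i c) (measurable_flip i c).

Section closed_classes.
Context {R : realType} (p : nat -> R).
Implicit Types (f g : cube -> R) (i n a b : nat).

(** Integrability and measurability are transported through all the operators by
    checking that they are stable under sums, multiples and substitution of a
    coordinate. *)
Definition stable_class (Q : (cube -> R) -> Prop) :=
  [/\ forall f g, Q f -> Q g -> Q (fun x => f x + g x),
      forall (k : R) f, Q f -> Q (fun x => k * f x) &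
      forall i c f, Q f -> Q (f \o flip i c)].

Variable Q : (cube -> R) -> Prop.
Hypothesis hQ : stable_class Q.

Lemma stable_avgi i f : Q f -> Q (avgi p i f).
Proof.
have [hD hZ hf] := hQ; move=> h.
by apply: (hD); apply: (hZ); [exact: (hf i true)|exact: (hf i false)].
Qed.

Lemma stable_dif i f : Q f -> Q (dif p i f).
Proof.
have [hD hZ hf] := hQ; move=> h; apply: (hZ).
rewrite (_ : (fun x => _) = fun x => (f \o flip i true) x + -1 * (f \o flip i false) x).
  by apply: (hD); [exact: hf|apply: (hZ); exact: hf].
by apply/funext => x /=; ring.
Qed.

Lemma stable_resample n a b f : Q f -> Q (resample p n a b f).
Proof.
have [hD hZ hf] := hQ.
elim: n a b f => [|n IH] a b f h /=; first exact: hZ.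
by apply: (hD); apply: IH => //; exact: stable_avgi.
Qed.

Lemma stable_avg n f : Q f -> Q (avg p n f).
Proof. by elim: n f => [|n IH] f h //=; apply: IH; exact: stable_avgi. Qed.

End closed_classes.

Section cube_measure.
Context {R : realType} (p : nat -> R) (mu : probability cube R).
Hypothesis hp : forall i, 0 < p i < 1.
Hypothesis hlaw : forall i (A : set cube), measurable A ->
  (mu A = (p i)%:E * mu (flip i true @^-1` A) +
          (1 - p i)%:E * mu (flip i false @^-1` A))%E.
Implicit Types (f g u : cube -> R) (i j l n a b : nat).

Local Notation Ex := (Ex mu).
Local Notation L1 := (L1 mu).
Local Notation L2 := (L2 mu).
Local Notation L4 := (L4 mu).

(** The product structure of [mu] enters the integrals only through this
    disintegration along one coordinate. *)
Lemma ge0_integral_flip i (f : cube -> \bar R) : measurable_fun setT f ->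
  (forall x, 0 <= f x)%E ->
  (\int[mu]_x f x = (p i)%:E * \int[mu]_x f (flip i true x) +
     (1 - p i)%:E * \int[mu]_x f (flip i false x))%E.
Proof.
move=> mf f0; have /andP[p0 p1] := hp i.
have q0 : 0 <= 1 - p i by rewrite subr_ge0 ltW.
pose m1 := mscale (NngNum (ltW p0)) (distribution mu (flip i true)).
pose m2 := mscale (NngNum q0) (distribution mu (flip i false)).
rewrite (@eq_measure_integral _ _ _ _ (measure_add m1 m2)); last first.
  by move=> A mA _; exact: (etrans (hlaw i mA) (esym (measure_addE m1 m2 A))).
rewrite ge0_integral_measure_add// !ge0_integral_mscale//.
by rewrite !ge0_integral_distribution.
Qed.

(** Fixing a coordinate costs at most the factor [1 / p i] or [1 / (1 - p i)]. *)
Lemma L1_flip i c f : L1 f -> L1 (f \o flip i c).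
Proof.
move=> hf; have mf := L1_measurable hf.
have mfc : measurable_fun setT (f \o flip i c) by apply: measurableT_comp.
apply/integrableP; split; first exact/measurable_EFinP.
have /integrableP[_] := hf.
rewrite (ge0_integral_flip i (f := fun x => `|(EFin \o f) x|%E)) //; last first.
  by apply/measurable_EFinP; apply: measurableT_comp.
have /andP[p0 p1] := hp i; have q0 : 0 < 1 - p i by rewrite subr_gt0.
have I0 c' : (0 <= \int[mu]_x `|(EFin \o f) (flip i c' x)|)%E by exact: integral_ge0.
have M0 (k : R) c' : 0 < k -> (0 <= k%:E * \int[mu]_x `|(EFin \o f) (flip i c' x)|)%E.
  by move=> k0; apply: mule_ge0 => //; rewrite lee_fin ltW.
have fin (k : R) (I : \bar R) : 0 < k -> (0 <= I)%E -> (k%:E * I < +oo)%E -> (I < +oo)%E.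
  by case: I => [r k0 _ _||] //; [exact: ltry|move=> k0 _; rewrite gt0_muley ?lte_fin// ltxx].
move=> h; case: c {mfc}.
  by apply: (fin (p i) _ p0 (I0 true)); apply: le_lt_trans h; exact: leeDl (M0 _ _ q0).
by apply: (fin (1 - p i) _ q0 (I0 false)); apply: le_lt_trans h; exact: leeDr (M0 _ _ p0).
Qed.

Lemma stable_measurable : stable_class (fun f => measurable_fun setT f).
Proof.
split=> [f g|k f|i c f] *; [exact: measurable_funD|exact: measurable_funM|].
exact: measurableT_comp.
Qed.

Lemma stable_L1 : stable_class L1.
Proof.
by split=> [f g|k f|i c f] *; [exact: L1D|exact: L1Z|exact: L1_flip].
Qed.

Lemma stable_L2 : stable_class L2.
Proof.
split; [exact: L2D|exact: L2Z|move=> i c f [mf h]].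
by split; [exact: measurableT_comp|exact: (L1_flip i c h)].
Qed.

Lemma stable_L4 : stable_class L4.
Proof.
split; [exact: L4D|exact: L4Z|move=> i c f [mf h]].
by split; [exact: measurableT_comp|exact: (L1_flip i c h)].
Qed.

(** For nonnegative functions this is the disintegration; in general it follows by
    writing [f] as the difference of [`|f| + f] and [`|f|]. *)
Lemma Ex_avgi i f : L1 f -> Ex (avgi p i f) = Ex f.
Proof.
have ge0 g : L1 g -> (forall x, 0 <= g x) -> Ex (avgi p i g) = Ex g.
  move=> hg g0.
  have h1 := L1_flip i true hg; have h2 := L1_flip i false hg.
  rewrite /avgi ExD ?ExZ//; [|exact: L1Z|exact: L1Z].
  rewrite [RHS]/Rintegral (ge0_integral_flip i (f := EFin \o g)) //; last first.
    by apply/measurable_EFinP; exact: L1_measurable hg.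
  have fin c : (\int[mu]_x (EFin \o g) (flip i c x))%E \is a fin_num.
    by apply: integrable_fin_num => //; case: c.
  by rewrite fineD ?fin_numM// !fineM.
move=> hf; have hn := L1_norm hf.
have E1 : Ex (avgi p i (fun x => `|f x| + f x)) = Ex (fun x => `|f x| + f x).
  apply: ge0; first exact: L1D.
  by move=> x; have := ler_norm (- f x); rewrite normrN; lra.
have E2 : Ex (avgi p i (fun x => `|f x|)) = Ex (fun x => `|f x|) by exact: ge0.
have a1 : L1 (avgi p i (fun x => `|f x|)) := stable_avgi p stable_L1 i hn.
have a2 : L1 (avgi p i f) := stable_avgi p stable_L1 i hf.
by move: E1; rewrite avgiD (ExD a1 a2) (ExD hn hf) E2 => /addrI.
Qed.

Lemma Ex_resample n a b f : L1 f ->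
  Ex (resample p n a b f) = beta_weight a b * Ex f.
Proof.
elim: n a b f => [|n IH] a b f hf /=; first by rewrite ExZ.
have ha : L1 (avgi p n f) by exact: (stable_avgi p stable_L1 n hf).
rewrite (ExD (stable_resample p stable_L1 n _ _ hf) (stable_resample p stable_L1 n _ _ ha)).
by rewrite !IH// Ex_avgi// -mulrDl beta_weightD.
Qed.

Lemma Ex_avg n f : L1 f -> Ex (avg p n f) = Ex f.
Proof.
elim: n f => [|n IH] f hf //=; rewrite IH ?Ex_avgi//.
exact: (stable_avgi p stable_L1 n hf).
Qed.

(** Integration by parts: averaging the left-hand side in the [i]-th coordinate
    produces the gradient by [avgi_std_mul]. *)
Lemma Ex_std_mul i u f : indep_of i u -> L1 (fun x => std p i x * (u x * f x)) ->
  Ex (fun x => std p i x * (u x * f x)) = Ex (fun x => u x * dif p i f x).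
Proof.
move=> hu h; rewrite -(Ex_avgi i h) avgi_std_mul//; congr Ex.
by apply/funext => x; rewrite /dif !hu; ring.
Qed.

(** Jensen's inequality for a positive operator fixing constants, obtained by
    applying it to [(f y - c) ^+ 2] with [c] its value at [f]. *)
Lemma resample_sqr_le n f x :
  resample p n 0 0 f x ^+ 2 <= resample p n 0 0 (fun y => f y ^+ 2) x.
Proof.
set c := resample p n 0 0 f x.
have := @resample_ge0 _ p hp n 0 0 (fun y => (f y - c) ^+ 2) (fun y => sqr_ge0 _) x.
rewrite (_ : (fun y => (f y - c) ^+ 2) = fun y => f y ^+ 2 + (- 2 * c * f y + c ^+ 2)).
  rewrite resampleD resampleD resampleZ resample_cst beta_weight00 mul1r -/c; lra.
by apply/funext => y; ring.
Qed.

Lemma avgiE_sqr_le i f x : avgi p i f x ^+ 2 <= avgi p i (fun y => f y ^+ 2) x.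
Proof. by rewrite avgi_sqr// lerDl sqr_ge0. Qed.

Lemma avg_le n f g : (forall x, f x <= g x) -> forall x, avg p n f x <= avg p n g x.
Proof.
elim: n f g => [|n IH] f g fg x //=.
by apply: IH => y; exact: avgi_le.
Qed.

Lemma avg_sqr_le n f x : avg p n f x ^+ 2 <= avg p n (fun y => f y ^+ 2) x.
Proof.
elim: n f x => [|n IH] f x //=; apply: (le_trans (IH _ _)).
by apply: avg_le => y; exact: avgiE_sqr_le.
Qed.

Lemma Ex_avg_sqr_le n f : L2 f -> Ex (fun x => avg p n f x ^+ 2) <= Ex (fun x => f x ^+ 2).
Proof.
move=> hf; rewrite -(Ex_avg n hf.2); apply: Ex_le.
- by have [] := stable_avg p stable_L2 n hf.
- exact: (stable_avg p stable_L1 n hf.2).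
- by move=> x; exact: avg_sqr_le.
Qed.

Lemma avgi_avg i n f : avgi p i (avg p n f) = avg p n (avgi p i f).
Proof. by elim: n f => [|n IH] f //=; rewrite IH avgiC. Qed.

Lemma dif_avg i n f : (n <= i)%N -> dif p i (avg p n f) = avg p n (dif p i f).
Proof.
elim: n f => [|n IH] f ni //=; rewrite IH ?(ltnW ni)// dif_avgi//.
by rewrite gtn_eqF.
Qed.

(** Averaging out one more coordinate loses exactly the mean square of a gradient
    of [avg n f], which is at most that of the gradient of [f]. *)
Lemma Ex_poincare_step n f : L2 f ->
  Ex (fun x => avg p n f x ^+ 2) <=
  Ex (fun x => avg p n.+1 f x ^+ 2) + Ex (fun x => dif p n f x ^+ 2).
Proof.
move=> hf; have ha := stable_avg p stable_L2 n hf.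
have hd := stable_dif p stable_L2 n hf.
rewrite -(Ex_avgi n ha.2).
rewrite (_ : avgi p n (fun x => avg p n f x ^+ 2) =
   fun x => avg p n.+1 f x ^+ 2 + avg p n (dif p n f) x ^+ 2).
  rewrite ExD; last 2 first.
  - by have [] := stable_avg p stable_L2 n.+1 hf.
  - by have [] := stable_avg p stable_L2 n hd.
  by rewrite lerD2l; exact: Ex_avg_sqr_le.
by apply/funext => x; rewrite avgi_sqr// avgi_avg dif_avg.
Qed.

Lemma Ex_poincare n f : L2 f -> Ex (fun x => f x ^+ 2) <=
  Ex (fun x => avg p n f x ^+ 2) + \sum_(l < n) Ex (fun x => dif p l f x ^+ 2).
Proof.
move=> hf; elim: n => [|n IH]; first by rewrite big_ord0 addr0.
apply: (le_trans IH); rewrite big_ord_recr /= addrA addrAC lerD2r.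
exact: Ex_poincare_step.
Qed.

End cube_measure.

(** * Averaging out more and more coordinates *)

Section mixing.
Context {R : realType} (p : nat -> R) (mu : probability cube R).
Hypothesis hp : forall i, 0 < p i < 1.
Hypothesis hlaw : forall i (A : set cube), measurable A ->
  (mu A = (p i)%:E * mu (flip i true @^-1` A) +
          (1 - p i)%:E * mu (flip i false @^-1` A))%E.
Implicit Types (f g u : cube -> R) (i j l n a b N : nat) (A B : set cube).

Local Notation Ex := (Ex mu).
Local Notation L1 := (L1 mu).
Local Notation L2 := (L2 mu).
Local Notation avg := (avg p).

Lemma avgD n f g : avg n (fun x => f x + g x) = fun x => avg n f x + avg n g x.
Proof. by elim: n f g => [|n IH] f g //=; rewrite avgiD IH. Qed.

Lemma avgZ n (k : R) f : avg n (fun x => k * f x) = fun x => k * avg n f x.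
Proof. by elim: n f => [|n IH] f //=; rewrite avgiZ IH. Qed.

Lemma L2_avg n f : L2 f -> L2 (avg n f).
Proof. exact: (stable_avg p (stable_L2 hp hlaw) n). Qed.

Definition mixing f := L2 f /\ forall e : R, 0 < e ->
  exists N, forall n, (N <= n)%N -> Ex (fun x => (avg n f x - Ex f) ^+ 2) <= e.

Lemma Ex_sqrD_le f g : L2 f -> L2 g ->
  Ex (fun x => (f x + g x) ^+ 2) <=
  2 * Ex (fun x => f x ^+ 2) + 2 * Ex (fun x => g x ^+ 2).
Proof.
move=> hf hg; rewrite -(ExZ 2 hf.2) -(ExZ 2 hg.2) -(ExD (L1Z 2 hf.2) (L1Z 2 hg.2)).
apply: Ex_le; [exact: (L2D hf hg).2|apply: L1D; apply: L1Z; [exact: hf.2|exact: hg.2]|].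
by move=> x; have := sqr_ge0 (f x - g x); rewrite sqrrB sqrrD; lra.
Qed.

Lemma L2_centered n f : L2 f -> L2 (fun x => avg n f x - Ex f).
Proof. by move=> hf; apply: L2B; [exact: L2_avg|exact: L2_cst]. Qed.

Lemma mixingD f g : mixing f -> mixing g -> mixing (fun x => f x + g x).
Proof.
move=> [hf mf] [hg mg]; split; first exact: L2D.
move=> e e0; have e4 : 0 < e / 4 by lra.
have [N1 h1] := mf _ e4; have [N2 h2] := mg _ e4.
exists (maxn N1 N2) => n; rewrite geq_max => /andP[/h1 n1 /h2 n2].
have := Ex_sqrD_le (L2_centered n hf) (L2_centered n hg).
rewrite avgD (ExD (L2_L1 hf) (L2_L1 hg)).
rewrite (_ : (fun x => (_ + _) ^+ 2) =
  fun x => (avg n f x + avg n g x - (Ex f + Ex g)) ^+ 2); first lra.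
by apply/funext => x; congr (_ ^+ 2); ring.
Qed.

Lemma mixingZ (k : R) f : mixing f -> mixing (fun x => k * f x).
Proof.
move=> [hf mf]; split; first exact: L2Z.
move=> e e0; have k0 : 0 < k ^+ 2 + 1 by have := sqr_ge0 k; lra.
have [N h] := mf _ (divr_gt0 e0 k0).
exists N => n /h; rewrite ler_pdivlMr// => h1.
rewrite avgZ (ExZ _ (L2_L1 hf)).
rewrite (_ : (fun x => _) = fun x => k ^+ 2 * (avg n f x - Ex f) ^+ 2).
  rewrite ExZ; last exact: (L2_centered n hf).2.
  have := Ex_ge0 mu (fun x => sqr_ge0 (avg n f x - Ex f)); lra.
by apply/funext => x; ring.
Qed.

Lemma mixing_cst (k : R) : mixing (fun=> k).
Proof.
split; first exact: L2_cst.
have E n : avg n (fun=> k) = fun=> k by elim: n => [|n IH] //=; rewrite avgi_cst.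
move=> e e0; exists 0%N => n _; rewrite E Ex_cst.
by rewrite Ex_cst subrr expr0n ltW.
Qed.

Lemma mixing_sum (J : Type) (r : seq J) (F : J -> cube -> R) :
  (forall t, mixing (F t)) -> mixing (fun x => \sum_(t <- r) F t x).
Proof.
move=> h; elim: r => [|t r IH].
  by rewrite (_ : (fun _ => _) = fun=> 0); [exact: mixing_cst|apply/funext => x; rewrite big_nil].
rewrite (_ : (fun _ => _) = fun x => F t x + \sum_(t <- r) F t x); first exact: mixingD.
by apply/funext => x; rewrite big_cons.
Qed.

Lemma Ex_centered_le n f : L2 f ->
  Ex (fun x => (avg n f x - Ex f) ^+ 2) <= Ex (fun x => f x ^+ 2).
Proof.
move=> hf; apply: le_trans (Ex_avg_sqr_le hp hlaw n hf).
have ha := L2_avg n hf.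
rewrite (_ : (fun x => _) = fun x => avg n f x ^+ 2 + (- 2 * Ex f * avg n f x + Ex f ^+ 2)).
  have a1 := L2_L1 ha; have c1 := L1_cst mu (Ex f ^+ 2).
  rewrite (ExD ha.2 (L1D (L1Z (- 2 * Ex f) a1) c1)) (ExD (L1Z _ a1) c1) (ExZ _ a1) Ex_cst.
  by rewrite (Ex_avg hp hlaw n (L2_L1 hf)); have := sqr_ge0 (Ex f); lra.
by apply/funext => x; ring.
Qed.

(** The class is closed in mean square because [avg n], after centering, is a
    contraction. *)
Lemma mixing_closed f : L2 f ->
  (forall e : R, 0 < e -> exists2 g, mixing g & Ex (fun x => (f x - g x) ^+ 2) <= e) ->
  mixing f.
Proof.
move=> hf happ; split=> // e e0; have e4 : 0 < e / 4 by lra.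
have [g [hg mg] fg] := happ _ e4; have [N h] := mg _ e4.
exists N => n /h hn.
have hfg : L2 (fun x => f x + -1 * g x) by apply: L2D => //; exact: L2Z.
have h1 := Ex_centered_le n hfg.
have := Ex_sqrD_le (L2_centered n hfg) (L2_centered n hg).
rewrite (_ : (fun x => (_ + (avg n g x - _)) ^+ 2) =
  fun x => (avg n f x - Ex f) ^+ 2).
  move=> h2; apply: (le_trans h2).
  suff : Ex (fun x => (f x + -1 * g x) ^+ 2) <= e / 4 by lra.
  by under [X in Ex X]funext do rewrite mulN1r.
apply/funext => x; congr (_ ^+ 2).
rewrite avgD avgZ (ExD (L2_L1 hf) (L1Z (-1) (L2_L1 hg))) (ExZ _ (L2_L1 hg)); ring.
Qed.

Definition agree N (x y : cube) := forall i, (i < N)%N -> x i = y i.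

Lemma avg_finite_dep N f : (forall x y, agree N x y -> f x = f y) ->
  forall x y, avg N f x = avg N f y.
Proof.
elim: N f => [|N IH] f hf x y /=; first exact: hf.
apply: IH => {}x {}y xy; rewrite /avgi; congr (_ * _ + _ * _); apply: hf => i;
  rewrite ltnS leq_eqVlt => /predU1P[->|iN]; rewrite ?flip_same//;
  by rewrite !flip_other ?ltn_eqF//; exact: xy.
Qed.

Lemma mixing_finite_dep N f : L2 f -> (forall x y, agree N x y -> f x = f y) -> mixing f.
Proof.
move=> hf hN; split=> // e e0; exists N => n Nn.
have hn x y : agree n x y -> f x = f y.
  by move=> xy; apply: hN => i iN; apply: xy; exact: leq_trans Nn.
have hc := avg_finite_dep hn; pose x0 : cube := fun=> true.
have E : avg n f = fun=> avg n f x0 by apply/funext => x; exact: hc.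
have E2 := Ex_avg hp hlaw n (L2_L1 hf).
rewrite (_ : (fun x => _) = fun=> 0) ?Ex_cst ?ltW//.
apply/funext => x; rewrite -E2 E Ex_cst; ring.
Qed.

Lemma L2_indic A : measurable A -> L2 (\1_A).
Proof.
move=> mA; apply: (@L2_bounded _ _ _ _ _ 1).
  exact: measurable_indic.
by move=> x; rewrite indicE; case: (x \in A); rewrite /= ?normr1 ?normr0.
Qed.

(** The sets depending on finitely many coordinates form a pi-system generating the
    sigma-algebra, and the sets with mixing indicator form a lambda-system. *)
Lemma mixing_indic A : measurable A -> mixing (\1_A).
Proof.
pose G : set (set cube) :=
  [set A | measurable A /\ exists N, forall x y, agree N x y -> A x -> A y].
pose H : set (set cube) := [set A | measurable A /\ mixing (\1_A)].
have GI : setI_closed G.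
  move=> B C [mB [N hB]] [mC [M hC]]; split; first exact: measurableI.
  exists (maxn N M) => x y xy [Bx Cx]; split.
  - by apply: hB Bx => i iN; apply: xy; rewrite leq_max iN.
  - by apply: hC Cx => i iN; apply: xy; rewrite leq_max iN orbT.
have GH : G `<=` H.
  move=> B [mB [N hB]]; split=> //; apply: (@mixing_finite_dep N).
    exact: L2_indic.
  move=> x y xy; rewrite !indicE; congr ((nat_of_bool _)%:R).
  apply/idP/idP; rewrite !inE; apply: hB => // i iN; exact: esym (xy i iN).
have HL : lambda_system setT H.
  split.
  - by [].
  - by apply: GH; split => //; exists 0%N.
  - move=> B C CB [mB xB] [mC xC]; split; first exact: measurableD.
    rewrite (_ : \1_(B `\` C) = fun x => (\1_B x : R) + -1 * \1_C x).
      by apply: mixingD => //; exact: mixingZ.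
    apply/funext => x; rewrite !indicE in_setD.
    have := @CB x; rewrite -(in_setE B) -(in_setE C).
    by case: (x \in B); case: (x \in C) => //= h; rewrite ?mulr0 ?mulr1 ?subrr ?addr0//; have := h isT.
  - move=> F ndF hF; have mU : measurable (\bigcup_i F i).
      by apply: bigcupT_measurable => i; exact: (hF i).1.
    split=> //; apply: mixing_closed; first exact: L2_indic.
    move=> e e0.
    have [||||n hn] := @dominated_small _ _ _ mu
        (fun n x => (\1_(\bigcup_i F i) x - \1_(F n) x) ^+ 2) (fun=> 1) _ _ _ _ e e0.
    + move=> n; apply: measurable_funX; apply: measurable_funB; apply: measurable_indic => //.
      exact: (hF n).1.
    + exact: L1_cst.
    + move=> n x; rewrite !indicE; apply/andP; split; first exact: sqr_ge0.
      by case: (x \in _); case: (x \in _); rewrite /= ?subrr ?subr0 ?sub0r ?sqrrN ?expr1n ?expr0n.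
    + move=> x; apply: cvg_near_cst.
      have [[i _ Fi]|nU] := pselect ((\bigcup_i F i) x).
        near=> n; rewrite !indicE mem_set; last by exists i.
        rewrite mem_set ?subrr ?expr0n//.
        have /subsetPset : (F i <= F n)%O by apply: ndF; near: n; exact: nbhs_infty_ge.
        exact.
      near=> n; rewrite !indicE !memNset ?subrr ?expr0n// => Fn; apply: nU.
      by exists n.
    + by exists (\1_(F n)); [exact: (hF n).2|].
move=> mA; suff : H A by case.
apply: (lambda_system_subset GI HL GH) => //.
have : <<s coord_sets >> `<=` <<s G >>.
  apply: smallest_sub; first exact: smallest_sigma_algebra.
  move=> _ [i ->]; apply: sub_sigma_algebra; split.
    by apply: sub_sigma_algebra; exists i.
  by exists i.+1 => x y xy; rewrite (xy i)//.
by apply.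
Unshelve. all: by end_near. Qed.

Import HBNNSimple.

(** Approximation from below by simple functions, under the majorant [f ^+ 2]. *)
Lemma mixing_L2_ge0 f : L2 f -> (forall x, 0 <= f x) -> mixing f.
Proof.
move=> hf f0; apply: mixing_closed => // e e0.
have mf : measurable_fun setT (EFin \o f) by apply/measurable_EFinP; case: hf.
pose h := nnsfun_approx measurableT mf.
have f0' x : setT x -> (0 <= (EFin \o f) x)%E by rewrite lee_fin.
have hf0 n x : 0 <= h n x <= f x.
  rewrite fun_ge0/= -lee_fin /h nnsfun_approxE; exact: le_approx.
have [||||n hn] := @dominated_small _ _ _ mu
    (fun n x => (f x - h n x) ^+ 2) (fun x => f x ^+ 2) _ _ _ _ e e0.
- by move=> n; apply: measurable_funX; apply: measurable_funB; [case: hf|].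
- exact: hf.2.
- move=> n x; rewrite sqr_ge0/=; have /andP[h0 hh] := hf0 n x.
  by apply: lerXn2r; rewrite ?nnegrE//; lra.
- move=> x.
  have /fine_cvg hx := @cvg_nnsfun_approx _ _ _ _ measurableT _ mf f0' x I.
  have hd : (fun n => f x - h n x) @ \oo --> (0 : R).
    by rewrite -(subrr (f x)); apply: cvgB => //; exact: cvg_cst.
  rewrite -[0](mulr0 (0 : R)); under eq_fun do rewrite expr2.
  exact: cvgM.
exists (h n) => //.
rewrite (funext (fimfunEord (h n))).
by apply: mixing_sum => i; apply: mixingZ; exact: mixing_indic.
Qed.

(** A mean-square form of Kolmogorov's zero-one law; it is what makes it possible to
    work with finitely many coordinates at a time. *)
Lemma mixing_L2 f : L2 f -> mixing f.
Proof.
move=> hf; have [mf _] := hf.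
rewrite (_ : f = fun x => f^\+ x + -1 * f^\- x).
  apply: mixingD; last apply: mixingZ; apply: mixing_L2_ge0 => //.
  - apply: (L2_le _ hf); first exact: measurable_funrpos.
    by move=> x; rewrite ger0_norm// /funrpos ge_max ler_norm normr_ge0.
  - apply: (L2_le _ hf); first exact: measurable_funrneg.
    by move=> x; rewrite ger0_norm// /funrneg ge_max -normrN ler_norm normr_ge0.
apply/funext => x; rewrite mulN1r.
by have /(congr1 (fun g => g x)) := funrposBneg f.
Qed.

End mixing.

(** * Second-order estimates on the space of signs *)

Section estimates.
Context {R : realType} (p : nat -> R) (mu : probability cube R).
Hypothesis hp : forall i, 0 < p i < 1.
Hypothesis hlaw : forall i (A : set cube), measurable A ->
  (mu A = (p i)%:E * mu (flip i true @^-1` A) +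
          (1 - p i)%:E * mu (flip i false @^-1` A))%E.
Implicit Types (f g u v : cube -> R) (i j l m n N : nat).

Local Notation Ex := (Ex mu).
Local Notation L1 := (L1 mu).
Local Notation L2 := (L2 mu).
Local Notation L4 := (L4 mu).
Local Notation avg := (avg p).
Local Notation dif := (dif p).
Local Notation std := (std p).
Local Notation K N := (resample p N 0 0).
Local Notation s i := (Num.sqrt (pq p i)).

Lemma L2_K N f : L2 f -> L2 (K N f).
Proof. exact: (stable_resample p (stable_L2 hp hlaw)). Qed.

Lemma L4_K N f : L4 f -> L4 (K N f).
Proof. exact: (stable_resample p (stable_L4 hp hlaw)). Qed.

Lemma L1_K N f : L1 f -> L1 (K N f).
Proof. exact: (stable_resample p (stable_L1 hp hlaw)). Qed.

Lemma L4_dif i f : L4 f -> L4 (dif i f).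
Proof. exact: (stable_dif p (stable_L4 hp hlaw)). Qed.

Lemma L2_dif i f : L2 f -> L2 (dif i f).
Proof. exact: (stable_dif p (stable_L2 hp hlaw)). Qed.

Lemma Ex_K N f : L1 f -> Ex (K N f) = Ex f.
Proof. by move=> hf; rewrite Ex_resample// beta_weight00 mul1r. Qed.

Lemma Ex_K_sqr_le N f : L2 f -> Ex (fun x => K N f x ^+ 2) <= Ex (fun x => f x ^+ 2).
Proof.
move=> hf; rewrite -(Ex_K N hf.2); apply: Ex_le.
- exact: (L2_K N hf).2.
- exact: L1_K hf.2.
- by move=> x; exact: resample_sqr_le.
Qed.

Lemma K_norm N f x : `|K N f x| <= K N (fun y => `|f y|) x.
Proof.
have h1 := @resample_le _ p hp N 0 0 f (fun y => `|f y|) (fun y => ler_norm _) x.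
have h2 := @resample_le _ p hp N 0 0 (fun y => -1 * f y) (fun y => `|f y|).
rewrite ler_norml h1 andbT lerNl.
have := h2 _ x; rewrite resampleZ mulN1r; apply=> y.
by rewrite mulN1r -normrN ler_norm.
Qed.

(** Applying Jensen's inequality to the whole sum, and not to each summand, keeps
    the same resampled point in all the factors [U j]; this is why the bound
    involves the joint moments of the pairs [(U j, U m)]. *)
Lemma Ex_sum_mul_K_sqr_le N n (A U : nat -> cube -> R) :
  (forall j, L4 (A j)) -> (forall j, L4 (U j)) ->
  Ex (fun x => (\sum_(j < n) `|A j x| * K N (fun y => `|U j y|) x) ^+ 2) <=
  \sum_(j < n) \sum_(m < n)
    Num.sqrt (Ex (fun x => A j x ^+ 2 * A m x ^+ 2)) *
    Num.sqrt (Ex (fun x => U j x ^+ 2 * U m x ^+ 2)).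
Proof.
move=> hA hU.
pose W j m x := `|U j x| * `|U m x|.
have hW j m : L2 (W j m) by apply: L4M; exact: L4_norm.
have hAA j m : L2 (fun x => `|A j x| * `|A m x|) by apply: L4M; exact: L4_norm.
have hT j m : L1 (fun x => `|A j x| * `|A m x| * K N (W j m) x).
  by apply: L2M => //; exact: L2_K.
have pw x : (\sum_(j < n) `|A j x| * K N (fun y => `|U j y|) x) ^+ 2 <=
    \sum_(j < n) \sum_(m < n) `|A j x| * `|A m x| * K N (W j m) x.
  have := @resample_sqr_le _ p hp N (fun y => \sum_(j < n) `|A j x| * `|U j y|) x.
  rewrite resample_sum.
  under eq_bigr do rewrite resampleZ.
  move/le_trans; apply; rewrite le_eqVlt; apply/orP; left; apply/eqP.
  rewrite (_ : (fun y => _ ^+ 2) = fun y => \sum_(j < n) \sum_(m < n)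
      (`|A j x| * `|A m x|) * W j m y).
    rewrite resample_sum; apply: eq_bigr => j _.
    by rewrite resample_sum; apply: eq_bigr => m _; rewrite resampleZ.
  apply/funext => y; rewrite expr2 big_distrlr /=.
  by apply: eq_bigr => j _; apply: eq_bigr => m _; rewrite /W; ring.
have hS : L1 (fun x => \sum_(j < n) \sum_(m < n) `|A j x| * `|A m x| * K N (W j m) x).
  by apply: L1_sum => j; apply: L1_sum => m; exact: hT.
have hL : L2 (fun x => \sum_(j < n) `|A j x| * K N (fun y => `|U j y|) x).
  apply: L2_sum => j; apply: L4M; first exact: L4_norm.
  by apply: L4_K; exact: L4_norm.
apply: (le_trans (Ex_le hL.2 hS pw)).
rewrite Ex_sum; last by move=> j; apply: L1_sum => m; exact: hT.
apply: ler_sum => j _; rewrite Ex_sum; last by move=> m; exact: hT.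
apply: ler_sum => m _.
apply: (@le_trans _ _ (Ex (fun x => `| `|A j x| * `|A m x| * K N (W j m) x|))).
  apply: Ex_le; [exact: hT|exact: L1_norm (hT _ _)|] => x; exact: ler_norm.
apply: (le_trans (Ex_cauchy_schwarz (hAA j m) (L2_K N (hW j m)))).
have sq (a b : R) : (`|a| * `|b|) ^+ 2 = a ^+ 2 * b ^+ 2.
  by rewrite exprMn !real_normK ?num_real.
apply: ler_pM; rewrite ?sqrtr_ge0//; apply: ler_wsqrtr.
  by under [X in Ex X]funext do rewrite sq.
apply: (le_trans (Ex_K_sqr_le N (hW j m))).
by under [X in Ex X]funext do rewrite /W sq.
Qed.

Lemma Ex_mul_K_sqr_le N f g : L4 f -> L4 g ->
  Ex (fun x => (`|f x| * K N (fun y => `|g y|) x) ^+ 2) <=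
  Num.sqrt (Ex (fun x => f x ^+ 4)) * Num.sqrt (Ex (fun x => g x ^+ 4)).
Proof.
move=> hf hg.
have := @Ex_sum_mul_K_sqr_le N 1 (fun=> f) (fun=> g) (fun=> hf) (fun=> hg).
rewrite !big_ord1.
under [X in Ex X]funext do rewrite big_ord1.
have sq (a : R) : a ^+ 2 * a ^+ 2 = a ^+ 4 by rewrite -exprD.
by under [X in _ <= Num.sqrt (Ex X) * _]funext do rewrite sq;
  under [X in _ <= _ * Num.sqrt (Ex X)]funext do rewrite sq.
Qed.

Lemma sqrD3_le (a b c : R) : (a + b + c) ^+ 2 <= 3 * (a ^+ 2 + b ^+ 2 + c ^+ 2).
Proof.
have := sqr_ge0 (a - b); have := sqr_ge0 (b - c); have := sqr_ge0 (a - c).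
nra.
Qed.

Lemma sqr_norm_le (a b : R) : `|a| <= b -> a ^+ 2 <= b ^+ 2.
Proof.
move=> ab; rewrite -[a ^+ 2]real_normK ?num_real//.
by apply: lerXn2r; rewrite ?nnegrE// (le_trans _ ab).
Qed.

Section gradient_pair.
Variable F : cube -> R.
Hypothesis hF : L2 F.
Local Notation V j := (dif j F).
Hypothesis hV : forall j, L4 (V j).

(** A finite-dimensional version of [<DF, - D L^-1 F>]. *)
Definition carre N x : R := \sum_(j < N) V j x * K N (V j) x.

Lemma L2_carre N : L2 (carre N).
Proof. by apply: L2_sum => j; apply: L4M => //; exact: L4_K. Qed.

(** [b1], ..., [b5] are the terms of the five quantities of the bound, [b1 N l] and
    [b2 N l] already summed over the two indices of first-order gradients below
    [N]. *)
Definition b1 N l : R := \sum_(j < N) \sum_(m < N)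
  Num.sqrt (Ex (fun x => V j x ^+ 2 * V m x ^+ 2)) *
  Num.sqrt (Ex (fun x => dif l (V j) x ^+ 2 * dif l (V m) x ^+ 2)).

Definition b2 N l : R := \sum_(j < N) \sum_(m < N)
  (pq p l)^-1 * Ex (fun x => dif l (V j) x ^+ 2 * dif l (V m) x ^+ 2).

Definition b3 m : R := (pq p m)^-1 * Ex (fun x => V m x ^+ 4).

Definition b4 m l : R := (pq p m)^-1 * Num.sqrt (Ex (fun x => V m x ^+ 4)) *
  Num.sqrt (Ex (fun x => dif l (V m) x ^+ 4)).

Definition b5 m l : R := (pq p m * pq p l)^-1 * Ex (fun x => dif l (V m) x ^+ 4).

(** The Leibniz rule gives three sums, each of the form bounded in
    [Ex_sum_mul_K_sqr_le]: the second gradient falls on either factor, or on both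
    with the weight [1 / sqrt (pq p l)]. *)
Lemma Ex_dif_carre_le N l :
  Ex (fun x => dif l (carre N) x ^+ 2) <= 3 * (2 * b1 N l + b2 N l).
Proof.
have hD j : L4 (dif l (V j)) by exact: L4_dif.
pose S (A U : nat -> cube -> R) x :=
  \sum_(j < N) `|A j x| * K N (fun y => `|U j y|) x.
have hS A U : (forall j, L4 (A j)) -> (forall j, L4 (U j)) -> L2 (S A U).
  move=> hA hU; apply: L2_sum => j; apply: L4M; first exact: L4_norm.
  by apply: L4_K; exact: L4_norm.
pose DV j := dif l (V j); pose VV j := V j.
pose S1 := S DV VV; pose S2 := S VV DV; pose S3 := fun x => (s l)^-1 * S DV DV x.
have h1 : L2 S1 by apply: hS. have h2 : L2 S2 by apply: hS.
have h3 : L2 S3 by apply: L2Z; apply: hS.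
have pw x : `|dif l (carre N) x| <= S1 x + S2 x + S3 x.
  rewrite /carre dif_sum; apply: (le_trans (ler_norm_sum _ _ _)).
  rewrite /S1 /S2 /S3 /S mulr_sumr -!big_split /=; apply: ler_sum => j _.
  apply: (le_trans (dif_mul_norm hp _ _ _ _)).
  have Kn := K_norm N (V j) x; have Dn := dif_resample_norm hp l N 0 0 (V j) x.
  apply: lerD; first apply: lerD.
  - by apply: ler_wpM2l.
  - by apply: ler_wpM2l.
  - apply: ler_wpM2l; first by rewrite invr_ge0 sqrtr_ge0.
    by apply: ler_wpM2l.
have pw2 x : dif l (carre N) x ^+ 2 <= 3 * (S1 x ^+ 2 + S2 x ^+ 2 + S3 x ^+ 2).
  by apply: (le_trans (sqr_norm_le (pw x))); exact: sqrD3_le.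
have hsum : L1 (fun x => S1 x ^+ 2 + S2 x ^+ 2 + S3 x ^+ 2).
  by apply: L1D; [apply: L1D|]; [exact: h1.2|exact: h2.2|exact: h3.2].
apply: (le_trans (Ex_le (L2_dif l (L2_carre N)).2 (L1Z 3 hsum) pw2)).
rewrite (ExZ 3 hsum) (ExD (L1D h1.2 h2.2) h3.2) (ExD h1.2 h2.2).
apply: ler_wpM2l => //; have pql := pq_gt0 hp l.
have E1 : Ex (fun x => S1 x ^+ 2) <= b1 N l.
  apply: (le_trans (Ex_sum_mul_K_sqr_le N N hD hV)).
  by apply: ler_sum => j _; apply: ler_sum => m _; rewrite mulrC.
have E2 : Ex (fun x => S2 x ^+ 2) <= b1 N l by exact: Ex_sum_mul_K_sqr_le.
have E3 : Ex (fun x => S3 x ^+ 2) <= b2 N l.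
  rewrite (_ : (fun x => S3 x ^+ 2) = fun x => (pq p l)^-1 * S DV DV x ^+ 2); last first.
    by apply/funext => x; rewrite exprMn exprVn sqr_sqrtr// ltW.
  rewrite ExZ; last by have [] := hS _ _ hD hD.
  rewrite /b2; under eq_bigr do rewrite -mulr_sumr.
  rewrite -mulr_sumr; apply: ler_wpM2l; first by rewrite invr_ge0 ltW.
  apply: (le_trans (Ex_sum_mul_K_sqr_le N N hD hD)).
  apply: ler_sum => j _; apply: ler_sum => m _.
  by rewrite -expr2 sqr_sqrtr// Ex_ge0// => x; rewrite mulr_ge0// sqr_ge0.
lra.
Qed.

(** The discrete Poincare inequality turns the bound on the gradient of [carre N]
    into a bound on its variance. *)
Lemma Ex_carre_variance_le N (B1 B2 : R) :
  (forall n, \sum_(l < n) b1 N l <= B1) -> (forall n, \sum_(l < n) b2 N l <= B2) ->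
  Ex (fun x => (carre N x - Ex (carre N)) ^+ 2) <= 3 * (2 * B1 + B2).
Proof.
move=> h1 h2; apply/ler_addgt0Pr => e e0.
have hT := L2_carre N; have hT1 := L2_L1 hT.
have [_ /(_ e e0) [n /(_ n (leqnn n)) hn]] := mixing_L2 hp hlaw hT.
have hTc : L2 (fun x => carre N x + - Ex (carre N)).
  by apply: L2D => //; exact: L2_cst.
apply: (le_trans (Ex_poincare hp hlaw n hTc)); rewrite addrC.
apply: lerD; last first.
  rewrite avgD (_ : avg n (fun=> - Ex (carre N)) = fun=> - Ex (carre N))//.
  by elim: (n) => [|q IH] //=; rewrite avgi_cst.
apply: (@le_trans _ _ (\sum_(l < n) 3 * (2 * b1 N l + b2 N l))).
  apply: ler_sum => l _; rewrite difD dif_cst.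
  under [X in Ex X]funext do rewrite addr0.
  exact: Ex_dif_carre_le.
rewrite -mulr_sumr big_split /= -mulr_sumr.
by have := h1 n; have := h2 n; lra.
Qed.

Local Notation u N j := (fun x => (s j)^-1 * (V j x * `|K N (V j) x|)).

Lemma L2_u N j : L2 (u N j).
Proof. by apply: L2Z; apply: L4M => //; apply: L4_norm; exact: L4_K. Qed.

(** The process is constant in its own coordinate, which is what makes
    [Ex_std_mul] applicable to it. *)
Lemma indep_u N j : indep_of j (u N j).
Proof.
move=> c x; rewrite (indep_dif p j F c x).
by rewrite (@indep_resample _ p j N 0 0 _ (indep_dif p j F) c x).
Qed.

Lemma Ex_u_sqr_le N j : Ex (fun x => u N j x ^+ 2) <= b3 j.
Proof.
have pqj := pq_gt0 hp j.
have h := Ex_mul_K_sqr_le N (hV j) (hV j).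
rewrite -expr2 sqr_sqrtr in h; last by apply: Ex_ge0 => x; rewrite exprn_even_ge0.
have hVK : L2 (fun x => `|V j x| * K N (fun y => `|V j y|) x).
  by apply: L4M; [exact: L4_norm|apply: L4_K; exact: L4_norm].
rewrite /b3; apply: le_trans (ler_wpM2l _ h); last by rewrite invr_ge0 ltW.
rewrite -(ExZ _ hVK.2); apply: Ex_le; [exact: (L2_u N j).2|exact: L1Z hVK.2|] => x.
rewrite exprMn exprVn sqr_sqrtr ?(ltW pqj)//; apply: ler_wpM2l.
  by rewrite invr_ge0 ltW.
apply: sqr_norm_le; rewrite normrM normr_id; apply: ler_wpM2l => //; exact: K_norm.
Qed.

Lemma Ex_dif_u_sqr_le N j l :
  Ex (fun x => dif l (u N j) x ^+ 2) <= 3 * (2 * b4 j l + b5 j l).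
Proof.
have pqj := pq_gt0 hp j; have pql := pq_gt0 hp l.
have hD : L4 (dif l (V j)) by exact: L4_dif.
pose S f g x := `|f x| * K N (fun y => `|g y|) x.
have hS f g : L4 f -> L4 g -> L2 (S f g).
  by move=> h1 h2; apply: L4M; [exact: L4_norm|apply: L4_K; exact: L4_norm].
pose DV := dif l (V j).
pose S1 := S DV (V j); pose S2 := S (V j) DV; pose S3 := fun x => (s l)^-1 * S DV DV x.
have h1 : L2 S1 by apply: hS. have h2 : L2 S2 by apply: hS.
have h3 : L2 S3 by apply: L2Z; apply: hS.
have pw x : `|dif l (u N j) x| <= (s j)^-1 * (S1 x + S2 x + S3 x).
  rewrite difZ normrM ger0_norm ?invr_ge0 ?sqrtr_ge0//.
  apply: ler_wpM2l; first by rewrite invr_ge0 sqrtr_ge0.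
  apply: (le_trans (dif_mul_norm hp _ _ _ _)); rewrite normr_id.
  have Kn := K_norm N (V j) x.
  have Dn : `|dif l (fun x => `|K N (V j) x|) x| <= K N (fun y => `|DV y|) x.
    apply: le_trans (dif_norm p l (K N (V j)) x) _; exact: dif_resample_norm.
  apply: lerD; first apply: lerD.
  - by apply: ler_wpM2l.
  - by apply: ler_wpM2l.
  - apply: ler_wpM2l; first by rewrite invr_ge0 sqrtr_ge0.
    by apply: ler_wpM2l.
have pw2 x : dif l (u N j) x ^+ 2 <=
    (pq p j)^-1 * (3 * (S1 x ^+ 2 + S2 x ^+ 2 + S3 x ^+ 2)).
  apply: (le_trans (sqr_norm_le (pw x))).
  rewrite exprMn exprVn sqr_sqrtr ?(ltW pqj)//; apply: ler_wpM2l.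
    by rewrite invr_ge0 ltW.
  exact: sqrD3_le.
have hsum : L1 (fun x => S1 x ^+ 2 + S2 x ^+ 2 + S3 x ^+ 2).
  by apply: L1D; [apply: L1D|]; [exact: h1.2|exact: h2.2|exact: h3.2].
apply: (le_trans (Ex_le (L2_dif l (L2_u N j)).2 (L1Z _ (L1Z 3 hsum)) pw2)).
rewrite (ExZ _ (L1Z 3 hsum)) (ExZ 3 hsum) (ExD (L1D h1.2 h2.2) h3.2) (ExD h1.2 h2.2).
have ipj : 0 <= (pq p j)^-1 by rewrite invr_ge0 ltW.
have E1 : (pq p j)^-1 * Ex (fun x => S1 x ^+ 2) <= b4 j l.
  rewrite /b4 -mulrA; apply: ler_wpM2l => //.
  by rewrite [leRHS]mulrC; exact: Ex_mul_K_sqr_le.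
have E2 : (pq p j)^-1 * Ex (fun x => S2 x ^+ 2) <= b4 j l.
  by rewrite /b4 -mulrA; apply: ler_wpM2l => //; exact: Ex_mul_K_sqr_le.
have E3 : (pq p j)^-1 * Ex (fun x => S3 x ^+ 2) <= b5 j l.
  rewrite /b5 (invfM (pq p j) (pq p l)) -(mulrA (pq p j)^-1); apply: ler_wpM2l => //.
  rewrite (_ : (fun x => S3 x ^+ 2) = fun x => (pq p l)^-1 * S DV DV x ^+ 2); last first.
    by apply/funext => x; rewrite exprMn exprVn sqr_sqrtr// ltW.
  rewrite ExZ; last by have [] := hS _ _ hD hD.
  apply: ler_wpM2l; first by rewrite invr_ge0 ltW.
  apply: (le_trans (Ex_mul_K_sqr_le N hD hD)).
  by rewrite -expr2 sqr_sqrtr// Ex_ge0// => x; rewrite exprn_even_ge0.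
move: E1 E2 E3; set c := (pq p j)^-1; set e1 := Ex _; set e2 := Ex _; set e3 := Ex _.
by move=> E1 E2 E3; rewrite mulrCA !mulrDr; lra.
Qed.

Lemma std_norm_le i x : `|std i x| <= (s i)^-1.
Proof.
have /andP[p0 p1] := hp i; have s0 := spq_gt0 hp i.
rewrite /std normrM [`|_^-1|]gtr0_norm ?invr_gt0// ler_piMl ?invr_ge0 ?ltW//.
by case: (x i); rewrite ?normrN gtr0_norm//; lra.
Qed.

Lemma measurable_std i : measurable_fun setT (std i : cube -> R).
Proof.
by apply: measurable_funM => //; apply: measurable_fun_ifT => //; exact: measurable_bit.
Qed.

Lemma L2_std_mul i f : L2 f -> L2 (fun x => std i x * f x).
Proof.
move=> hf; rewrite (_ : (fun x => _) = fun x => f x * std i x).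
  by apply: (L2_mul_bounded hf (measurable_std i)) => x; exact: std_norm_le.
by apply/funext => x; rewrite mulrC.
Qed.

Lemma dif_std i x : dif i (std i) x = 1.
Proof.
rewrite /std /dif !flip_same; have := spq_neq0 hp i; move: (s i) => t t0.
by field.
Qed.

(** The Skorokhod integral [\sum_j Y_j u_j] of the process [u]. *)
Definition skorokhod N x : R := \sum_(j < N) std j x * u N j x.

Lemma L2_skorokhod N : L2 (skorokhod N).
Proof. by apply: L2_sum => j; apply: L2_std_mul; exact: L2_u. Qed.

(** The off-diagonal terms of the square are integrated by parts in both
    coordinates, which yields the symmetric products of gradients. *)
Lemma Ex_skorokhod_sqr_le N : Ex (fun x => skorokhod N x ^+ 2) <=
  \sum_(j < N) Ex (fun x => u N j x ^+ 2) +
  \sum_(j < N) \sum_(l < N) Ex (fun x => dif l (u N j) x ^+ 2).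
Proof.
have hY j : L2 (fun x => std j x * u N j x) by apply: L2_std_mul; exact: L2_u.
have hd j l : L2 (dif l (u N j)) by apply: L2_dif; exact: L2_u.
have hP (i j : 'I_N) : L1 (fun x => (std i x * u N i x) * (std j x * u N j x)).
  by apply: L2M.
rewrite (_ : (fun x => skorokhod N x ^+ 2) = fun x =>
    \sum_(i < N) \sum_(j < N) (std i x * u N i x) * (std j x * u N j x)); last first.
  by apply/funext => x; rewrite expr2 big_distrlr.
rewrite Ex_sum; last by move=> i; apply: L1_sum => j; exact: hP.
under eq_bigr do rewrite Ex_sum//.
pose G (i j : 'I_N) : R := Ex (fun x => dif j (u N i) x ^+ 2).
have G0 (i j : 'I_N) : 0 <= G i j by apply: Ex_ge0 => x; exact: sqr_ge0.
have diag (i : 'I_N) : Ex (fun x => (std i x * u N i x) * (std i x * u N i x)) =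
    Ex (fun x => u N i x ^+ 2).
  have iu : indep_of i (fun x => u N i x ^+ 2).
    by move=> c x; rewrite (indep_u N i c x).
  have E : (fun x => (std i x * u N i x) * (std i x * u N i x)) =
      (fun x => std i x * (u N i x ^+ 2 * std i x)).
    by apply/funext => x; ring.
  rewrite E (Ex_std_mul hp hlaw iu); last by rewrite -E; exact: hP.
  by congr (Ex _); apply/funext => x; rewrite dif_std mulr1.
have off (i j : 'I_N) : i != j ->
    Ex (fun x => (std i x * u N i x) * (std j x * u N j x)) <= 2^-1 * G i j + 2^-1 * G j i.
  move=> ij; have ij' : (i : nat) != j by [].
  have h1 : Ex (fun x => (std i x * u N i x) * (std j x * u N j x)) =
      Ex (fun x => u N i x * (std j x * dif i (u N j) x)).
    have E : (fun x => (std i x * u N i x) * (std j x * u N j x)) =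
        (fun x => std i x * (u N i x * (std j x * u N j x))).
      by apply/funext => x; ring.
    rewrite E (Ex_std_mul hp hlaw (indep_u N i)); last by rewrite -E; exact: hP.
    congr (Ex _); apply/funext => x; congr (_ * _).
    rewrite /dif /std !flip_other; [ring|by rewrite eq_sym..].
  have h2 : Ex (fun x => u N i x * (std j x * dif i (u N j) x)) =
      Ex (fun x => dif i (u N j) x * dif j (u N i) x).
    have E : (fun x => u N i x * (std j x * dif i (u N j) x)) =
        (fun x => std j x * (dif i (u N j) x * u N i x)).
      by apply/funext => x; ring.
    have iD : indep_of j (dif i (u N j)).
      move=> c x; rewrite /dif !(flipC _ _ _ ij').
      by rewrite (indep_u N j c (flip i true x)) (indep_u N j c (flip i false x)).
    rewrite E (Ex_std_mul hp hlaw iD)// -E.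
    apply: L2M; first exact: L2_u.
    by apply: L2_std_mul; exact: hd.
  rewrite h1 h2 -(ExZ _ (hd i j).2) -(ExZ _ (hd j i).2).
  rewrite -(ExD (L1Z _ (hd i j).2) (L1Z _ (hd j i).2)).
  apply: Ex_le; first exact: L2M.
    by apply: L1D; apply: L1Z; [exact: (hd i j).2|exact: (hd j i).2].
  move=> x; have := sqr_ge0 (dif i (u N j) x - dif j (u N i) x).
  by rewrite sqrrB; lra.
apply: (@le_trans _ _ (\sum_(i < N) \sum_(j < N)
    ((i == j)%:R * Ex (fun x => u N i x ^+ 2) + (2^-1 * G i j + 2^-1 * G j i)))).
  apply: ler_sum => i _; apply: ler_sum => j _.
  have [<-|ij] := eqVneq i j.
    by rewrite diag mul1r lerDl; have := G0 i i; lra.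
  by rewrite mul0r add0r; exact: off.
under eq_bigr do rewrite big_split /=.
rewrite big_split /=; apply: lerD.
  apply: ler_sum => i _; rewrite (bigD1 i)//= eqxx mul1r big1 ?addr0// => j ji.
  by rewrite eq_sym (negbTE ji) mul0r.
under eq_bigr do rewrite big_split /=.
rewrite big_split /= [X in _ + X]exchange_big /= -big_split /=.
apply: ler_sum => i _; rewrite -big_split /=; apply: ler_sum => j _.
by rewrite -/(G i j); lra.
Qed.

Lemma Ex_skorokhod_sqr_bound N (B3 B4 B5 : R) :
  \sum_(m < N) b3 m <= B3 -> \sum_(m < N) \sum_(l < N) b4 m l <= B4 ->
  \sum_(m < N) \sum_(l < N) b5 m l <= B5 ->
  Ex (fun x => skorokhod N x ^+ 2) <= B3 + 3 * (2 * B4 + B5).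
Proof.
move=> h3 h4 h5; apply: (le_trans (Ex_skorokhod_sqr_le N)); apply: lerD.
  by apply: le_trans h3; apply: ler_sum => j _; exact: Ex_u_sqr_le.
apply: (@le_trans _ _ (\sum_(j < N) \sum_(l < N) 3 * (2 * b4 j l + b5 j l))).
  by apply: ler_sum => j _; apply: ler_sum => l _; exact: Ex_dif_u_sqr_le.
under eq_bigr do rewrite -mulr_sumr big_split /= -mulr_sumr.
by rewrite -mulr_sumr big_split /= -mulr_sumr; lra.
Qed.

(** Covariance identity: integrate [resample_by_parts] against [G]. *)
Lemma Ex_covariance N (G : cube -> R) : L2 G ->
  Ex (fun x => F x * G x) - Ex (fun x => avg N F x * G x) =
  \sum_(j < N) Ex (fun x => K N (V j) x * dif j G x).
Proof.
move=> hG; have hA : L2 (avg N F) by exact: L2_avg.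
have hK j : L2 (K N (V j)) by apply: L2_K; exact: L4_L2.
have iK j : indep_of j (K N (V j)) by apply: indep_resample; exact: indep_dif.
have E : (fun x => F x * G x - avg N F x * G x) =
    fun x => \sum_(j < N) std j x * (K N (V j) x * G x).
  apply/funext => x; rewrite -mulrBl.
  have := resample_by_parts hp N 0 0 F x; rewrite /= !mul1r !mul0r subr0 addr0 => <-.
  by rewrite mulr_suml; apply: eq_bigr => j _; rewrite mulrA.
have hT j : L1 (fun x => std j x * (K N (V j) x * G x)).
  rewrite (_ : (fun x => _) = fun x => (std j x * K N (V j) x) * G x).
    by apply: L2M => //; exact: L2_std_mul.
  by apply/funext => x; rewrite mulrA.
rewrite -ExB; [|exact: L2M|exact: L2M].
rewrite E Ex_sum//; apply: eq_bigr => j _.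
exact: (Ex_std_mul hp hlaw (iK j) (hT j)).
Qed.

Lemma norm_stein_deriv_le (z w : R) : `|stein_deriv z w| <= 2.
Proof.
have := normr_mul_stein_sol z w; have := Phi_ge0 z; have := Phi_le1 z.
rewrite /stein_deriv !ler_norml => ? ? /andP[? ?].
by apply/andP; split; case: (w <= z); rewrite ?mulr1n ?mulr0n; lra.
Qed.

Lemma norm_stein_mono_le (z w : R) : `|stein_mono z w| <= 2.
Proof.
have := normr_mul_stein_sol z w; rewrite /stein_mono !ler_norml => /andP[? ?].
by apply/andP; split; case: (z < w); case: (z < 0); rewrite ?mulr1n ?mulr0n; lra.
Qed.

Lemma L2_bounded_comp (f : R -> R) (k : R) : measurable_fun setT f ->
  (forall w, `|f w| <= k) -> L2 (f \o F).
Proof.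
move=> mf fk; apply: (@L2_bounded _ _ _ _ _ k) => [|x]; last exact: fk.
by apply: measurableT_comp => //; case: hF.
Qed.

Lemma L2_stein_deriv z : L2 (stein_deriv z \o F).
Proof.
apply: L2_bounded_comp; first exact: measurable_stein_deriv.
exact: norm_stein_deriv_le.
Qed.

Lemma L2_stein_mono z : L2 (stein_mono z \o F).
Proof.
apply: L2_bounded_comp; first exact: measurable_stein_mono.
exact: norm_stein_mono_le.
Qed.

Lemma L2_stein_sol z : L2 (stein_sol z \o F).
Proof.
apply: L2_bounded_comp; first exact: measurable_stein_sol.
by move=> w; rewrite ger0_norm ?stein_sol_ge0//; exact: stein_sol_bounded.
Qed.

Definition stein_rest z j x : R :=
  dif j (stein_sol z \o F) x - stein_deriv z (F x) * V j x.

(** The remainder is dominated by a nonnegative product of gradients, in which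
    the singular factor [stein_mono z \o F] is again differentiated and can
    therefore be moved away by duality. *)
Lemma stein_rest_le z j x :
  `|stein_rest z j x| <= (s j)^-1 * (V j x * dif j (stein_mono z \o F) x).
Proof.
have s0 := spq_gt0 hp j.
pose a := F (flip j true x); pose b := F (flip j false x).
have hc : F x = a \/ F x = b.
  have -> : F x = F (flip j (x j) x) by rewrite flip_id.
  by case: (x j); [left|right].
have h := stein_taylor z hc.
have -> : stein_rest z j x = s j * (stein_sol z a - stein_sol z b -
    stein_deriv z (F x) * (a - b)).
  by rewrite /stein_rest /dif /= -/a -/b; ring.
have -> : (s j)^-1 * (V j x * dif j (stein_mono z \o F) x) =
    s j * ((a - b) * (stein_mono z a - stein_mono z b)).
  by rewrite /dif /= -/a -/b; field; rewrite gt_eqF.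
by rewrite normrM gtr0_norm//; apply: ler_wpM2l => //; exact: ltW.
Qed.

(** Every term of the majorant is nonnegative, so that the signs disappear before
    the gradient of [stein_mono z \o F] is traded for [skorokhod]. *)
Lemma Ex_stein_rest_le z N :
  `|\sum_(j < N) Ex (fun x => K N (V j) x * stein_rest z j x)| <=
  Num.sqrt (Ex (fun x => stein_mono z (F x) ^+ 2)) *
  Num.sqrt (Ex (fun x => skorokhod N x ^+ 2)).
Proof.
have hm := L2_stein_mono z.
have hr j : L2 (fun x => stein_rest z j x).
  apply: L2B; first by apply: L2_dif; exact: L2_stein_sol.
  rewrite (_ : (fun x => _) = fun x => V j x * stein_deriv z (F x)).
    apply: L2_mul_bounded; [exact: L4_L2| |by move=> x; exact: norm_stein_deriv_le].
    by case: (L2_stein_deriv z).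
  by apply/funext => x; rewrite mulrC.
have hK j : L2 (K N (V j)) by apply: L2_K; exact: L4_L2.
have hU j : L1 (fun x => u N j x * dif j (stein_mono z \o F) x).
  by apply: L2M; [exact: L2_u|exact: L2_dif].
have hSt j : L1 (fun x => std j x * (u N j x * (stein_mono z \o F) x)).
  rewrite (_ : (fun x => _) = fun x => (std j x * u N j x) * (stein_mono z \o F) x).
    by apply: L2M => //; apply: L2_std_mul; exact: L2_u.
  by apply/funext => x; rewrite mulrA.
apply: (@le_trans _ _ (\sum_(j < N) Ex (fun x => u N j x * dif j (stein_mono z \o F) x))).
  apply: (le_trans (ler_norm_sum _ _ _)); apply: ler_sum => j _.
  apply: Ex_le_norm => //; first exact: L1_measurable (L2M (hK j) (hr j)).
  move=> x; rewrite normrM mulrC.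
  apply: (le_trans (ler_wpM2r (normr_ge0 _) (stein_rest_le z j x))).
  by rewrite le_eqVlt; apply/orP; left; apply/eqP; ring.
rewrite (eq_bigr (fun j : 'I_N => Ex (fun x => std j x * (u N j x * (stein_mono z \o F) x)))).
  rewrite -Ex_sum//.
  rewrite (_ : (fun x => \sum_(j < N) _) = fun x => (stein_mono z \o F) x * skorokhod N x).
    apply: le_trans (Ex_cauchy_schwarz hm (L2_skorokhod N)).
    apply: Ex_le; [exact: (L2M hm (L2_skorokhod N))
                  |exact: L1_norm (L2M hm (L2_skorokhod N))|].
    by move=> x; exact: ler_norm.
  apply/funext => x; rewrite /skorokhod mulr_sumr.
  by apply: eq_bigr => j _; rewrite [RHS]mulrC mulrA.
by move=> j _; rewrite (Ex_std_mul hp hlaw (indep_u N j) (hSt j)).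
Qed.

(** Stein's equation turns the difference into [E[h(F)] - E[F f(F)]] with
    [f = stein_sol z], [h = stein_deriv z]. The covariance identity is used twice:
    with [f(F)], where it produces [E[h(F) * carre N]] and the remainders, and with
    [F] itself, where it shows that [E[carre N]] tends to [1]. *)
Lemma cube_stein_bound z (B1 B2 B3 B4 B5 : R) :
  Ex F = 0 -> Ex (fun x => F x ^+ 2) = 1 ->
  (forall N n, \sum_(l < n) b1 N l <= B1) -> (forall N n, \sum_(l < n) b2 N l <= B2) ->
  (forall N, \sum_(m < N) b3 m <= B3) ->
  (forall N, \sum_(m < N) \sum_(l < N) b4 m l <= B4) ->
  (forall N, \sum_(m < N) \sum_(l < N) b5 m l <= B5) ->
  `|Ex (fun x => (F x <= z)%R%:R) - Phi z| <=
  Num.sqrt (Ex (fun x => stein_deriv z (F x) ^+ 2)) * Num.sqrt (3 * (2 * B1 + B2)) +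
  Num.sqrt (Ex (fun x => stein_mono z (F x) ^+ 2)) * Num.sqrt (B3 + 3 * (2 * B4 + B5)).
Proof.
move=> F0 F1 h1 h2 h3 h4 h5.
have hs := L2_stein_sol z; have hh := L2_stein_deriv z; have hm := L2_stein_mono z.
pose Bs : R := 1 + (normal_pdf (0 : R) 1 1)^-1.
have Bs0 : 0 <= Bs by rewrite addr_ge0// invr_ge0 normal_pdf_ge0.
apply/ler_addgt0Pr => e e0.
pose e' := e / (2 + Bs).
have D0 : 0 < 2 + Bs by lra.
have e'0 : 0 < e' by rewrite divr_gt0.
have [_ /(_ (e' ^+ 2))] := mixing_L2 hp hlaw hF.
rewrite exprn_gt0// => /(_ isT)[N /(_ N (leqnn N))]; rewrite F0.
under [X in Ex X]funext do rewrite subr0.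
move=> hN; have hA : L2 (avg N F) by exact: L2_avg.
have sA : Num.sqrt (Ex (fun x => avg N F x ^+ 2)) <= e'.
  by rewrite -[e']ger0_norm ?(ltW e'0)// -sqrtr_sqr; exact: ler_wsqrtr.
have hT := L2_carre N.
have hK j : L2 (K N (V j)) by apply: L2_K; exact: L4_L2.
have hV2 j : L2 (V j) by exact: L4_L2.
have hind : L1 (fun x => (F x <= z)%R%:R : R).
  apply: (@L1_bounded _ _ _ _ _ 1); last by move=> x; case: (F x <= z); rewrite /= ?normr1 ?normr0.
  rewrite (_ : (fun x => _) = (fun w => \1_`]-oo, z] w) \o F).
    by apply: measurableT_comp; [exact: measurable_indic|case: hF].
  by apply/funext => x /=; rewrite indicE mem_setE in_itv.
have stein : Ex (fun x => (F x <= z)%R%:R) - Phi z =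
    Ex (stein_deriv z \o F) - Ex (fun x => F x * (stein_sol z \o F) x).
  rewrite -ExB; [|exact: L2_L1|exact: L2M].
  rewrite -[X in _ - X](Ex_cst mu) -ExB//; last exact: L1_cst.
  by congr (Ex _); apply/funext => x; rewrite /stein_deriv /=; ring.
have cov1 := Ex_covariance N hs.
have cov2 := Ex_covariance N hF.
have ET : Ex (carre N) = \sum_(j < N) Ex (fun x => K N (V j) x * V j x).
  rewrite /carre Ex_sum; last by move=> j; exact: L2M.
  by apply: eq_bigr => j _; congr (Ex _); apply/funext => x; rewrite mulrC.
have EhT : \sum_(j < N) Ex (fun x => K N (V j) x * dif j (stein_sol z \o F) x) =
    Ex (fun x => (stein_deriv z \o F) x * carre N x) +
    \sum_(j < N) Ex (fun x => K N (V j) x * stein_rest z j x).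
  have hKV (j : 'I_N) : L1 (fun x => (stein_deriv z \o F) x * (V j x * K N (V j) x)).
    by apply: L2M => //; apply: L4M => //; exact: L4_K.
  have hKR (j : 'I_N) : L1 (fun x => K N (V j) x * stein_rest z j x).
    rewrite (_ : (fun x => _) = fun x => K N (V j) x * dif j (stein_sol z \o F) x -
        (stein_deriv z \o F) x * (V j x * K N (V j) x)).
      by apply: L1B => //; apply: L2M => //; exact: L2_dif.
    by apply/funext => x; rewrite /stein_rest /=; ring.
  rewrite (_ : (fun x => _ * carre N x) =
      fun x => \sum_(j < N) (stein_deriv z \o F) x * (V j x * K N (V j) x)).
    rewrite Ex_sum// -big_split /=; apply: eq_bigr => j _.
    rewrite -ExD//; congr (Ex _); apply/funext => x.
    by rewrite /stein_rest /=; ring.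
  by apply/funext => x; rewrite /carre mulr_sumr.
have Ehc : Ex (fun x => (stein_deriv z \o F) x * (carre N x - Ex (carre N))) =
    Ex (fun x => (stein_deriv z \o F) x * carre N x) -
    Ex (carre N) * Ex (stein_deriv z \o F).
  rewrite -(ExZ _ (L2_L1 hh)) -ExB; [|exact: L2M|by apply: L1Z; exact: L2_L1].
  by congr (Ex _); apply/funext => x; ring.
have hTc : L2 (fun x => carre N x - Ex (carre N)) by apply: L2B => //; exact: L2_cst.
have cs f g : L2 f -> L2 g -> `|Ex (fun x => f x * g x)| <=
    Num.sqrt (Ex (fun x => f x ^+ 2)) * Num.sqrt (Ex (fun x => g x ^+ 2)).
  move=> hf hg; apply: le_trans (Ex_cauchy_schwarz hf hg).
  by apply: le_normr_Rintegral => //; exact: L2M.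
have T1 : `|Ex (fun x => (stein_deriv z \o F) x * (carre N x - Ex (carre N)))| <=
    Num.sqrt (Ex (fun x => stein_deriv z (F x) ^+ 2)) * Num.sqrt (3 * (2 * B1 + B2)).
  apply: (le_trans (cs _ _ hh hTc)); apply: ler_wpM2l; first exact: sqrtr_ge0.
  by apply: ler_wsqrtr; exact: Ex_carre_variance_le.
have T2 : `|\sum_(j < N) Ex (fun x => K N (V j) x * stein_rest z j x)| <=
    Num.sqrt (Ex (fun x => stein_mono z (F x) ^+ 2)) * Num.sqrt (B3 + 3 * (2 * B4 + B5)).
  apply: (le_trans (Ex_stein_rest_le z N)); apply: ler_wpM2l; first exact: sqrtr_ge0.
  by apply: ler_wsqrtr; exact: Ex_skorokhod_sqr_bound.
have T3 : `|Ex (fun x => avg N F x * (stein_sol z \o F) x)| <= e' * Bs.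
  apply: (le_trans (cs _ _ hA hs)); apply: ler_pM => //; rewrite ?sqrtr_ge0//.
  rewrite -[Bs]ger0_norm// -sqrtr_sqr; apply: ler_wsqrtr.
  rewrite -[leRHS](Ex_cst mu); apply: Ex_le; [exact: hs.2|exact: L1_cst|] => x.
  by apply: lerXn2r; rewrite ?nnegrE//= ?stein_sol_ge0// stein_sol_bounded.
have T4 : `|Ex (fun x => avg N F x * F x)| <= e'.
  by apply: (le_trans (cs _ _ hA hF)); rewrite F1 sqrtr1 mulr1.
have Eh : `|Ex (stein_deriv z \o F)| <= 2.
  rewrite -[leRHS](Ex_cst mu); apply: Ex_le_norm.
  - by case: hh.
  - exact: L1_cst.
  - by move=> x; exact: norm_stein_deriv_le.
have F1' : Ex (fun x => F x * F x) = 1 by rewrite -F1; congr (Ex _).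
have ee : e = e' * Bs + e' * 2 by rewrite /e'; field; rewrite gt_eqF.
rewrite stein (_ : _ - _ = - Ex (fun x => (stein_deriv z \o F) x * (carre N x - Ex (carre N)))
   - \sum_(j < N) Ex (fun x => K N (V j) x * stein_rest z j x)
   - Ex (fun x => avg N F x * (stein_sol z \o F) x)
   + Ex (fun x => avg N F x * F x) * Ex (stein_deriv z \o F)); last first.
  have E1 : Ex (fun x => F x * (stein_sol z \o F) x) =
      Ex (fun x => avg N F x * (stein_sol z \o F) x) +
      (Ex (fun x => (stein_deriv z \o F) x * carre N x) +
      \sum_(j < N) Ex (fun x => K N (V j) x * stein_rest z j x)).
    by rewrite -EhT -cov1; ring.
  have E2 : Ex (carre N) = 1 - Ex (fun x => avg N F x * F x).
    by rewrite ET -F1' cov2.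
  by rewrite Ehc E1 E2; ring.
have T5 : `|Ex (fun x => avg N F x * F x) * Ex (stein_deriv z \o F)| <= e' * 2.
  by rewrite normrM; apply: ler_pM.
rewrite ee; apply: (le_trans (ler_normD _ _)); rewrite addrA.
apply: lerD => //; apply: (le_trans (ler_normB _ _)).
apply: lerD => //; apply: (le_trans (ler_normB _ _)).
by rewrite normrN; exact: lerD.
Qed.

End gradient_pair.
End estimates.

(** * Functionals of a random sequence *)

Section sequence_space.
Context {R : realType}.

Definition coordinate (i : nat) (x : nat -> R) : R := x i.

Definition seq_space :=
  g_sigma_algebraType (\bigcup_i preimage_set_system setT (coordinate i) measurable).

Lemma measurable_coordinate i : measurable_fun setT (coordinate i : seq_space -> R).
Proof. by move=> _ B mB; apply: sub_sigma_algebra; exists i => //; exists B. Qed.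

Lemma measurable_into_seq d (T : measurableType d) (G : T -> seq_space) :
  (forall i, measurable_fun setT (fun w => G w i)) -> measurable_fun setT G.
Proof.
move=> h; apply: (@measurability _ _ T seq_space setT G (\bigcup_i preimage_set_system setT (coordinate i) measurable)) => //.
move=> _ [_ [i _ [B mB <-]] <-]; rewrite !setTI.
by have := h i measurableT B mB; rewrite setTI.
Qed.

Lemma sigma_measurableP (f : (nat -> R) -> R) :
  sigma_measurable (fun i (x : nat -> R) => x i) f <->
  measurable_fun setT (f : seq_space -> R).
Proof.
split=> [h _ B mB|h B mB]; first by rewrite setTI; exact: h.
by have := h measurableT B mB; rewrite setTI.
Qed.

Lemma measurable_set_coord i (a : R) :
  measurable_fun setT ((fun x => set_coord x i a) : seq_space -> seq_space).
Proof.
apply: measurable_into_seq => j; rewrite /set_coord.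
case: eqP => _; first exact: measurable_cst.
exact: measurable_coordinate.
Qed.

(** The preimages of measurable sets under the path map form a sigma-algebra
    containing the generators. *)
Lemma sigma_of_preimage (T : Type) (X : nat -> T -> R) (S : set T) :
  sigma_of X S -> exists2 A : set seq_space, measurable A &
    S = (fun w i => X i w) @^-1` A.
Proof.
move: S; apply: smallest_sub.
  split.
  - by exists set0 => //; rewrite preimage_set0.
  - move=> _ [A mA ->]; exists (~` A); first exact: measurableC.
    by rewrite setTD preimage_setC.
  - move=> S hS; have /choice[A hA] : forall n, exists A : set seq_space,
        measurable A /\ S n = (fun w i => X i w) @^-1` A.
      by move=> n; have [A ? ?] := hS n; exists A.
    exists (\bigcup_n A n); first by apply: bigcupT_measurable => n; exact: (hA n).1.
    by rewrite preimage_bigcup; apply: eq_bigcupr => n _; exact: (hA n).2.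
move=> _ [i _ [B mB <-]]; exists (coordinate i @^-1` B); last by rewrite setTI.
by have := @measurable_coordinate i measurableT B mB; rewrite setTI.
Qed.

(** Doob-Dynkin: the functional is rebuilt from the level sets of [F] at rational
    heights, [f x] being the infimum of the rationals [q] with [F <= q]. *)
Lemma doob_dynkin (T : Type) (X : nat -> T -> R) (F : T -> R) :
  sigma_measurable X F ->
  exists2 f : (nat -> R) -> R, measurable_fun setT (f : seq_space -> R) &
    forall w, F w = f (fun i => X i w).
Proof.
move=> hF.
have /choice[A hA] : forall q : rat, exists A : set seq_space, measurable A /\
    F @^-1` `]-oo, ratr q] = (fun w i => X i w) @^-1` A.
  move=> q; have [|A ? ?] := @sigma_of_preimage T X (F @^-1` `]-oo, ratr q]).
    exact: hF (measurable_itv _).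
  by exists A.
pose u (n : nat) (x : seq_space) : \bar R :=
  if unpickle n is Some q then (if x \in A q then (ratr q)%:E else +oo%E) else +oo%E.
have mu_ n : measurable_fun setT (u n).
  rewrite /u; case: (unpickle n) => [q|]; last exact: measurable_cst.
  apply: measurable_fun_ifT; [|exact: measurable_cst|exact: measurable_cst].
  apply: (measurable_fun_bool true).
  rewrite setTI (_ : _ @^-1` _ = A q); first exact: (hA q).1.
  by apply/seteqP; split => x /= h; [exact: set_mem|exact: mem_set].
exists (fun x => fine (einfs (u ^~ x) 0)).
  apply: measurableT_comp => //; exact: measurable_fun_einfs.
move=> w; set x := fun i => X i w.
suff -> : einfs (u ^~ x) 0 = (F w)%:E by [].
have inA q : (x \in A q) = (F w <= ratr q).
  have := (hA q).2 => /seteqP[h1 h2]; apply/idP/idP => [/set_mem Ax|Fq].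
    by have := h2 w Ax; rewrite /= in_itv.
  by apply/mem_set; apply: (h1 w); rewrite /= in_itv.
apply/eqP; rewrite eq_le; apply/andP; split; last first.
  apply: le_ereal_inf_tmp => _ [n _ <-]; rewrite /u.
  case: (unpickle n) => [q|]; last by rewrite leey.
  by rewrite inA; case: ifP => h; rewrite ?lee_fin ?leey.
apply/lee_addgt0Pr => e e0.
have [q /andP[q1 q2]] : exists q, F w < ratr q < F w + e.
  by have := @rat_in_itvoo R (F w) (F w + e); rewrite ltrDl => /(_ e0)[q]; rewrite in_itv; exists q.
apply: (@le_trans _ _ (u (pickle q) x)); last first.
  by rewrite /u pickleK inA (ltW q1) lee_fin ltW.
by apply: ereal_inf_lbound; exists (pickle q).
Qed.

(** Any measurable functional representing [F] shows that the choice made in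
    [functional_of] is a good one. *)
Lemma functional_of_spec (T : Type) (X : nat -> T -> R) (F : T -> R)
    (f : (nat -> R) -> R) : measurable_fun setT (f : seq_space -> R) ->
  (forall w, F w = f (fun i => X i w)) ->
  measurable_fun setT (functional_of X F : seq_space -> R) /\
  forall w, F w = functional_of X F (fun i => X i w).
Proof.
move=> mf hf.
have [/sigma_measurableP h1 h2] : (sigma_measurable (fun i (x : nat -> R) => x i)
    (functional_of X F) /\ forall w, F w = functional_of X F (fun i => X i w)).
  apply: (@getPex _ [set f | sigma_measurable (fun (i : nat) (x : nat -> R) => x i) f /\
               forall w, F w = f (fun i => X i w)]).
  by exists f; split => //; apply/sigma_measurableP.
by [].
Qed.

End sequence_space.

(** * The law of the signs of a Rademacher sequence *)

Section sign_law.
Context {R : realType} {d : measure_display} {T : measurableType d}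
  (P : probability T R) (X : nat -> {RV P >-> R}) (p : nat -> R).

Definition signs (w : T) : cube := fun i => X i w == 1.

Lemma measurable_signs : measurable_fun setT signs.
Proof.
apply: (@measurability _ _ T cube setT signs coord_sets) => // _ [_ [i ->] <-]; rewrite setTI.
have m1 : measurable_fun setT (fun w => X i w == 1) by exact: measurable_fun_eqr.
have := m1 measurableT [set true] I; rewrite setTI; congr measurable.
Qed.

HB.instance Definition _ := isMeasurableFun.Build _ _ _ _ signs measurable_signs.

Definition sign_law : probability cube R := distribution P (signs : {mfun T >-> cube}).

Hypothesis hX : rademacher_sequence X p.

Definition cylinder n (C : nat -> bool -> bool) : set cube :=
  [set x | forall i, (i < n)%N -> C i (x i)].

Lemma measurable_cylinder n C : measurable (cylinder n C).
Proof.
elim: n => [|n IH].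
  by rewrite (_ : cylinder 0 C = setT)//; apply/seteqP; split => // x _ i.
rewrite (_ : cylinder n.+1 C = cylinder n C `&` ((fun x : cube => x n) @^-1` [set b | C n b])).
  apply: measurableI => //.
  by have := @measurable_bit n measurableT [set b | C n b] I; rewrite setTI.
apply/seteqP; split => [x h|x [h1 h2] i]; first by split => [i ni|]; apply: h; rewrite ?ltnS// ltnW.
by rewrite ltnS leq_eqVlt => /predU1P[->//|]; exact: h1.
Qed.

Definition bit_mass (C : nat -> bool -> bool) i : R :=
  p i * (C i true)%:R + (1 - p i) * (C i false)%:R.

(** Independence, applied to the events that prescribe the first [n] signs. *)
Lemma sign_law_cylinder n C :
  sign_law (cylinder n C) = (\prod_(i < n) bit_mass C i)%:E.
Proof.
have [ind p01 P1 _] := hX.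
pose A i : set R := [set r | C i (r == 1)].
have mA i : measurable (A i).
  have m1 : measurable_fun setT (fun r : R => r == 1) by exact: measurable_fun_eqr.
  by have := m1 measurableT [set b | C i b] I; rewrite setTI.
have PA i : P (preimage (X i) (A i)) = (bit_mass C i)%:E.
  have mX1 : measurable [set w | X i w = 1].
    have mXi : measurable_fun setT (X i) by [].
    by have := mXi measurableT [set 1] (measurable_set1 _); rewrite setTI.
  rewrite /bit_mass /A; case E1: (C i true); case E2: (C i false) => /=.
  - rewrite (_ : _ @^-1` _ = setT); last by apply/seteqP; split => // w _ /=; case: (_ == _).
    rewrite [LHS]probability_setT; congr EFin; ring.
  - rewrite mulr1 mulr0 addr0 -P1; congr (P _); apply/seteqP; split => w /=.
      by case: eqP => //; rewrite E2.
    by move=> ->; rewrite eqxx E1.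
  - rewrite mulr1 mulr0 add0r EFinB -P1 -probability_setC//; congr (P _).
    apply/seteqP; split => w /=; first by case: eqP => // ->; rewrite E1.
    by move=> /eqP/negbTE->; rewrite E2.
  - rewrite (_ : _ @^-1` _ = set0); last by apply/seteqP; split => // w /=; case: (_ == _); rewrite ?E1 ?E2.
    by rewrite measure0 !mulr0 addr0.
transitivity (P (\bigcap_(i in [set` iota 0 n]) preimage (X i) (A i))).
  congr (P _); apply/seteqP; split => w h i /=.
    by rewrite mem_iota => ni; exact: h.
  by move=> ni; apply: (h i); rewrite /= mem_iota.
rewrite (ind (iota 0 n) A (iota_uniq 0 n) mA) (eq_bigr _ (fun i _ => PA i)).
rewrite prodEFin; congr EFin; rewrite -[n in iota 0 n]subn0 -/(index_iota 0 n).
by rewrite big_mkord.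
Qed.

(** Both sides are finite measures, so it is enough to compare them on cylinders,
    where one factor of the product splits into its two values. *)
Lemma sign_law_flip i (A : set cube) : measurable A ->
  (sign_law A = (p i)%:E * sign_law (flip i true @^-1` A) +
     (1 - p i)%:E * sign_law (flip i false @^-1` A))%E.
Proof.
have [_ p01 _ _] := hX; have /andP[p0 p1] := p01 i.
have q0 : 0 <= 1 - p i by rewrite subr_ge0 ltW.
pose m1 := mscale (NngNum (ltW p0)) (distribution sign_law (flip i true)).
pose m2 := mscale (NngNum q0) (distribution sign_law (flip i false)).
pose G : set (set cube) := [set A | exists n C, A = cylinder n C].
have mG : measurable = <<s G >> :> set (set cube).
  apply/seteqP; split.
    apply: smallest_sub; first exact: smallest_sigma_algebra.
    move=> _ [j ->]; apply: sub_sigma_algebra.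
    exists j.+1, (fun k b => (k == j) ==> b); apply/seteqP; split => x /= h.
      by move=> k _; apply/implyP => /eqP->.
    by have := h j (ltnSn j); rewrite eqxx.
  apply: smallest_sub; first exact: sigma_algebra_measurable.
  by move=> _ [n [C ->]]; exact: measurable_cylinder.
have GI : setI_closed G.
  move=> _ _ [n [C ->]] [m [C' ->]].
  exists (maxn n m), (fun j b => ((j < n)%N ==> C j b) && ((j < m)%N ==> C' j b)).
  apply/seteqP; split => [x [h1 h2] j _|x h].
    by apply/andP; split; apply/implyP; [exact: h1|exact: h2].
  split=> j jn.
    by have := h j; rewrite leq_max jn => /(_ isT)/andP[].
  by have := h j; rewrite leq_max jn orbT => /(_ isT)/andP[].
move=> mA; rewrite (@measure_unique _ _ _ G (fun=> setT) mG GI _ _ sign_law (measure_add m1 m2) _ _ A mA).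
- exact: (measure_addE m1 m2 A).
- move=> _; exists 0%N, (fun _ _ => true); apply/seteqP; by split.
- by apply/seteqP; split => // x _; exists 0%N.
- move=> _ [n [C ->]]; apply/esym; apply: etrans (measure_addE m1 m2 _) _.
  pose U j := if j == i then xpredT else C j.
  have pre c : flip i c @^-1` cylinder n C =
      if (i < n)%N ==> C i c then cylinder n U else set0.
    case: ifPn => h; apply/seteqP; split => // x.
    - move=> hx j jn; rewrite /U; case: eqP => // /eqP ji.
      by have := hx j jn; rewrite flip_other.
    - move=> hx j jn; have := hx j jn; rewrite /U; case: (eqVneq j i) => [ji _|ji].
        by rewrite ji flip_same; move: h; rewrite -ji jn.
      by rewrite flip_other.
    - move: h; rewrite negb_imply => /andP[ni Cn] hx.
      by have := hx i ni; rewrite flip_same (negbTE Cn).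
  transitivity ((p i)%:E * sign_law (flip i true @^-1` cylinder n C) +
      (1 - p i)%:E * sign_law (flip i false @^-1` cylinder n C))%E; first by [].
  rewrite !pre.
  have mass (b : bool) : sign_law (if b then cylinder n U else set0) =
      (b%:R * \prod_(j < n) bit_mass U j)%:E.
    case: b; last by rewrite measure0 mul0r.
    by rewrite sign_law_cylinder mul1r.
  rewrite !mass; apply: etrans _ (esym (sign_law_cylinder n C)).
  rewrite -!EFinM -EFinD; congr EFin.
  have [ni|ni] := ltnP i n => /=; last first.
    rewrite !mul1r -mulrDl addrC subrK mul1r; apply: eq_bigr => j _.
    by rewrite /bit_mass /U ltn_eqF// (leq_trans (ltn_ord j)).
  have E (V : nat -> bool -> bool) : \prod_(j < n) bit_mass V j =
      bit_mass V i * \prod_(j < n | j != Ordinal ni) bit_mass V j.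
    by rewrite (bigD1 (Ordinal ni)).
  rewrite (E U) (E C).
  have -> : \prod_(j < n | j != Ordinal ni) bit_mass U j =
      \prod_(j < n | j != Ordinal ni) bit_mass C j.
    apply: eq_bigr => j ji; rewrite /bit_mass /U (_ : (j == i :> nat) = false)//.
    by apply: contraNF ji => /eqP ji; apply/eqP/val_inj.
  have -> : bit_mass U i = 1 by rewrite /bit_mass /U eqxx /=; ring.
  by rewrite /bit_mass; ring.
- by move=> _; rewrite (le_lt_trans (probability_le1 _ _))// ltry.
Qed.

End sign_law.

(** * From the probability space to the space of signs *)

Section transfer.
Context {R : realType} {d : measure_display} {T : measurableType d}
  (P : probability T R) (X : nat -> {RV P >-> R}) (p : nat -> R).
Hypothesis hX : rademacher_sequence X p.

Local Notation mu := (sign_law X).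
Local Notation Ex := (Ex mu).
Local Notation L1 := (L1 mu).
Local Notation L2 := (L2 mu).
Local Notation L4 := (L4 mu).

Let hp : forall i, 0 < p i < 1. Proof. by case: hX. Qed.
Let hlaw := @sign_law_flip _ _ _ _ _ _ hX.

Definition pm1 (b : cube) : @seq_space R := fun i => if b i then 1 else -1.

Lemma measurable_pm1 : measurable_fun setT pm1.
Proof.
apply: measurable_into_seq => i.
by apply: measurable_fun_ifT; [exact: measurable_bit|exact: measurable_cst..].
Qed.

Lemma measurable_path : measurable_fun setT ((fun w i => X i w) : T -> @seq_space R).
Proof. exact: measurable_into_seq. Qed.

(** Almost every path consists of signs; on such paths the functionals on real
    sequences and on sign sequences agree. *)
Definition is_sign_path (w : T) := forall i, X i w = 1 \/ X i w = -1.

Lemma ae_sign_path : {ae P, forall w, is_sign_path w}.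
Proof.
apply: ae_foralln => i; have [_ _ P1 Pm1] := hX.
have mXi : measurable_fun setT (X i) by [].
have m (a : R) : measurable [set w | X i w = a].
  by have := mXi measurableT [set a] (measurable_set1 _); rewrite setTI.
pose A := [set w | X i w = 1] `|` [set w | X i w = -1].
have mA : measurable A by exact: measurableU.
exists (~` A); split; [exact: measurableC| |by move=> w /= h [?|?]; apply: h; [left|right]].
have PA : P A = 1%E.
  have dis : [set w | X i w = 1] `&` [set w | X i w = -1] = set0.
    by apply/seteqP; split => // w [/= -> h]; lra.
  apply: (etrans (measureU P (m 1) (m (-1)) dis)).
  apply: (etrans (congr2 (fun a b => a + b)%E (P1 i) (Pm1 i))).
  by rewrite /= -EFinD addrC subrK.
apply: (etrans (probability_setC P mA)); apply: (etrans (congr1 (fun t => 1 - t)%E PA)).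
by rewrite /= -EFinB subrr.
Qed.

Lemma pm1_signs w : is_sign_path w -> pm1 (signs X w) = fun i => X i w.
Proof.
move=> h; apply/funext => i; rewrite /pm1 /signs.
have [->|->] := h i; first by rewrite eqxx.
by case: eqP => // E; lra.
Qed.

Lemma set_coord_pm1 i c b : set_coord (pm1 b) i (if c then 1 else -1) = pm1 (flip i c b).
Proof. by apply/funext => j; rewrite /set_coord /pm1 /flip; case: eqP. Qed.

Lemma ae_signs (Q : cube -> Prop) : {ae mu, forall x, Q x} -> {ae P, forall w, Q (signs X w)}.
Proof.
move=> [N [mN N0 QN]]; exists (signs X @^-1` N); split.
- by have := @measurable_signs _ _ _ _ X measurableT N mN; rewrite setTI.
- exact: N0.
- by move=> w /= h; apply: QN.
Qed.

(** Substituting a coordinate maps null sets to null sets, because both values have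
    positive probability. *)
Lemma ae_flip i c (Q : cube -> Prop) : {ae mu, forall x, Q x} -> {ae mu, forall x, Q (flip i c x)}.
Proof.
move=> [N [mN N0 QN]]; exists (flip i c @^-1` N); split.
- by have := @measurable_flip i c measurableT N mN; rewrite setTI.
- have := hlaw i mN; rewrite [in X in X = _]N0 => /esym.
  have /andP[p0 p1] := hp i; have q0 : 0 < 1 - p i by rewrite subr_gt0.
  move/eqP; rewrite padde_eq0; [|by apply: mule_ge0; [apply: ltW; rewrite lte_fin|exact: measure_ge0]..].
  rewrite !mule_eq0 !eqe (gt_eqF p0) (gt_eqF q0) /= => /andP[/eqP h1 /eqP h2].
  by case: c.
- by move=> x /= h; apply: QN.
Qed.

Lemma ae_of_signs (f g : cube -> R) : measurable_fun setT f -> measurable_fun setT g ->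
  {ae P, forall w, f (signs X w) = g (signs X w)} -> {ae mu, forall x, f x = g x}.
Proof.
move=> mf mg [N [mN N0 QN]].
pose Z := [set x | f x != g x].
have mZ : measurable Z.
  have := measurable_neqe measurableT (iffRL (measurable_EFinP _ _) mf)
     (iffRL (measurable_EFinP _ _) mg).
  by rewrite setTI.
exists Z; split => //; last by move=> x /= /eqP.
have mSZ : measurable (signs X @^-1` Z).
  by have := @measurable_signs _ _ _ _ X measurableT Z mZ; rewrite setTI.
have h : (P (signs X @^-1` Z) <= P N)%E.
  apply: le_measure; rewrite ?inE//.
  by move=> w /= h; apply: QN => /= E; rewrite /Z /= E eqxx in h.
by apply/eqP; rewrite eq_le measure_ge0 andbT; move: h; rewrite N0.
Qed.

Lemma expectation_signs_ge0 (psi : T -> R) (Psi : cube -> R) :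
  measurable_fun setT psi -> measurable_fun setT Psi ->
  (forall w, 0 <= psi w) -> (forall x, 0 <= Psi x) ->
  {ae P, forall w, psi w = Psi (signs X w)} ->
  ('E_P[psi] = \int[mu]_x (Psi x)%:E)%E.
Proof.
move=> m1 m2 p0 P0 ae; rewrite unlock /= ge0_integral_distribution//; last first.
  exact/measurable_EFinP.
apply: ge0_ae_eq_integral => //.
- exact/measurable_EFinP.
- apply/measurable_EFinP; apply: measurableT_comp => //; exact: measurable_signs.
- by move=> w _; rewrite lee_fin.
- by move=> w _; rewrite /= lee_fin.
- by apply: filterS ae => w /= ->.
Qed.

Lemma L1_of_fin (Psi : cube -> R) : measurable_fun setT Psi -> (forall x, 0 <= Psi x) ->
  (\int[mu]_x (Psi x)%:E < +oo)%E -> L1 Psi.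
Proof.
move=> mP P0 h; apply/integrableP; split; first exact/measurable_EFinP.
by under eq_integral do rewrite /= ger0_norm//.
Qed.

Lemma L1_Ex (Psi : cube -> R) : L1 Psi -> (\int[mu]_x (Psi x)%:E = (Ex Psi)%:E)%E.
Proof. by move=> h; rewrite /Rintegral fineK//; exact: integrable_fin_num. Qed.

Definition cube_lift (G : T -> R) : cube -> R := fun b => functional_of X G (pm1 b).

Definition has_functional (G : T -> R) :=
  exists2 f : (nat -> R) -> R, measurable_fun setT (f : seq_space -> R) &
    forall w, G w = f (fun i => X i w).

Section one_functional.
Variable G : T -> R.
Hypothesis hG : has_functional G.

Lemma functionalP : measurable_fun setT (functional_of X G : seq_space -> R) /\
  forall w, G w = functional_of X G (fun i => X i w).
Proof. by case: hG => f; exact: functional_of_spec. Qed.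

Lemma measurable_lift : measurable_fun setT (cube_lift G).
Proof. by apply: measurableT_comp functionalP.1 _; exact: measurable_pm1. Qed.

Lemma measurable_functional : measurable_fun setT G.
Proof.
rewrite (_ : G = (functional_of X G : seq_space -> R) \o (fun w i => X i w)).
  by apply: measurableT_comp functionalP.1 _; exact: measurable_path.
by apply/funext => w; exact: functionalP.2.
Qed.

Lemma lift_signs w : is_sign_path w -> G w = cube_lift G (signs X w).
Proof. by move=> h; rewrite /cube_lift pm1_signs//; exact: functionalP.2. Qed.

Lemma D_signs i w : is_sign_path w -> D X p i G w = dif p i (cube_lift G) (signs X w).
Proof.
move=> h; rewrite /D /dif /cube_lift -!set_coord_pm1 pm1_signs//.
Qed.

Lemma has_functional_D i : has_functional (D X p i G).
Proof.
exists (fun x => Num.sqrt (pq p i) *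
  (functional_of X G (set_coord x i 1) - functional_of X G (set_coord x i (-1)))) => //.
apply: measurable_funM => //; apply: measurable_funB.
- by apply: measurableT_comp functionalP.1 _; exact: measurable_set_coord.
- by apply: measurableT_comp functionalP.1 _; exact: measurable_set_coord.
Qed.

End one_functional.

Lemma measurable_dif i (f : cube -> R) : measurable_fun setT f -> measurable_fun setT (dif p i f).
Proof. exact: (stable_dif p (stable_measurable (R := R)) i). Qed.

Lemma ae_lift_D i G : has_functional G ->
  {ae mu, forall x, cube_lift (D X p i G) x = dif p i (cube_lift G) x}.
Proof.
move=> hG; have hD := has_functional_D hG i; apply: ae_of_signs.
- exact: measurable_lift.
- by apply: measurable_dif; exact: measurable_lift.
- apply: filterS ae_sign_path => w h.
  by rewrite -lift_signs// D_signs.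
Qed.

(** The functional chosen for [D X p m G] agrees with [dif p m (cube_lift G)] only
    almost everywhere; by [ae_flip] this still determines its gradient. *)
Lemma ae_D2_signs l m G : has_functional G ->
  {ae P, forall w, D X p l (D X p m G) w = dif p l (dif p m (cube_lift G)) (signs X w)}.
Proof.
move=> hG; have hD := has_functional_D hG m.
have h c := ae_signs (ae_flip l c (ae_lift_D m hG)).
apply: filterS3 ae_sign_path (h true) (h false) => w hw h1 h2.
by rewrite D_signs// {1}/dif h1 h2.
Qed.

Lemma ae_D_signs m G : has_functional G ->
  {ae P, forall w, D X p m G w = dif p m (cube_lift G) (signs X w)}.
Proof. by move=> hG; apply: filterS ae_sign_path => w; exact: D_signs. Qed.

End transfer.

(** * The non-uniform bound *)

Lemma le_sum_nneseries (R : realType) (u : nat -> \bar R) (v : nat -> R) (n : nat) :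
  (forall i, 0 <= u i)%E -> (forall i, (v i)%:E <= u i)%E ->
  ((\sum_(i < n) v i)%:E <= \sum_(0 <= i <oo) u i)%E.
Proof.
move=> u0 vu; apply: le_trans (nneseries_lim_ge n (fun i _ _ => u0 i)).
by rewrite big_mkord -sumEFin; apply: lee_sum => i _; exact: vu.
Qed.

Lemma sqrtrD_le (R : realType) (a b : R) : 0 <= a -> 0 <= b ->
  Num.sqrt (a + b) <= Num.sqrt a + Num.sqrt b.
Proof.
move=> a0 b0; rewrite -[leRHS]ger0_norm ?addr_ge0 ?sqrtr_ge0// -sqrtr_sqr.
apply: ler_wsqrtr; by rewrite sqrrD !sqr_sqrtr// addrAC lerDl mulrn_wge0.
Qed.

Section reduction.
Context {R : realType} {d : measure_display} {T : measurableType d}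
  (P : probability T R) (X : nat -> {RV P >-> R}) (p : nat -> R) (F : T -> R).
Hypothesis hX : rademacher_sequence X p.
Hypothesis hF : has_functional X F.

Local Notation mu := (sign_law X).
Local Notation Ex := (Ex mu).
Local Notation L1 := (L1 mu).
Local Notation L2 := (L2 mu).
Local Notation L4 := (L4 mu).
Local Notation phi := (cube_lift X F).
Local Notation V j := (dif p j phi).
Local Notation DF j := (D X p j F).
Local Notation DDF l j := (D X p l (D X p j F)).

Let hp : forall i, 0 < p i < 1. Proof. by case: hX. Qed.

Let mphi : measurable_fun setT phi := measurable_lift hF.
Let mV j : measurable_fun setT (V j) := measurable_dif p j mphi.
Let mDV l j : measurable_fun setT (dif p l (V j)) := measurable_dif p l (mV j).
Let mF : measurable_fun setT F := measurable_functional hF.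
Let mDF j : measurable_fun setT (DF j) := measurable_functional (has_functional_D p hF j).
Let mDDF l j : measurable_fun setT (DDF l j) :=
  measurable_functional (has_functional_D p (has_functional_D p hF j) l).

Lemma sqr_sqr_ge0 (a b : R) : 0 <= a ^+ 2 * b ^+ 2.
Proof. by rewrite mulr_ge0 ?sqr_ge0. Qed.

Lemma pow4_ge0 (a : R) : 0 <= a ^+ 4. Proof. exact: exprn_even_ge0. Qed.

Lemma expectation_comp_ge0 (h : R -> R) : measurable_fun setT h -> (forall w, 0 <= h w) ->
  ('E_P[fun w => h (F w)] = \int[mu]_x (h (phi x))%:E)%E.
Proof.
move=> mh h0; apply: expectation_signs_ge0 => //.
- exact: measurableT_comp.
- exact: measurableT_comp.
- by apply: filterS (ae_sign_path hX) => w hw; rewrite (lift_signs hF).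
Qed.

Lemma expectation_DD j m :
  ('E_P[fun w => (DF j w ^+ 2 * DF m w ^+ 2)%R] =
   \int[mu]_x (V j x ^+ 2 * V m x ^+ 2)%:E)%E.
Proof.
apply: expectation_signs_ge0.
- by apply: measurable_funM; apply: measurable_funX.
- by apply: measurable_funM; apply: measurable_funX.
- by move=> w; exact: sqr_sqr_ge0.
- by move=> x; exact: sqr_sqr_ge0.
- by apply: filterS2 (ae_D_signs hX j hF) (ae_D_signs hX m hF) => w -> ->.
Qed.

Lemma expectation_D2D2 l j m :
  ('E_P[fun w => (DDF l j w ^+ 2 * DDF l m w ^+ 2)%R] =
   \int[mu]_x (dif p l (V j) x ^+ 2 * dif p l (V m) x ^+ 2)%:E)%E.
Proof.
apply: expectation_signs_ge0.
- by apply: measurable_funM; apply: measurable_funX.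
- by apply: measurable_funM; apply: measurable_funX.
- by move=> w; exact: sqr_sqr_ge0.
- by move=> x; exact: sqr_sqr_ge0.
- by apply: filterS2 (ae_D2_signs hX l j hF) (ae_D2_signs hX l m hF) => w -> ->.
Qed.

Lemma expectation_D4 m :
  ('E_P[fun w => (DF m w ^+ 4)%R] = \int[mu]_x (V m x ^+ 4)%:E)%E.
Proof.
apply: expectation_signs_ge0.
- exact: measurable_funX.
- exact: measurable_funX.
- by move=> w; exact: pow4_ge0.
- by move=> x; exact: pow4_ge0.
- by apply: filterS (ae_D_signs hX m hF) => w ->.
Qed.

Lemma expectation_D2_4 l m :
  ('E_P[fun w => (DDF l m w ^+ 4)%R] = \int[mu]_x (dif p l (V m) x ^+ 4)%:E)%E.
Proof.
apply: expectation_signs_ge0.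
- exact: measurable_funX.
- exact: measurable_funX.
- by move=> w; exact: pow4_ge0.
- by move=> x; exact: pow4_ge0.
- by apply: filterS (ae_D2_signs hX l m hF) => w ->.
Qed.

Lemma B1_ge0 : (0 <= Defs.B1 P X p F)%E.
Proof.
by apply: nneseries_ge0 => j _ _; apply: nneseries_ge0 => m _ _;
  apply: nneseries_ge0 => l _ _; rewrite mule_ge0 ?sqrte_ge0.
Qed.

Lemma ipq_ge0 i : (0 <= (pq p i)^-1%:E :> \bar R)%E.
Proof. by rewrite lee_fin invr_ge0 ltW// pq_gt0. Qed.

Lemma ipq2_ge0 i j : (0 <= (pq p i * pq p j)^-1%:E :> \bar R)%E.
Proof. by rewrite lee_fin invr_ge0 ltW// mulr_gt0// pq_gt0. Qed.

Lemma expectation_fun_ge0 (f : T -> R) : (forall w, 0 <= f w) -> (0 <= 'E_P[f])%E.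
Proof. by move=> f0; rewrite unlock; apply: integral_ge0 => w _; rewrite lee_fin. Qed.

Let E22 (f g : T -> R) : (0 <= 'E_P[fun w => (f w ^+ 2 * g w ^+ 2)%R])%E.
Proof. by apply: expectation_fun_ge0 => w; exact: sqr_sqr_ge0. Qed.

Let E4 (f : T -> R) : (0 <= 'E_P[fun w => (f w ^+ 4)%R])%E.
Proof. by apply: expectation_fun_ge0 => w; exact: pow4_ge0. Qed.

Lemma B2_ge0 : (0 <= Defs.B2 P X p F)%E.
Proof.
by apply: nneseries_ge0 => j _ _; apply: nneseries_ge0 => m _ _;
  apply: nneseries_ge0 => l _ _; rewrite mule_ge0 ?ipq_ge0.
Qed.

Lemma B3_ge0 : (0 <= Defs.B3 P X p F)%E.
Proof. by apply: nneseries_ge0 => j _ _; rewrite mule_ge0 ?ipq_ge0. Qed.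

Lemma B4_ge0 : (0 <= Defs.B4 P X p F)%E.
Proof.
by apply: nneseries_ge0 => j _ _; apply: nneseries_ge0 => m _ _;
  rewrite !mule_ge0 ?sqrte_ge0 ?ipq_ge0.
Qed.

Lemma B5_ge0 : (0 <= Defs.B5 P X p F)%E.
Proof.
by apply: nneseries_ge0 => j _ _; apply: nneseries_ge0 => m _ _;
  rewrite mule_ge0 ?ipq2_ge0.
Qed.

(** The only source of fourth moments; when the third quantity is infinite, the
    bound to be proved is infinite as well. *)
Lemma L4_of_B3 : (Defs.B3 P X p F < +oo)%E -> forall m, L4 (V m).
Proof.
move=> h m; split => //; apply: L1_of_fin; [exact: measurable_funX|by move=> x; exact: pow4_ge0|].
rewrite -expectation_D4.
have u0 i : (0 <= (pq p i)^-1%:E * 'E_P[fun w => (DF i w ^+ 4)%R])%E.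
  by rewrite mule_ge0 ?ipq_ge0.
have h1 : ((pq p m)^-1%:E * 'E_P[fun w => (DF m w ^+ 4)%R] < +oo)%E.
  apply: le_lt_trans h; apply: le_trans (nneseries_lim_ge m.+1 (fun i _ _ => u0 i)).
  by rewrite big_nat_recr//= leeDr// sume_ge0.
have pqm : 0 < (pq p m)^-1 by rewrite invr_gt0 pq_gt0.
move: h1; case: ('E_P[_])%E (E4 (DF m)) => [r _ _||] //; first by rewrite ltry.
by rewrite gt0_muley ?lte_fin.
Qed.

Hypothesis hV : forall m, L4 (V m).

Let hlaw := @sign_law_flip _ _ _ _ _ _ hX.
Let hDV l m : L4 (dif p l (V m)). Proof. exact: (L4_dif hp hlaw l (hV m)). Qed.

Lemma E_DD j m : ('E_P[fun w => (DF j w ^+ 2 * DF m w ^+ 2)%R] =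
   (Ex (fun x => V j x ^+ 2 * V m x ^+ 2))%:E)%E.
Proof. by rewrite expectation_DD L1_Ex//; apply: L2M; exact: L4_sqr. Qed.

Lemma E_D2D2 l j m : ('E_P[fun w => (DDF l j w ^+ 2 * DDF l m w ^+ 2)%R] =
   (Ex (fun x => dif p l (V j) x ^+ 2 * dif p l (V m) x ^+ 2))%:E)%E.
Proof. by rewrite expectation_D2D2 L1_Ex//; apply: L2M; exact: L4_sqr. Qed.

Lemma E_D4 m : ('E_P[fun w => (DF m w ^+ 4)%R] = (Ex (fun x => V m x ^+ 4))%:E)%E.
Proof. by rewrite expectation_D4 L1_Ex//; case: (hV m). Qed.

Lemma E_D2_4 l m : ('E_P[fun w => (DDF l m w ^+ 4)%R] =
   (Ex (fun x => dif p l (V m) x ^+ 4))%:E)%E.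
Proof. by rewrite expectation_D2_4 L1_Ex//; case: (hDV l m). Qed.

Lemma sum_b1_le N n : ((\sum_(l < n) b1 p mu phi N l)%:E <= Defs.B1 P X p F)%E.
Proof.
pose t j m l := Num.sqrt (Ex (fun x => V j x ^+ 2 * V m x ^+ 2)) *
  Num.sqrt (Ex (fun x => dif p l (V j) x ^+ 2 * dif p l (V m) x ^+ 2)).
rewrite /b1 exchange_big /=.
apply: (@le_sum_nneseries _ _ (fun j => \sum_(l < n) \sum_(m < N) t j m l)) => j.
  by apply: nneseries_ge0 => m _ _; apply: nneseries_ge0 => l _ _; rewrite mule_ge0 ?sqrte_ge0.
rewrite exchange_big /=.
apply: (@le_sum_nneseries _ _ (fun m => \sum_(l < n) t j m l)) => m.
  by apply: nneseries_ge0 => l _ _; rewrite mule_ge0 ?sqrte_ge0.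
apply: (@le_sum_nneseries _ _ (t j m)) => l; first by rewrite mule_ge0 ?sqrte_ge0.
by rewrite E_DD E_D2D2.
Qed.

Lemma sum_b2_le N n : ((\sum_(l < n) b2 p mu phi N l)%:E <= Defs.B2 P X p F)%E.
Proof.
pose t j m l := (pq p l)^-1 *
  Ex (fun x => dif p l (V j) x ^+ 2 * dif p l (V m) x ^+ 2).
rewrite /b2 exchange_big /=.
apply: (@le_sum_nneseries _ _ (fun j => \sum_(l < n) \sum_(m < N) t j m l)) => j.
  by apply: nneseries_ge0 => m _ _; apply: nneseries_ge0 => l _ _; rewrite mule_ge0 ?ipq_ge0.
rewrite exchange_big /=.
apply: (@le_sum_nneseries _ _ (fun m => \sum_(l < n) t j m l)) => m.
  by apply: nneseries_ge0 => l _ _; rewrite mule_ge0 ?ipq_ge0.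
apply: (@le_sum_nneseries _ _ (t j m)) => l; first by rewrite mule_ge0 ?ipq_ge0.
by rewrite E_D2D2.
Qed.

Lemma sum_b3_le N : ((\sum_(m < N) b3 p mu phi m)%:E <= Defs.B3 P X p F)%E.
Proof.
apply: (@le_sum_nneseries _ _ (b3 p mu phi)) => m; first by rewrite mule_ge0 ?ipq_ge0.
by rewrite E_D4.
Qed.

Lemma sum_b4_le N :
  ((\sum_(m < N) \sum_(l < N) b4 p mu phi m l)%:E <= Defs.B4 P X p F)%E.
Proof.
apply: (@le_sum_nneseries _ _ (fun m => \sum_(l < N) b4 p mu phi m l)) => m.
  by apply: nneseries_ge0 => l _ _; rewrite !mule_ge0 ?sqrte_ge0 ?ipq_ge0.
apply: (@le_sum_nneseries _ _ (b4 p mu phi m)) => l; first by rewrite !mule_ge0 ?sqrte_ge0 ?ipq_ge0.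
by rewrite E_D4 E_D2_4.
Qed.

Lemma sum_b5_le N :
  ((\sum_(m < N) \sum_(l < N) b5 p mu phi m l)%:E <= Defs.B5 P X p F)%E.
Proof.
apply: (@le_sum_nneseries _ _ (fun m => \sum_(l < N) b5 p mu phi m l)) => m.
  by apply: nneseries_ge0 => l _ _; rewrite mule_ge0 ?ipq2_ge0.
apply: (@le_sum_nneseries _ _ (b5 p mu phi m)) => l; first by rewrite mule_ge0 ?ipq2_ge0.
by rewrite E_D2_4.
Qed.

End reduction.

Section moments.
Context {R : realType} {d : measure_display} {T : measurableType d}
  (P : probability T R) (X : nat -> {RV P >-> R}) (p : nat -> R) (F : T -> R).
Hypothesis hX : rademacher_sequence X p.
Hypothesis hF : has_functional X F.

Local Notation mu := (sign_law X).
Local Notation Ex := (Ex mu).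
Local Notation L1 := (L1 mu).
Local Notation L2 := (L2 mu).
Local Notation phi := (cube_lift X F).

Let mphi : measurable_fun setT phi := measurable_lift hF.
Let mF : measurable_fun setT F := measurable_functional hF.

Lemma even_pow_ge0 k (w : R) : 0 <= w ^+ (2 * k).
Proof. by rewrite exprM exprn_ge0// sqr_ge0. Qed.

Lemma expectation_even_pow k :
  ('E_P[fun w => (F w ^+ (2 * k))%R] = \int[mu]_x (phi x ^+ (2 * k))%:E)%E.
Proof.
apply: (expectation_comp_ge0 hX hF (h := fun w => w ^+ (2 * k))).
  exact: measurable_funX.
by move=> w; exact: even_pow_ge0.
Qed.

Lemma L1_even_pow k : ('E_P[fun w => (F w ^+ (2 * k))%R] < +oo)%E ->
  L1 (fun x => phi x ^+ (2 * k)).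
Proof.
move=> h; apply: L1_of_fin; [exact: measurable_funX|by move=> x; exact: even_pow_ge0|].
by rewrite -expectation_even_pow.
Qed.

Lemma expectation_lift : L1 phi -> 'E_P[F]%E = (Ex phi)%:E.
Proof.
move=> h1; rewrite -L1_Ex// unlock.
have ms := @measurable_signs _ _ _ _ X.
have mps : measurable_fun setT ((fun x => (phi x)%:E) \o signs X).
  by apply/measurable_EFinP; apply: measurableT_comp.
rewrite integral_distribution; [|exact/measurable_EFinP|].
  apply: ae_eq_integral => //; first exact/measurable_EFinP.
  by apply: filterS (ae_sign_path hX) => w hw _; rewrite /= (lift_signs hF).
apply/integrableP; split => //.
have /integrableP[mE] := h1.
by rewrite ge0_integral_distribution//; exact: measurableT_comp.
Qed.

Lemma probability_le_lift (z : R) :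
  P [set w | F w <= z] = (Ex (fun x => (phi x <= z)%R%:R))%:E.
Proof.
have mh : measurable_fun setT (fun w : R => (w <= z)%R%:R : R).
  rewrite (_ : (fun w : R => _) = \1_`]-oo, z]); first exact: measurable_indic.
  by apply/funext => w; rewrite indicE mem_setE in_itv.
have mA : measurable [set w | F w <= z].
  by have := mF measurableT (measurable_itv `]-oo, z]); rewrite setTI set_itvNyc.
rewrite -L1_Ex; last first.
  apply: (@L1_bounded _ _ _ _ _ 1); first exact: (measurableT_comp mh mphi).
  by move=> x; case: (phi x <= z); rewrite /= ?normr1 ?normr0.
rewrite -(expectation_comp_ge0 hX hF (h := fun w => (w <= z)%R%:R))//.
rewrite unlock; transitivity (\int[P]_w (\1_[set v | F v <= z] w)%:E)%E.
  by rewrite integral_indic// setIT.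
apply: eq_integral => w _; congr EFin; rewrite indicE; congr ((nat_of_bool _)%:R).
by apply/idP/idP => [/set_mem|h]//; exact: mem_set.
Qed.

End moments.

Theorem theorem4p3 (R : realType) (k : nat) (M : R) (M_gt0 : 0 < M) :
  exists2 C : R, 0 < C &
  forall (d : measure_display) (T : measurableType d) (P : probability T R)
    (X : nat -> {RV P >-> R}) (p : nat -> R),
  rademacher_sequence X p ->
  forall F : T -> R,
  D12 P X p F ->
  'E_P[F]%E = 0%E ->
  variance P F = 1%E ->
  ('E_P[fun w => (F w ^+ (2 * k))%R] < M%:E)%E ->
  (forall z : R,
    D12 P X p (fun w => F w * stein_sol z (F w) + \1_[set v | z < F v] w)) ->
  Dom_delta P X p
    (fun i w =>
       (Num.sqrt (pq p i))^-1 * D X p i F w * `|D X p i (Linv P X p F) w|) ->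
  forall z : R,
  (`|P [set w | (F w <= z)%R] - (Phi z)%:E| <=
     (C / (1 + `|z|) ^+ k)%:E *
     ((Num.sqrt 15 / 2)%:E * sqrte (B1 P X p F) +
      (Num.sqrt 3 / 2)%:E * sqrte (B2 P X p F) +
      2%:E * sqrte (B3 P X p F) +
      (2 * Num.sqrt 6)%:E * sqrte (B4 P X p F) +
      (2 * Num.sqrt 3)%:E * sqrte (B5 P X p F)))%E.
Proof.
have [Cd Cd0 hCd] := @stein_decay R k.
have CM0 : 0 < Cd * (1 + M) by apply: mulr_gt0 => //; lra.
pose A := Num.sqrt (Cd * (1 + M)); have A0 : 0 < A by rewrite sqrtr_gt0.
exists (2 * A); first by rewrite mulr_gt0.
move=> d T P X p hX F [[hFs hF2] _] EF VF MF _ _ z.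
have hF : has_functional X F by exact: doob_dynkin.
have hp : forall i, 0 < p i < 1 by case: hX.
pose q : R := (1 + `|z|) ^+ k.
have z1 : 0 < 1 + `|z| by have := normr_ge0 z; lra.
have q0 : 0 < q by rewrite exprn_gt0.
have c0 : 0 < 2 * A / q by rewrite divr_gt0// mulr_gt0.
set S := (_ + _ * sqrte (B5 P X p F))%E.
(* An infinite bound is trivial; when it is finite all five quantities are. *)
have [Sfin|] := ltP S +oo%E; last first.
  by rewrite leye_eq => /eqP->; rewrite gt0_muley ?leey// lte_fin.
have term_ge0 (a : R) (B : \bar R) : 0 < a -> (0 <= a%:E * sqrte B)%E.
  by move=> a0; rewrite mule_ge0 ?sqrte_ge0// lee_fin ltW.
have a1 : 0 < Num.sqrt 15 / 2 :> R by rewrite divr_gt0// sqrtr_gt0.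
have a2 : 0 < Num.sqrt 3 / 2 :> R by rewrite divr_gt0// sqrtr_gt0.
have a4 : 0 < 2 * Num.sqrt 6 :> R by rewrite mulr_gt0// sqrtr_gt0.
have a5 : 0 < 2 * Num.sqrt 3 :> R by rewrite mulr_gt0// sqrtr_gt0.
have a3 : 0 < 2 :> R by [].
have addl (x y : \bar R) : (0 <= y)%E -> (x + y < +oo)%E -> (x < +oo)%E.
  by move=> y0; apply: le_lt_trans; rewrite leeDl.
have addr (x y : \bar R) : (0 <= x)%E -> (x + y < +oo)%E -> (y < +oo)%E.
  by move=> y0; apply: le_lt_trans; rewrite leeDr.
have term_fin (a : R) (B : \bar R) : 0 < a -> (0 <= B)%E ->
    (a%:E * sqrte B < +oo)%E -> B = (fine B)%:E.
  move=> a0 B0 h; rewrite fineK// ge0_fin_numE//.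
  by move: B B0 h => [r _ _||] //; [rewrite ltry|rewrite /= gt0_muley ?lte_fin].
have s1 := term_ge0 _ (B1 P X p F) a1; have s2 := term_ge0 _ (B2 P X p F) a2.
have s3 := term_ge0 _ (B3 P X p F) a3; have s4 := term_ge0 _ (B4 P X p F) a4.
have s5 := term_ge0 _ (B5 P X p F) a5.
have f5 := term_fin _ _ a5 (B5_ge0 F hX)
  (addr _ _ (adde_ge0 (adde_ge0 (adde_ge0 s1 s2) s3) s4) Sfin).
have Sf4 := addl _ _ s5 Sfin.
have f4 := term_fin _ _ a4 (B4_ge0 F hX) (addr _ _ (adde_ge0 (adde_ge0 s1 s2) s3) Sf4).
have Sf3 := addl _ _ s4 Sf4.
have f3 := term_fin _ _ a3 (B3_ge0 F hX) (addr _ _ (adde_ge0 s1 s2) Sf3).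
have Sf2 := addl _ _ s3 Sf3.
have f2 := term_fin _ _ a2 (B2_ge0 F hX) (addr _ _ s1 Sf2).
have f1 := term_fin _ _ a1 (B1_ge0 X p F) (addl _ _ s2 Sf2).
have hV : forall m, L4 (sign_law X) (dif p m (cube_lift X F)).
  by apply: (L4_of_B3 hX hF); rewrite f3 ltry.
have g1 := B1_ge0 X p F; have g2 := B2_ge0 F hX; have g3 := B3_ge0 F hX.
have g4 := B4_ge0 F hX; have g5 := B5_ge0 F hX.
have c1 N n := sum_b1_le hX hF hV N n; have c2 N n := sum_b2_le hX hF hV N n.
have c3 N := sum_b3_le hX hF hV N; have c4 N := sum_b4_le hX hF hV N.
have c5 N := sum_b5_le hX hF hV N.
rewrite /S.
move: f1 f2 f3 f4 f5 g1 g2 g3 g4 g5 c1 c2 c3 c4 c5 {s1 s2 s3 s4 s5 Sfin Sf4 Sf3 Sf2 S}.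
move: (B1 P X p F) (B2 P X p F) (B3 P X p F) (B4 P X p F) (B5 P X p F).
move=> E1 E2 E3 E4 E5 -> -> -> -> ->.
move: (fine E1) (fine E2) (fine E3) (fine E4) (fine E5) => {E1 E2 E3 E4 E5} t1 t2 t3 t4 t5.
rewrite !lee_fin => g1 g2 g3 g4 g5.
move=> c1 c2 c3 c4 c5.
pose mu := sign_law X; pose phi := cube_lift X F.
have mphi : measurable_fun setT phi := measurable_lift hF.
have hphi : L2 mu phi.
  by split => //; exact: (L1_even_pow hX hF (k := 1) hF2).
have Ephi0 : Ex mu phi = 0.
  by have := expectation_lift hX hF (L2_L1 hphi); rewrite EF => -[].
have Ephi1 : Ex mu (fun x => phi x ^+ 2) = 1.
  have E2 : 'E_P[fun w => (F w ^+ (2 * 1))%R]%E = 1%E.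
    rewrite -VF /variance covariance.unlock EF /=; congr ('E_P[_])%E.
    by apply/funext => w; rewrite -[RHS]/((F w - 0) * (F w - 0)) subr0 expr2.
  by move: E2; rewrite (expectation_even_pow hX hF 1) (L1_Ex hphi.2) => -[].
have hk : L1 mu (fun x => phi x ^+ (2 * k)).
  by apply: (L1_even_pow hX hF); apply: lt_trans MF _; rewrite ltry.
have hkM : Ex mu (fun x => phi x ^+ (2 * k)) <= M.
  by move: MF; rewrite (expectation_even_pow hX hF k) (L1_Ex hk) lte_fin => /ltW.
have hlaw := @sign_law_flip _ _ _ _ _ _ hX.
have h1 N n : \sum_(l < n) b1 p mu phi N l <= t1 by have := c1 N n; rewrite lee_fin.
have h2 N n : \sum_(l < n) b2 p mu phi N l <= t2 by have := c2 N n; rewrite lee_fin.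
have h3 N : \sum_(m < N) b3 p mu phi m <= t3 by have := c3 N; rewrite lee_fin.
have h4 N : \sum_(m < N) \sum_(l < N) b4 p mu phi m l <= t4.
  by have := c4 N; rewrite lee_fin.
have h5 N : \sum_(m < N) \sum_(l < N) b5 p mu phi m l <= t5.
  by have := c5 N; rewrite lee_fin.
have main := cube_stein_bound hp hlaw hphi hV z Ephi0 Ephi1 h1 h2 h3 h4 h5.
rewrite (probability_le_lift hX hF z) -EFinB abse_EFin.
(* The only place where the moment of order [2 * k] is used. *)
have decay (h : R -> R) : measurable_fun setT h -> (forall w, `|h w| <= 2) ->
    (forall w, h w ^+ 2 <= Cd * (1 + w ^+ (2 * k)) / (1 + `|z|) ^+ (2 * k)) ->
    Num.sqrt (Ex mu (fun x => h (phi x) ^+ 2)) <= A / q.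
  move=> mh hb hle.
  have -> : A / q = Num.sqrt (Cd * (1 + M) / (1 + `|z|) ^+ (2 * k)).
    rewrite sqrtrM ?(ltW CM0)// sqrtrV; last by rewrite exprn_ge0// ltW.
    by rewrite mulnC exprM sqrtr_sqr ger0_norm// ltW.
  apply: ler_wsqrtr.
  have ik : L1 mu (fun x => 1 + phi x ^+ (2 * k)) by apply: L1D => //; exact: L1_cst.
  have hL : L2 mu (h \o phi) by exact: (L2_bounded_comp hphi mh hb).
  apply: (@le_trans _ _ (Ex mu (fun x => Cd / (1 + `|z|) ^+ (2 * k) * (1 + phi x ^+ (2 * k))))).
    apply: Ex_le; [exact: hL.2|exact: L1Z|move=> x].
    by apply: (le_trans (hle (phi x))); rewrite mulrAC.
  rewrite (ExZ _ ik) (ExD (L1_cst mu 1) hk) Ex_cst mulrAC ler_wpM2r//.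
  by apply: ler_wpM2l; [exact: ltW|lra].
have d1 := decay _ (measurable_stein_deriv z) (norm_stein_deriv_le z) (fun w => (hCd z w).1).
have d2 := decay _ (measurable_stein_mono z) (norm_stein_mono_le z) (fun w => (hCd z w).2).
have sqrteE (r : R) : sqrte r%:E = (Num.sqrt r)%:E by [].
rewrite !sqrteE -!EFinM lee_fin.
apply: (le_trans main).
(* The constant 6 obtained in front of [t1] is enlarged to 15; the factor 2 in the
   witness pays for the halves in the first two coefficients. *)
have r1 : Num.sqrt (3 * (2 * t1 + t2)) <= Num.sqrt 15 * Num.sqrt t1 + Num.sqrt 3 * Num.sqrt t2.
  have -> : 3 * (2 * t1 + t2) = 6 * t1 + 3 * t2 by ring.
  apply: (le_trans (sqrtrD_le _ _)); [by rewrite mulr_ge0..|].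
  rewrite !sqrtrM//; apply: lerD => //; apply: ler_wpM2r; first exact: sqrtr_ge0.
  by apply: ler_wsqrtr; lra.
have r2 : Num.sqrt (t3 + 3 * (2 * t4 + t5)) <=
    Num.sqrt t3 + (Num.sqrt 6 * Num.sqrt t4 + Num.sqrt 3 * Num.sqrt t5).
  have -> : t3 + 3 * (2 * t4 + t5) = t3 + (6 * t4 + 3 * t5) by ring.
  have p4 : 0 <= 6 * t4 by rewrite mulr_ge0.
  have p5 : 0 <= 3 * t5 by rewrite mulr_ge0.
  apply: (le_trans (sqrtrD_le g3 (addr_ge0 p4 p5))); apply: lerD => //.
  by apply: (le_trans (sqrtrD_le p4 p5)); rewrite !sqrtrM.
apply: (@le_trans _ _ (A / q * (Num.sqrt 15 * Num.sqrt t1 + Num.sqrt 3 * Num.sqrt t2) +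
    A / q * (Num.sqrt t3 + (Num.sqrt 6 * Num.sqrt t4 + Num.sqrt 3 * Num.sqrt t5)))).
  by apply: lerD; apply: ler_pM; rewrite ?sqrtr_ge0.
have Aq0 : 0 <= A / q by rewrite divr_ge0 ?ltW.
rewrite -mulrDr (_ : 2 * A / (1 + `|z|) ^+ k = A / q * 2); last by rewrite -/q; ring.
rewrite -(mulrA (A / q)); apply: ler_wpM2l => //.
have n3 := sqrtr_ge0 t3.
have n4 : 0 <= Num.sqrt 6 * Num.sqrt t4 by rewrite mulr_ge0 ?sqrtr_ge0.
have n5 : 0 <= Num.sqrt 3 * Num.sqrt t5 by rewrite mulr_ge0 ?sqrtr_ge0.
rewrite -!mulrA; lra.
Qed.
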